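(* Let us assume that $\omega\in\mathbf{\Omega}$ does not satisfy the mild strong non-quasianalyticity condition, that is, $$\int_1^{+\infty}\frac{\ln|\omega(t)|}{t^2}\,\ln\frac{t}{\ln|\omega(t)|}\,dt=+\infty .$$ Then there exists some $\omega$-ultradifferential operator with constant coefficients and of convergence type, which is not invertible in $\mathcal{D}_\rho{}'$ for any $\rho\in\mathbf{\Omega}$ satisfying $$|\omega(t)|\le c_0\,|\rho(t)|,\qquad t\in\mathbb{R},$$ for some constant $c_0>0$.
   Context: $\mathbf{\Omega}$ denotes the set of all entire functions of the form $\omega(z)=\prod_{j=1}^{\infty}\big(1+\frac{iz}{t_j}\big)$, $z\in\mathbb{C}$, where $0<t_1\le t_2\le t_3\le\dots\le+\infty$, $t_1<+\infty$, $\sum_{j\ge1}\frac1{t_j}<+\infty$ (with $\frac{1}{+\infty}=0$). A function $\omega\in\mathbf{\Omega}$ satisfies the mild strong non-quasianalyticity condition if $\int_1^{+\infty}\frac{\ln|\omega(t)|}{t^2}\ln\frac{t}{\ln|\omega(t)|}\,dt<+\infty$. For $\omega\in\mathbf{\Omega}$ and $K\subset\mathbb{R}$ compact, $\mathcal{D}_\omega(K)$ is the Fréchet space of all continuous $\varphi:\mathbb{R}\to\mathbb{C}$ with $\mathrm{supp}(\varphi)\subset K$ and $p_{\omega,n}(\varphi):=\sup_{t\in\mathbb{R}}|\widehat\varphi(t)\,\omega(t)^n|<+\infty$ for all integers $n\ge1$, topologized by the norms $p_{\omega,n}$; here $\widehat\varphi(t)=\frac1{2\pi}\int_{-\infty}^{+\infty}\varphi(s)e^{-its}\,ds$.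 $\mathcal{D}_\omega$ is the (locally convex) inductive limit of the $\mathcal{D}_\omega(K)$ over compact $K\subset\mathbb{R}$, and $\mathcal{D}_\omega{}'$ is its strong dual. $\mathcal{D}_\omega$ is regarded as a dense subspace of $\mathcal{D}_\omega{}'$ by identifying $\varphi$ with the functional $\psi\mapsto\int_{-\infty}^{+\infty}\varphi(s)\psi(s)\,ds$. An $\omega$-ultradifferential operator is a linear map $T:\mathcal{D}_\omega\to\mathcal{D}_\omega$ with $\mathrm{supp}(T\varphi)\subset\mathrm{supp}(\varphi)$ for all $\varphi$; it has constant coefficients if it commutes with all translations. Those with constant coefficients are exactly the operators $f(D)$ given by $\widehat{(f(D)\varphi)}(t)=f(it)\widehat\varphi(t)$ ($\varphi\in\mathcal{D}_\omega$, $t\in\mathbb{R}$), where $f$ is an entire function of exponential type $0$ with $|f(it)|\le d_0|\omega(t)^{n_0}|$, $t\in\mathbb{R}$, for some integer $n_0\ge1$ and some $d_0>0$. Such an $f(D)$ is of convergence type if there are an integer $n_1\ge1$ and $d_1>0$ with $|f(z)|\le d_1\big|\omega(|z|)^{n_1}\big|$ for all $z\in\mathbb{C}$. Every $f(D)$ extends uniquely to a continuous linear operator $\mathcal{D}_\omega{}'\to\mathcal{D}_\omega{}'$, still denoted $f(D)$. If $\rho\in\mathbf{\Omega}$ and $|\omega(t)|\le c_0|\rho(t)|$ for all $t\in\mathbb{R}$, with $c_0>0$ a constant, then $\mathcal{D}_\rho\subset\mathcal{D}_\omega$ and $f(D)$ is also a $\rho$-ultradifferential operator with constant coefficients. $f(D)$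 is called invertible in $\mathcal{D}_\rho{}'$ if $f(D)\mathcal{D}_\rho{}'=\mathcal{D}_\rho{}'$, i.e. if $f(D):\mathcal{D}_\rho{}'\to\mathcal{D}_\rho{}'$ is surjective. *)

(* Defs.v *)
From Stdlib Require Import Reals Lra Lia.
From Stdlib Require Import FunctionalExtensionality ProofIrrelevance.
From Coquelicot Require Import Coquelicot.

Open Scope R_scope.

(** * The class Omega *)

Fixpoint Cprod (u : nat -> C) (n : nat) : C :=
  match n with
  | O => RtoC 1
  | S m => Cmult (Cprod u m) (u m)
  end.

(* [t j] stands for t_{j+1}; [Rbar_inv p_infty = 0], so a value +oo
   contributes the trivial factor 1 to the product. *)
Definition in_Omega (omega : C -> C) : Prop :=
  exists t : nat -> Rbar,
    Rbar_lt (Finite 0) (t O) /\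
    Rbar_lt (t O) p_infty /\
    (forall j, Rbar_le (t j) (t (S j))) /\
    ex_series (fun j => real (Rbar_inv (t j))) /\
    forall z : C,
      filterlim
        (Cprod (fun j => (1 + Ci * z * RtoC (real (Rbar_inv (t j))))%C))
        eventually (locally (omega z)).

Definition mild_integrand (omega : C -> C) (t : R) : R :=
  ln (Cmod (omega (RtoC t))) / t ^ 2 * ln (t / ln (Cmod (omega (RtoC t)))).

(** * Test functions *)

Definition supp (phi : R -> C) : R -> Prop :=
  adherence (fun x => phi x <> RtoC 0).

Definition Cint (g : R -> C) : C :=
  RInt_gen (V := C_R_CompleteNormedModule) g
    (Rbar_locally m_infty) (Rbar_locally p_infty).

(* exp (i x) *)
Definition cis (x : R) : C := (cos x, sin x).

Definition fourier (phi : R -> C) (t : R) : C :=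
  (RtoC (/ (2 * PI)) *
   Cint (fun s => (phi s * cis (- (t * s))%R)%C))%C.

Definition pnorm (omega : C -> C) (n : nat) (phi : R -> C) : Rbar :=
  Lub_Rbar (fun y => exists t : R,
    y = Cmod (fourier phi t * omega (RtoC t) ^ n)%C).

Definition in_DK (omega : C -> C) (K : R -> Prop) (phi : R -> C) : Prop :=
  (forall x, continuous phi x) /\
  included (supp phi) K /\
  forall n, (1 <= n)%nat -> Rbar_lt (pnorm omega n phi) p_infty.

Definition in_D (omega : C -> C) (phi : R -> C) : Prop :=
  exists K, compact K /\ in_DK omega K phi.

Definition Dspace (omega : C -> C) : Type := {phi : R -> C | in_D omega phi}.

Definition D_fun {omega : C -> C} (phi : Dspace omega) : R -> C := proj1_sig phi.
Coercion D_fun : Dspace >-> Funclass.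

Lemma D_ext omega (phi psi : Dspace omega) :
  (forall s, phi s = psi s) -> phi = psi.
Proof.
destruct phi as [f Hf], psi as [g Hg]; unfold D_fun; simpl; intros H.
assert (E : f = g) by (apply functional_extensionality; exact H).
subst g; f_equal; apply proof_irrelevance.
Qed.

(** ** Vector space structure *)

Lemma supp_out (phi : R -> C) (M : R) :
  (forall x, M < Rabs x -> phi x = RtoC 0) <->
  included (supp phi) (fun c => - M <= c <= M).
Proof.
split.
- intros H x Hx.
  destruct (Rle_dec (Rabs x) M) as [Hl|Hl].
  + apply Rabs_le_between; exact Hl.
  + exfalso. assert (Hd : 0 < Rabs x - M) by lra.
    destruct (Hx (disc x (mkposreal _ Hd))) as [y [Hy1 Hy2]].
    { exists (mkposreal _ Hd). intros y Hy; exact Hy. }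
    apply Hy2, H. unfold disc in Hy1; simpl in Hy1.
    generalize (Rabs_triang_inv x y); rewrite (Rabs_minus_sym x y); lra.
- intros H x Hx.
  destruct (Ceq_dec (phi x) (RtoC 0)) as [E|E]; [exact E|exfalso].
  assert (A : supp phi x).
  { intros V [d Hd]; exists x; split; [|exact E].
    apply Hd; unfold disc; rewrite Rminus_diag, Rabs_R0; apply cond_pos. }
  apply H, Rabs_le_between in A; lra.
Qed.

Lemma in_D_iff omega phi :
  in_D omega phi <->
  (forall x, continuous phi x) /\
  (exists M, forall x, M < Rabs x -> phi x = RtoC 0) /\
  (forall n, (1 <= n)%nat -> exists B, forall t,
      Cmod (fourier phi t * omega (RtoC t) ^ n)%C <= B).
Proof.
assert (P : forall n, Rbar_lt (pnorm omega n phi) p_infty <->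
  exists B, forall t, Cmod (fourier phi t * omega (RtoC t) ^ n)%C <= B).
{ intros n; unfold pnorm.
  match goal with |- Rbar_lt (Lub_Rbar ?E) _ <-> _ =>
    destruct (Lub_Rbar_correct E) as [Hub Hlub];
    destruct (Lub_Rbar E) as [l| |] end; split; intros H; try easy.
  - exists l; intros t; apply (Hub _ (ex_intro _ t eq_refl)).
  - destruct H as [B HB].
    apply (Hlub (Finite B)); intros y [t ->]; apply HB.
  - destruct (Hub _ (ex_intro _ 0 eq_refl)). }
split.
- intros [K [HK [Hc [Hs Hp]]]]; split; [exact Hc|split].
  + destruct (compact_P1 K HK) as [m [M HM]].
    exists (Rmax (Rabs m) (Rabs M)); apply supp_out.
    intros x Hx; apply Rabs_le_between.
    destruct (HM x (Hs x Hx)).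
    generalize (RmaxAbs m x M); tauto.
  + intros n Hn; apply P, Hp, Hn.
- intros [Hc [[M HM] Hp]].
  exists (fun c => - M <= c <= M); split; [apply compact_P3|].
  split; [exact Hc|split; [apply supp_out, HM|]].
  intros n Hn; apply P, Hp, Hn.
Qed.

Lemma ex_Cint (g : R -> C) (M : R) :
  (forall x, continuous (U := C_R_NormedModule) g x) ->
  (forall x, M < Rabs x -> g x = RtoC 0) ->
  ex_RInt_gen (V := C_R_NormedModule) g
    (Rbar_locally m_infty) (Rbar_locally p_infty).
Proof.
intros Hc HM.
pose (m := Rmax M 0).
assert (Hm0 : 0 <= m) by apply Rmax_r.
assert (HmM : M <= m) by apply Rmax_l.
assert (Z : forall a b, (forall x, a < x < b -> g x = RtoC 0) -> a <= b ->
  is_RInt (V := C_R_NormedModule) g a b zero).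
{ intros a b H Hab.
  apply (is_RInt_ext (V := C_R_NormedModule) (fun _ => zero)).
  - intros x Hx; rewrite Rmin_left, Rmax_right in Hx by lra.
    symmetry; apply H, Hx.
  - pose proof (is_RInt_const (V := C_R_NormedModule) a b zero) as I.
    exact (eq_ind _ (is_RInt (V := C_R_NormedModule) (fun _ => zero) a b) I _
      (scal_zero_r (V := C_R_NormedModule) (b - a))). }
exists (RInt (V := C_R_CompleteNormedModule) g (- m) m).
intros P HP.
exists (fun x => x < - m) (fun x => m < x).
- exists (- m); auto.
- exists m; auto.
- intros x y Hx Hy; simpl.
  exists (RInt (V := C_R_CompleteNormedModule) g (- m) m).
  split; [|apply locally_singleton, HP].
  rewrite <- (plus_zero_l (G := C_R_NormedModule)
    (RInt (V := C_R_CompleteNormedModule) g (- m) m)).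
  apply (is_RInt_Chasles (V := C_R_NormedModule)) with (- m).
  + apply Z; [|lra]. intros s Hs; apply HM.
    rewrite Rabs_left by lra; lra.
  + rewrite <- (plus_zero_r (G := C_R_NormedModule)
      (RInt (V := C_R_CompleteNormedModule) g (- m) m)).
    apply (is_RInt_Chasles (V := C_R_NormedModule)) with m.
    * apply (RInt_correct (V := C_R_CompleteNormedModule)).
      apply (ex_RInt_continuous (V := C_R_CompleteNormedModule)); auto.
    * apply Z; [|lra]. intros s Hs; apply HM.
      rewrite Rabs_right by lra; lra.
Qed.

Lemma is_RInt_Cmult (c : C) (g : R -> C) (a b : R) (l : C) :
  is_RInt (V := C_R_NormedModule) g a b l ->
  is_RInt (V := C_R_NormedModule) (fun s => (c * g s)%C) a b (c * l)%C.
Proof.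
intros H.
pose proof (is_RInt_fct_extend_fst (U := R_NormedModule) (V := R_NormedModule)
  g a b l H) as H1.
pose proof (is_RInt_fct_extend_snd (U := R_NormedModule) (V := R_NormedModule)
  g a b l H) as H2.
apply (is_RInt_fct_extend_pair (U := R_NormedModule) (V := R_NormedModule)).
- apply (is_RInt_minus (V := R_NormedModule)
    (fun s => scal (fst c) (fst (g s))) (fun s => scal (snd c) (snd (g s))));
  apply (is_RInt_scal (V := R_NormedModule)); assumption.
- apply (is_RInt_plus (V := R_NormedModule)
    (fun s => scal (fst c) (snd (g s))) (fun s => scal (snd c) (fst (g s))));
  apply (is_RInt_scal (V := R_NormedModule)); assumption.
Qed.

Lemma continuous_Cmult_l (c : C) : forall z : C,
  filterlim (fun w => (c * w)%C) (locally z) (locally (c * z)%C).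
Proof.
intros z; apply (filterlim_scal_r (K := C_AbsRing) (V := C_NormedModule)).
Qed.

Lemma is_RInt_gen_Cmult (c : C) (g : R -> C) Fa Fb (l : C)
  {FFa : Filter Fa} {FFb : Filter Fb} :
  is_RInt_gen (V := C_R_NormedModule) g Fa Fb l ->
  is_RInt_gen (V := C_R_NormedModule) (fun s => (c * g s)%C) Fa Fb (c * l)%C.
Proof.
intros H P HP.
destruct (H _ (continuous_Cmult_l c l P HP)) as [Q S HQ HS HH].
exists Q S; [exact HQ|exact HS|].
intros x y Hx Hy; destruct (HH x y Hx Hy) as [I [HI1 HI2]].
exists (c * I)%C; split; [apply is_RInt_Cmult, HI1|exact HI2].
Qed.

Lemma Cint_lin (a b : C) (f g : R -> C) (M : R) :
  (forall x, continuous f x) -> (forall x, continuous g x) ->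
  (forall x, M < Rabs x -> f x = RtoC 0) ->
  (forall x, M < Rabs x -> g x = RtoC 0) ->
  Cint (fun s => a * f s + b * g s)%C = (a * Cint f + b * Cint g)%C.
Proof.
intros cf cg Mf Mg.
assert (I : forall h, (forall x, continuous (U := C_UniformSpace) h x) ->
  (forall x, M < Rabs x -> h x = RtoC 0) ->
  is_RInt_gen (V := C_R_NormedModule) h
    (Rbar_locally m_infty) (Rbar_locally p_infty) (Cint h)).
{ intros h ch Mh.
  exact (RInt_gen_correct (V := C_R_CompleteNormedModule) h
    (ex_Cint h M ch Mh)). }
exact (is_RInt_gen_unique (V := C_R_CompleteNormedModule) _ _
  (is_RInt_gen_plus (V := C_R_NormedModule) _ _ _ _
    (is_RInt_gen_Cmult a f _ _ _ (I f cf Mf))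
    (is_RInt_gen_Cmult b g _ _ _ (I g cg Mg)))).
Qed.

Lemma continuous_Cpair (u v : R -> R) x :
  continuous u x -> continuous v x -> continuous (fun s => (u s, v s) : C) x.
Proof.
intros Hu Hv.
apply (filterlim_comp_2 (G := locally (u x)) (H := locally (v x))
  u v (fun a b => (a, b) : C)); [exact Hu|exact Hv|].
intros P [d Hd].
exists (ball (u x) d) (ball (v x) d).
- apply locally_ball.
- apply locally_ball.
- intros a b Ha Hb; apply Hd; split; assumption.
Qed.

Lemma continuous_CRe (f : R -> C) x :
  continuous f x -> continuous (fun s => fst (f s)) x.
Proof.
intros H; apply (continuous_comp f (fun z : R * R => fst z)); [exact H|].
apply continuous_fst.
Qed.

Lemma continuous_CIm (f : R -> C) x :
  continuous f x -> continuous (fun s => snd (f s)) x.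
Proof.
intros H; apply (continuous_comp f (fun z : R * R => snd z)); [exact H|].
apply continuous_snd.
Qed.

Lemma continuous_Cplus (f g : R -> C) x :
  continuous f x -> continuous g x -> continuous (fun s => (f s + g s)%C) x.
Proof.
intros Hf Hg; apply continuous_Cpair;
  apply (continuous_plus (V := R_NormedModule));
  (apply continuous_CRe || apply continuous_CIm); assumption.
Qed.

Lemma continuous_Cmult (f g : R -> C) x :
  continuous f x -> continuous g x -> continuous (fun s => (f s * g s)%C) x.
Proof.
intros Hf Hg; apply continuous_Cpair;
[apply (continuous_minus (V := R_NormedModule))
|apply (continuous_plus (V := R_NormedModule))];
apply (continuous_mult (K := R_AbsRing));
  (apply continuous_CRe || apply continuous_CIm); assumption.
Qed.

Lemma continuous_cis t x : continuous (fun s => cis (- (t * s))) x.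
Proof.
assert (H : continuous (fun s => - (t * s)) x).
{ apply (continuous_opp (V := R_NormedModule)).
  apply (continuous_mult (K := R_AbsRing));
    [apply continuous_const|apply continuous_id]. }
apply continuous_Cpair.
- apply (continuous_comp (fun s => - (t * s)) cos); [exact H|].
  apply continuous_cos.
- apply (continuous_comp (fun s => - (t * s)) sin); [exact H|].
  apply continuous_sin.
Qed.

Lemma fourier_lin (a b : C) (f g : R -> C) (M : R) (t : R) :
  (forall x, continuous f x) -> (forall x, continuous g x) ->
  (forall x, M < Rabs x -> f x = RtoC 0) ->
  (forall x, M < Rabs x -> g x = RtoC 0) ->
  fourier (fun s => a * f s + b * g s)%C t =
  (a * fourier f t + b * fourier g t)%C.
Proof.
intros cf cg Mf Mg; unfold fourier.
replace (fun s => ((a * f s + b * g s) * cis (- (t * s)))%C)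
  with (fun s => (a * (f s * cis (- (t * s))) + b * (g s * cis (- (t * s))))%C)
  by (apply functional_extensionality; intros s; ring).
rewrite (Cint_lin a b _ _ M); [ring| | | |].
- intros x; apply continuous_Cmult; [apply cf|apply continuous_cis].
- intros x; apply continuous_Cmult; [apply cg|apply continuous_cis].
- intros x Hx; rewrite Mf by exact Hx; ring.
- intros x Hx; rewrite Mg by exact Hx; ring.
Qed.

Lemma in_D_lin omega (a b : C) (f g : R -> C) :
  in_D omega f -> in_D omega g -> in_D omega (fun s => a * f s + b * g s)%C.
Proof.
rewrite !in_D_iff.
intros [cf [[M HM] pf]] [cg [[N HN] pg]].
assert (HM' : forall x, Rmax M N < Rabs x -> f x = RtoC 0).
{ intros x Hx; apply HM; generalize (Rmax_l M N); lra. }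
assert (HN' : forall x, Rmax M N < Rabs x -> g x = RtoC 0).
{ intros x Hx; apply HN; generalize (Rmax_r M N); lra. }
split; [|split].
- intros x; apply continuous_Cplus; apply continuous_Cmult; auto;
  apply continuous_const.
- exists (Rmax M N); intros x Hx.
  rewrite HM', HN' by exact Hx; ring.
- intros n Hn; destruct (pf n Hn) as [A HA], (pg n Hn) as [B HB].
  exists (Cmod a * A + Cmod b * B); intros t.
  rewrite (fourier_lin a b f g (Rmax M N)) by assumption.
  replace ((a * fourier f t + b * fourier g t) * omega (RtoC t) ^ n)%C
    with (a * (fourier f t * omega (RtoC t) ^ n)
          + b * (fourier g t * omega (RtoC t) ^ n))%C by ring.
  eapply Rle_trans; [apply Cmod_triangle|]; rewrite !Cmod_mult.
  rewrite <- !Cmod_mult, (Cmod_mult a), (Cmod_mult b).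
  apply Rplus_le_compat; apply Rmult_le_compat_l;
    auto using Cmod_ge_0.
Qed.

Lemma in_D_zero omega : in_D omega (fun _ => RtoC 0).
Proof.
assert (Hf : forall t, fourier (fun _ => RtoC 0) t = RtoC 0).
{ intros t.
  replace (fun _ : R => RtoC 0)
    with (fun _ : R => (RtoC 0 * RtoC 0 + RtoC 0 * RtoC 0)%C)
    by (apply functional_extensionality; intros s; ring).
  rewrite (fourier_lin _ _ (fun _ => RtoC 0) (fun _ => RtoC 0) 0); auto;
  try (intros x; apply continuous_const); ring. }
apply in_D_iff; split; [intros x; apply continuous_const|split].
- exists 0; reflexivity.
- intros n _; exists 0; intros t; rewrite Hf, Cmult_0_l, Cmod_0; lra.
Qed.

Lemma in_D_plus omega (f g : R -> C) :
  in_D omega f -> in_D omega g -> in_D omega (fun s => f s + g s)%C.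
Proof.
intros Hf Hg; generalize (in_D_lin omega (RtoC 1) (RtoC 1) f g Hf Hg).
assert (E : (fun s => RtoC 1 * f s + RtoC 1 * g s)%C = (fun s => f s + g s)%C)
  by (apply functional_extensionality; intros s; ring).
rewrite E; auto.
Qed.

Lemma in_D_scal omega (a : C) (f : R -> C) :
  in_D omega f -> in_D omega (fun s => a * f s)%C.
Proof.
intros Hf; generalize (in_D_lin omega a (RtoC 0) f f Hf Hf).
assert (E : (fun s => a * f s + RtoC 0 * f s)%C = (fun s => a * f s)%C)
  by (apply functional_extensionality; intros s; ring).
rewrite E; auto.
Qed.

Definition D_zero omega : Dspace omega :=
  exist _ (fun _ => RtoC 0) (in_D_zero omega).

Definition D_plus {omega} (phi psi : Dspace omega) : Dspace omega :=
  exist _ (fun s => phi s + psi s)%C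
    (in_D_plus omega _ _ (proj2_sig phi) (proj2_sig psi)).

Definition D_scal {omega} (a : C) (phi : Dspace omega) : Dspace omega :=
  exist _ (fun s => a * phi s)%C (in_D_scal omega a _ (proj2_sig phi)).

Definition D_opp {omega} (phi : Dspace omega) : Dspace omega :=
  D_scal (RtoC (-1)) phi.

Lemma D_plus_comm omega (x y : Dspace omega) : D_plus x y = D_plus y x.
Proof. apply D_ext; intros s; apply Cplus_comm. Qed.

Lemma D_plus_assoc omega (x y z : Dspace omega) :
  D_plus x (D_plus y z) = D_plus (D_plus x y) z.
Proof. apply D_ext; intros s; apply Cplus_assoc. Qed.

Lemma D_plus_zero omega (x : Dspace omega) : D_plus x (D_zero omega) = x.
Proof. apply D_ext; intros s; apply Cplus_0_r. Qed.

Definition D_AbelianMonoid_mixin omega :=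
  AbelianMonoid.Mixin (Dspace omega) D_plus (D_zero omega)
    (D_plus_comm omega) (D_plus_assoc omega) (D_plus_zero omega).

Canonical D_AbelianMonoid omega :=
  AbelianMonoid.Pack (Dspace omega) (D_AbelianMonoid_mixin omega) (Dspace omega).

Lemma D_plus_opp omega (x : Dspace omega) : plus x (D_opp x) = zero.
Proof.
apply D_ext; intros s.
change (x s + RtoC (-1) * x s = RtoC 0)%C.
apply injective_projections; simpl; ring.
Qed.

Canonical D_AbelianGroup omega :=
  AbelianGroup.Pack (Dspace omega)
    (AbelianGroup.Class (Dspace omega) (D_AbelianMonoid_mixin omega)
      (AbelianGroup.Mixin (D_AbelianMonoid omega) D_opp (D_plus_opp omega)))
    (Dspace omega).

Lemma D_scal_assoc omega (a b : C_Ring) (x : Dspace omega) :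
  D_scal a (D_scal b x) = D_scal (mult a b) x.
Proof. apply D_ext; intros s; apply Cmult_assoc. Qed.

Lemma D_scal_one omega (x : Dspace omega) : D_scal (one : C_Ring) x = x.
Proof. apply D_ext; intros s; apply Cmult_1_l. Qed.

Lemma D_scal_plus_r omega (a : C_Ring) (x y : Dspace omega) :
  D_scal a (plus x y) = plus (D_scal a x) (D_scal a y).
Proof. apply D_ext; intros s; apply Cmult_plus_distr_l. Qed.

Lemma D_scal_plus_l omega (a b : C_Ring) (x : Dspace omega) :
  D_scal (plus a b) x = plus (D_scal a x) (D_scal b x).
Proof. apply D_ext; intros s; apply Cmult_plus_distr_r. Qed.

Canonical D_ModuleSpace omega :=
  ModuleSpace.Pack C_Ring (Dspace omega)
    (ModuleSpace.Class C_Ring (Dspace omega) (AbelianGroup.class (D_AbelianGroup omega))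
      (ModuleSpace.Mixin C_Ring (D_AbelianGroup omega) D_scal
        (D_scal_assoc omega) (D_scal_one omega)
        (D_scal_plus_r omega) (D_scal_plus_l omega)))
    (Dspace omega).

(** * Locally convex inductive limit topology *)

(* Neighbourhoods of 0 in the Frechet space D_omega(K), seen as a subset of
   D_omega *)
Definition D_nbhs0_K (omega : C -> C) (K : R -> Prop) (U : Dspace omega -> Prop) :
  Prop :=
  exists (n : nat) (eps : posreal), forall phi : Dspace omega,
    in_DK omega K phi ->
    (forall k, (1 <= k <= n)%nat -> Rbar_lt (pnorm omega k phi) eps) ->
    U phi.

Definition abs_convex {V : ModuleSpace C_Ring} (U : V -> Prop) : Prop :=
  forall (x y : V) (a b : C), U x -> U y -> Cmod a + Cmod b <= 1 ->
    U (plus (scal a x) (scal b y)).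

Definition D_nbhs0 (omega : C -> C) (U : Dspace omega -> Prop) : Prop :=
  exists V : Dspace omega -> Prop,
    abs_convex V /\ (forall phi, V phi -> U phi) /\
    forall K, compact K -> D_nbhs0_K omega K V.

Definition D_nbhs {omega : C -> C} (phi : Dspace omega) (U : Dspace omega -> Prop) :
  Prop := D_nbhs0 omega (fun psi => U (plus phi psi)).

Lemma D_nbhs_filter omega (phi : Dspace omega) : Filter (D_nbhs phi).
Proof.
split.
- exists (fun _ => True); repeat split; auto.
  intros K HK; exists O, (mkposreal 1 Rlt_0_1); auto.
- intros P Q [V [V1 [V2 V3]]] [W [W1 [W2 W3]]].
  exists (fun x => V x /\ W x); split; [|split].
  + intros x y a b [? ?] [? ?] ?; split; auto.
  + intros x []; auto.
  + intros K HK.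
    destruct (V3 K HK) as [n [e He]], (W3 K HK) as [m [d Hd]].
    exists (max n m), (mkposreal _ (Rmin_stable_in_posreal e d)).
    intros x Hx Hp; split.
    * apply He; [exact Hx|intros k Hk].
      eapply Rbar_lt_le_trans; [apply Hp; lia|apply Rmin_l].
    * apply Hd; [exact Hx|intros k Hk].
      eapply Rbar_lt_le_trans; [apply Hp; lia|apply Rmin_r].
- intros P Q H [V [V1 [V2 V3]]]; exists V; auto.
Qed.

Definition D_bounded {omega : C -> C} (B : Dspace omega -> Prop) : Prop :=
  forall U, D_nbhs0 omega U ->
    exists r : posreal, forall (c : C) (phi : Dspace omega),
      Cmod c <= r -> B phi -> U (scal c phi).

(** * The strong dual *)

Definition linear_map {V W : ModuleSpace C_Ring} (T : V -> W) : Prop :=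
  (forall x y, T (plus x y) = plus (T x) (T y)) /\
  (forall (a : C) x, T (scal a x) = scal a (T x)).

Definition in_dual (omega : C -> C) (L : Dspace omega -> C) : Prop :=
  linear_map L /\ forall phi, filterlim L (D_nbhs phi) (locally (L phi)).

Definition dual (omega : C -> C) : Type := {L : Dspace omega -> C | in_dual omega L}.

Definition dual_fun {omega : C -> C} (L : dual omega) : Dspace omega -> C :=
  proj1_sig L.
Coercion dual_fun : dual >-> Funclass.

Lemma dual_ext omega (L M : dual omega) :
  (forall phi, L phi = M phi) -> L = M.
Proof.
destruct L as [f Hf], M as [g Hg]; unfold dual_fun; simpl; intros H.
assert (E : f = g) by (apply functional_extensionality; exact H).
subst g; f_equal; apply proof_irrelevance.
Qed.

Lemma in_dual_zero omega : in_dual omega (fun _ => RtoC 0).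
Proof.
split; [split|].
- intros x y; symmetry; apply Cplus_0_r.
- intros a x; symmetry; apply Cmult_0_r.
- intros phi P HP.
  generalize (D_nbhs_filter omega phi); intros F.
  apply (filter_forall (F := D_nbhs phi)); intros psi.
  apply (locally_singleton (T := C_UniformSpace) (RtoC 0)), HP.
Qed.

Lemma in_dual_plus omega (L M : Dspace omega -> C) :
  in_dual omega L -> in_dual omega M ->
  in_dual omega (fun phi => (L phi + M phi)%C).
Proof.
intros [[L1 L2] L3] [[M1 M2] M3]; split; [split|].
- intros x y; rewrite L1, M1.
  change ((L x + L y) + (M x + M y) = (L x + M x) + (L y + M y))%C; ring.
- intros a x; rewrite L2, M2.
  change (a * L x + a * M x = a * (L x + M x))%C; ring.
- intros phi; generalize (D_nbhs_filter omega phi); intros F.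
  exact (filterlim_comp_2 L M Cplus (L3 phi) (M3 phi)
    (filterlim_plus (K := C_AbsRing) (V := C_NormedModule) _ _)).
Qed.

Lemma in_dual_scal omega (a : C) (L : Dspace omega -> C) :
  in_dual omega L -> in_dual omega (fun phi => (a * L phi)%C).
Proof.
intros [[L1 L2] L3]; split; [split|].
- intros x y; rewrite L1.
  change (a * (L x + L y) = a * L x + a * L y)%C; ring.
- intros b x; rewrite L2.
  change (a * (b * L x) = b * (a * L x))%C; ring.
- intros phi; eapply filterlim_comp; [apply L3|apply continuous_Cmult_l].
Qed.

Definition dual_zero omega : dual omega :=
  exist _ (fun _ => RtoC 0) (in_dual_zero omega).

Definition dual_plus {omega} (L M : dual omega) : dual omega :=
  exist _ (fun phi => L phi + M phi)%C
    (in_dual_plus omega _ _ (proj2_sig L) (proj2_sig M)).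

Definition dual_scal {omega} (a : C) (L : dual omega) : dual omega :=
  exist _ (fun phi => a * L phi)%C (in_dual_scal omega a _ (proj2_sig L)).

Definition dual_opp {omega} (L : dual omega) : dual omega :=
  dual_scal (RtoC (-1)) L.

Lemma dual_plus_comm omega (x y : dual omega) : dual_plus x y = dual_plus y x.
Proof. apply dual_ext; intros phi; apply Cplus_comm. Qed.

Lemma dual_plus_assoc omega (x y z : dual omega) :
  dual_plus x (dual_plus y z) = dual_plus (dual_plus x y) z.
Proof. apply dual_ext; intros phi; apply Cplus_assoc. Qed.

Lemma dual_plus_zero omega (x : dual omega) : dual_plus x (dual_zero omega) = x.
Proof. apply dual_ext; intros phi; apply Cplus_0_r. Qed.

Definition dual_AbelianMonoid_mixin omega :=
  AbelianMonoid.Mixin (dual omega) dual_plus (dual_zero omega)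
    (dual_plus_comm omega) (dual_plus_assoc omega) (dual_plus_zero omega).

Canonical dual_AbelianMonoid omega :=
  AbelianMonoid.Pack (dual omega) (dual_AbelianMonoid_mixin omega) (dual omega).

Lemma dual_plus_opp omega (x : dual omega) : plus x (dual_opp x) = zero.
Proof.
apply dual_ext; intros phi.
change (x phi + RtoC (-1) * x phi = RtoC 0)%C.
apply injective_projections; simpl; ring.
Qed.

Canonical dual_AbelianGroup omega :=
  AbelianGroup.Pack (dual omega)
    (AbelianGroup.Class (dual omega) (dual_AbelianMonoid_mixin omega)
      (AbelianGroup.Mixin (dual_AbelianMonoid omega) dual_opp (dual_plus_opp omega)))
    (dual omega).

Lemma dual_scal_assoc omega (a b : C_Ring) (x : dual omega) :
  dual_scal a (dual_scal b x) = dual_scal (mult a b) x.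
Proof. apply dual_ext; intros phi; apply Cmult_assoc. Qed.

Lemma dual_scal_one omega (x : dual omega) : dual_scal (one : C_Ring) x = x.
Proof. apply dual_ext; intros phi; apply Cmult_1_l. Qed.

Lemma dual_scal_plus_r omega (a : C_Ring) (x y : dual omega) :
  dual_scal a (plus x y) = plus (dual_scal a x) (dual_scal a y).
Proof. apply dual_ext; intros phi; apply Cmult_plus_distr_l. Qed.

Lemma dual_scal_plus_l omega (a b : C_Ring) (x : dual omega) :
  dual_scal (plus a b) x = plus (dual_scal a x) (dual_scal b x).
Proof. apply dual_ext; intros phi; apply Cmult_plus_distr_r. Qed.

Canonical dual_ModuleSpace omega :=
  ModuleSpace.Pack C_Ring (dual omega)
    (ModuleSpace.Class C_Ring (dual omega) (AbelianGroup.class (dual_AbelianGroup omega))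
      (ModuleSpace.Mixin C_Ring (dual_AbelianGroup omega) dual_scal
        (dual_scal_assoc omega) (dual_scal_one omega)
        (dual_scal_plus_r omega) (dual_scal_plus_l omega)))
    (dual omega).

Definition dual_nbhs {omega : C -> C} (L : dual omega) (U : dual omega -> Prop) :
  Prop :=
  exists (B : Dspace omega -> Prop) (eps : posreal), D_bounded B /\
    forall M : dual omega,
      (forall phi, B phi -> Cmod (M phi - L phi)%C < eps) -> U M.

(* [L] is the functional with which the function [phi] is identified *)
Definition represents {omega : C -> C} (L : dual omega) (phi : R -> C) : Prop :=
  forall psi : Dspace omega, L psi = Cint (fun s => phi s * psi s)%C.

(** * Ultradifferential operators *)

Definition ultradiff_op (omega : C -> C) (T : Dspace omega -> Dspace omega) : Prop :=
  linear_map T /\ forall phi, included (supp (T phi)) (supp phi).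

Definition constant_coeff (omega : C -> C) (T : Dspace omega -> Dspace omega) : Prop :=
  forall (a : R) (phi psi : Dspace omega),
    (forall s, psi s = phi (s - a)) -> forall s, T psi s = T phi (s - a).

(* f ranges over the entire functions for which f(D) is defined. *)
Definition symbol (omega f : C -> C) : Prop :=
  (forall z, ex_derive (K := C_AbsRing) (V := C_NormedModule) f z) /\
  (forall eps, 0 < eps ->
     exists A, forall z, Cmod (f z) <= A * exp (eps * Cmod z)) /\
  exists (n0 : nat) (d0 : R), (1 <= n0)%nat /\ 0 < d0 /\
    forall t : R, Cmod (f (Ci * RtoC t)%C) <= d0 * Cmod (omega (RtoC t) ^ n0)%C.

Definition convergence_type (omega f : C -> C) : Prop :=
  exists (n1 : nat) (d1 : R), (1 <= n1)%nat /\ 0 < d1 /\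
    forall z : C, Cmod (f z) <= d1 * Cmod (omega (RtoC (Cmod z)) ^ n1)%C.

(* psi = f(D) phi *)
Definition fD (f : C -> C) (phi psi : R -> C) : Prop :=
  forall t, fourier psi t = (f (Ci * RtoC t) * fourier phi t)%C.

(* S is a continuous linear extension of f(D) to the strong dual of D_rho. *)
Definition dual_extension (rho f : C -> C) (S : dual rho -> dual rho) : Prop :=
  linear_map S /\
  (forall L, filterlim S (dual_nbhs L) (dual_nbhs (S L))) /\
  forall (phi psi : Dspace rho) (L M : dual rho),
    fD f phi psi -> represents L phi -> represents M psi -> S L = M.

(* For f a symbol, S exists and is unique; with the universal quantifier, a
   proof of [~ invertible_in_dual rho f] has to exhibit it. *)
Definition invertible_in_dual (rho f : C -> C) : Prop :=
  forall S : dual rho -> dual rho, dual_extension rho f S ->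
    forall M, exists L, S L = M.

(* Main.v *)
(* The symbol is [f(z) = prod_j (1 + v_j^2 z^2)], where [v_j <= 1/t_j] is [1/t_j]
   rounded down to a power of 1/2: then [|f(z)| <= |omega(|z|)|^2], while all the
   zeros [+- i / v_j] sit at the points [+- i 2^k], with multiplicity [m_k] equal to
   the number of [1/t_j] in the k-th dyadic block.

   If [f(D)] is onto in the dual of [D_rho], a fundamental solution [E] exists, and
   its continuity gives [|phi(0)| <= C sup_t |f(it) phihat(t) rho(t)^n|] for [phi]
   supported in [[-2,2]]. Testing with functions whose Fourier transform is
   concentrated within [O(ln rho(r))] of [r = 2^k], where [f] is at most
   [(C ln rho(r) / r)^(m_k) rho(r)^C], yields [m_k ln (2^k / ln rho(2^k)) <= C ln rho(2^k)]
   up to constants. Since [sum_k 2^(-k) ln rho(2^k)] is finite, Gibbs' inequality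
   [x ln (1/x) <= x ln (1/y) + y] with [y = C 2^(-k) ln rho(2^k)] bounds the integral
   of the theorem; the contributions of different dyadic blocks to [ln omega] decay
   geometrically and [ln (1/y)] varies slowly in [k].

   Every construction with the Fourier transform (second derivatives, [f(D)], its
   symmetry, the delta functional) rests on one bound of [sup |g|] by
   [sup_t (1 + t^2) |ghat(t)|]: second derivatives are uniform limits of symmetric
   second differences, and [f(D)] is the uniform limit of the partial products of
   [1 + v_j^2 D^2]. *)

Require Import Defs.
From Stdlib Require Import Reals Lra Lia Classical.
From Stdlib Require Import FunctionalExtensionality IndefiniteDescription.
From Coquelicot Require Import Coquelicot.
Open Scope R_scope.

(** The continuity of a fundamental solution supplies an unknown power n of rho and an unknown
    constant, so the test functions must beat every power of rho with constants independent of the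
    frequency r = 2^k. Hence there is one fixed mollifier, an infinite convolution of boxes repeated
    with slowly growing multiplicity; only a modulation and q further averages depend on r. Moving
    the frequency to r costs a power of rho(r), since |rho(r + x)| <= |rho(r)|^2 |rho(x)|^2. This
    loss forces q to be of order ln rho(r), and the averages gain exp (- q) only at distance of
    order q from r. The symbol must therefore be small on a whole interval of that length, which is
    why its zeros are gathered at the single points i 2^k. On the real axis omega and rho are seen
    only through |omega(t)|^2 = prod (1 + t^2 / t_j^2). Real products of this shape measure the
    growth of the weights, the size of the symbol and the decay of the test functions, and are
    compared factor by factor. *)

(** * Finite sums and products of reals *)

Fixpoint Rsum (a : nat -> R) (n : nat) : R :=
  match n with O => 0 | S m => Rsum a m + a m end.

Fixpoint Rprod (a : nat -> R) (n : nat) : R :=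
  match n with O => 1 | S m => Rprod a m * a m end.

Lemma Rsum_ext a b n :
  (forall j, (j < n)%nat -> a j = b j) -> Rsum a n = Rsum b n.
Proof.
induction n as [|n IH]; simpl; intros H; [reflexivity|].
rewrite IH, H by (intros; try apply H; lia); reflexivity.
Qed.

Lemma Rsum_le a b n :
  (forall j, (j < n)%nat -> a j <= b j) -> Rsum a n <= Rsum b n.
Proof.
induction n as [|n IH]; simpl; intros H; [lra|].
apply Rplus_le_compat; [apply IH; intros; apply H; lia|apply H; lia].
Qed.

Lemma Rsum_scal k a n : Rsum (fun j => k * a j) n = k * Rsum a n.
Proof. induction n as [|n IH]; simpl; [ring|rewrite IH; ring]. Qed.

Lemma Rsum_plus a b n : Rsum (fun j => a j + b j) n = Rsum a n + Rsum b n.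
Proof. induction n as [|n IH]; simpl; [ring|rewrite IH; ring]. Qed.

Lemma Rsum_0 n : Rsum (fun _ => 0) n = 0.
Proof. induction n as [|n IH]; simpl; [reflexivity|rewrite IH; ring]. Qed.

Lemma Rsum_exchange (a : nat -> nat -> R) n m :
  Rsum (fun i => Rsum (a i) m) n = Rsum (fun j => Rsum (fun i => a i j) n) m.
Proof.
induction n as [|n IH]; simpl; [symmetry; apply Rsum_0|].
rewrite IH, <- Rsum_plus; reflexivity.
Qed.

Lemma Rsum_mono a n m :
  (forall j, 0 <= a j) -> (n <= m)%nat -> Rsum a n <= Rsum a m.
Proof.
intros Ha H; induction H as [|m H IH]; simpl; [lra|].
generalize (Ha m); lra.
Qed.

Lemma Rsum_ge0 a n : (forall j, 0 <= a j) -> 0 <= Rsum a n.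
Proof. intros Ha; apply (Rsum_mono a 0 n Ha); lia. Qed.

Lemma Rsum_ge_term a n j :
  (forall j, 0 <= a j) -> (j < n)%nat -> a j <= Rsum a n.
Proof.
intros Ha H; eapply Rle_trans; [|apply (Rsum_mono a (S j) n Ha H)].
simpl; generalize (Rsum_ge0 a j Ha); lra.
Qed.

Lemma Rprod_pos a n : (forall j, 0 < a j) -> 0 < Rprod a n.
Proof.
intros Ha; induction n as [|n IH]; simpl; [lra|].
apply Rmult_lt_0_compat; auto.
Qed.

Lemma Rprod_ge0 a n : (forall j, 0 <= a j) -> 0 <= Rprod a n.
Proof.
intros Ha; induction n as [|n IH]; simpl; [lra|].
apply Rmult_le_pos; auto.
Qed.

Lemma Rprod_le a b n :
  (forall j, 0 <= a j <= b j) -> Rprod a n <= Rprod b n.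
Proof.
intros H; induction n as [|n IH]; simpl; [lra|].
apply Rmult_le_compat; try apply IH; try apply H.
apply Rprod_ge0; intros j; apply H.
Qed.

Lemma Rprod_mult a b n : Rprod (fun j => a j * b j) n = Rprod a n * Rprod b n.
Proof. induction n as [|n IH]; simpl; [ring|rewrite IH; ring]. Qed.

Lemma Rprod_pow a k n : Rprod (fun j => a j ^ k) n = Rprod a n ^ k.
Proof.
induction n as [|n IH]; simpl; [rewrite pow1; reflexivity|].
rewrite IH, Rpow_mult_distr; reflexivity.
Qed.

Lemma Rprod_ln a n :
  (forall j, 0 < a j) -> ln (Rprod a n) = Rsum (fun j => ln (a j)) n.
Proof.
intros Ha; induction n as [|n IH]; simpl; [apply ln_1|].
rewrite ln_mult, IH; auto; apply Rprod_pos; auto.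
Qed.

Lemma Rprod_mono a n m :
  (forall j, 1 <= a j) -> (n <= m)%nat -> Rprod a n <= Rprod a m.
Proof.
intros Ha H; induction H as [|m H IH]; simpl; [lra|].
eapply Rle_trans; [exact IH|].
rewrite <- (Rmult_1_r (Rprod a m)) at 1.
apply Rmult_le_compat_l; auto.
apply Rprod_ge0; intros j; generalize (Ha j); lra.
Qed.

(** * Summable sequences of nonnegative reals *)

Definition summable (c : nat -> R) : Prop :=
  (forall j, 0 <= c j) /\ exists S, is_lim_seq (Rsum c) (Finite S).

Lemma summable_bound c B :
  (forall j, 0 <= c j) -> (forall n, Rsum c n <= B) -> summable c.
Proof.
intros Hc HB; split; [exact Hc|].
destruct (ex_finite_lim_seq_incr (Rsum c) B) as [S HS].
- intros n; apply Rsum_mono; auto.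
- exact HB.
- exists S; exact HS.
Qed.

Lemma Rsum_le_lim c S n :
  (forall j, 0 <= c j) -> is_lim_seq (Rsum c) (Finite S) -> Rsum c n <= S.
Proof.
intros Hc HS; apply (is_lim_seq_incr_compare (Rsum c) S HS).
intros k; apply Rsum_mono; auto.
Qed.

Lemma summable_bounded c : summable c -> exists B, 0 < B /\ forall n, Rsum c n <= B.
Proof.
intros [Hc [S HS]]; exists (S + 1); split.
- generalize (Rsum_le_lim c S 0 Hc HS); simpl; lra.
- intros n; generalize (Rsum_le_lim c S n Hc HS); lra.
Qed.

Lemma summable_le c d :
  (forall j, 0 <= c j <= d j) -> summable d -> summable c.
Proof.
intros H Hd; destruct (summable_bounded d Hd) as [B [_ HB]].
apply summable_bound with B; [intros j; apply H|].
intros n; eapply Rle_trans; [|apply (HB n)].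
apply Rsum_le; intros j _; apply H.
Qed.

Lemma summable_scal k c : 0 <= k -> summable c -> summable (fun j => k * c j).
Proof.
intros Hk Hc; destruct (summable_bounded c Hc) as [B [_ HB]].
apply summable_bound with (k * B).
- intros j; apply Rmult_le_pos; [exact Hk|apply Hc].
- intros n; rewrite Rsum_scal; apply Rmult_le_compat_l; auto.
Qed.

Lemma summable_plus c d : summable c -> summable d -> summable (fun j => c j + d j).
Proof.
intros Hc Hd; destruct (summable_bounded c Hc) as [B [_ HB]],
  (summable_bounded d Hd) as [B' [_ HB']].
apply summable_bound with (B + B').
- intros j; apply Rplus_le_le_0_compat; [apply Hc|apply Hd].
- intros n; rewrite Rsum_plus; generalize (HB n), (HB' n); lra.
Qed.

Lemma summable_sqr c : summable c -> summable (fun j => c j ^ 2).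
Proof.
intros Hc; destruct (summable_bounded c Hc) as [B [HB0 HB]].
apply summable_le with (fun j => B * c j); [|apply summable_scal; auto; lra].
intros j; pose proof (proj1 Hc j); split; [nra|].
assert (c j <= B).
{ eapply Rle_trans; [|apply (HB (S j))].
  apply Rsum_ge_term; [apply Hc|lia]. }
nra.
Qed.

Lemma summable_half : summable (fun j => (/ 2) ^ j).
Proof.
apply summable_bound with 2.
- intros j; apply pow_le; lra.
- assert (H : forall n, Rsum (fun j => (/ 2) ^ j) n = 2 - 2 * (/ 2) ^ n).
  { induction n as [|n IH]; simpl; [ring|rewrite IH; field]. }
  intros n; rewrite H; generalize (pow_le (/2) n); lra.
Qed.

(** * Complex moduli, and limits with an explicit rate *)

Lemma Cmod_le_abs (z : C) : Cmod z <= Rabs (fst z) + Rabs (snd z).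
Proof.
unfold Cmod.
apply Rsqr_incr_0_var; [|generalize (Rabs_pos (fst z)), (Rabs_pos (snd z)); lra].
rewrite Rsqr_sqrt by nra.
rewrite <- (pow2_abs (fst z)), <- (pow2_abs (snd z)); unfold Rsqr.
generalize (Rabs_pos (fst z)), (Rabs_pos (snd z)); nra.
Qed.

Lemma Cmod_ge_fst (z : C) : Rabs (fst z) <= Cmod z.
Proof. eapply Rle_trans; [apply Rmax_l|apply Rmax_Cmod]. Qed.

Lemma Cmod_ge_snd (z : C) : Rabs (snd z) <= Cmod z.
Proof. eapply Rle_trans; [apply Rmax_r|apply Rmax_Cmod]. Qed.

Lemma Cmod_minus_sym (z w : C) : Cmod (z - w)%C = Cmod (w - z)%C.
Proof. rewrite <- (Cmod_opp (z - w)%C); f_equal; ring. Qed.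

Lemma Cmod_triang3 (a b c : C) : Cmod (a - c)%C <= Cmod (a - b)%C + Cmod (b - c)%C.
Proof.
replace (a - c)%C with ((a - b) + (b - c))%C by ring; apply Cmod_triangle.
Qed.

Lemma Cmod_le_sub (a b : C) : Cmod a <= Cmod (a - b)%C + Cmod b.
Proof. replace a with ((a - b) + b)%C at 1 by ring; apply Cmod_triangle. Qed.

Lemma Cmod_sub_le (a b : C) : Cmod (a - b)%C <= Cmod a + Cmod b.
Proof. rewrite <- (Cmod_opp b); apply (Cmod_triangle a (- b)%C). Qed.

Lemma Cmod_lip (a b : C) : Rabs (Cmod a - Cmod b) <= Cmod (a - b)%C.
Proof.
generalize (Cmod_le_sub a b), (Cmod_le_sub b a); rewrite (Cmod_minus_sym b a).
intros; apply Rabs_le; lra.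
Qed.

Lemma cauchy_complete (u : nat -> R) (e : nat -> R) :
  is_lim_seq e (Finite 0) ->
  (forall n m, (n <= m)%nat -> Rabs (u m - u n) <= e n) ->
  exists l, is_lim_seq u (Finite l).
Proof.
intros He H.
apply (proj2 (ex_lim_seq_cauchy_corr u)).
intros eps.
apply is_lim_seq_spec in He.
assert (Hp : 0 < eps / 2) by (generalize (cond_pos eps); lra).
destruct (He (mkposreal _ Hp)) as [N HN]; exists N.
intros n m Hn Hm; simpl in HN.
replace (u n - u m) with ((u n - u N) - (u m - u N)) by ring.
pose proof (HN N (Nat.le_refl N)) as HNN; rewrite Rminus_0_r in HNN.
eapply Rle_lt_trans; [apply Rabs_triang|]; rewrite Rabs_Ropp.
generalize (H N n Hn), (H N m Hm), (Rle_abs (e N)); lra.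
Qed.

(** The Cauchy modulus [e] survives as the rate of convergence. Limits of complex numbers and
    functions are carried in this form, with an explicit null sequence as error; a rate independent
    of the point is then uniform convergence. *)
Lemma C_cauchy_complete (z : nat -> C) (e : nat -> R) :
  is_lim_seq e (Finite 0) ->
  (forall n m, (n <= m)%nat -> Cmod (z m - z n)%C <= e n) ->
  exists l : C, forall n, Cmod (l - z n)%C <= e n.
Proof.
intros He H.
destruct (cauchy_complete (fun n => fst (z n)) e He) as [a Ha].
{ intros n m Hnm; eapply Rle_trans; [|apply H, Hnm].
  apply (Cmod_ge_fst (z m - z n)%C). }
destruct (cauchy_complete (fun n => snd (z n)) e He) as [b Hb].
{ intros n m Hnm; eapply Rle_trans; [|apply H, Hnm].
  apply (Cmod_ge_snd (z m - z n)%C). }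
exists (a, b); intros n.
(* Let m tend to infinity in the triangle inequality through [z m]: the first two terms vanish. *)
assert (L : is_lim_seq
  (fun m => Rabs (a - fst (z m)) + Rabs (b - snd (z m)) + e n)
  (Finite (Rabs (a - a) + Rabs (b - b) + e n))).
{ apply is_lim_seq_plus'; [|apply is_lim_seq_const].
  apply is_lim_seq_plus';
  apply (is_lim_seq_abs _ (Finite _)), is_lim_seq_minus';
    try apply is_lim_seq_const; assumption. }
replace (Rabs (a - a) + Rabs (b - b) + e n) with (e n) in L
  by (rewrite !Rminus_diag, Rabs_R0; ring).
apply (is_lim_seq_le_loc (fun _ => Cmod ((a, b) - z n)%C) _ (Finite _)
  (Finite (e n))) with (3 := L); [|apply is_lim_seq_const].
exists n; intros m Hm.
eapply Rle_trans; [apply (Cmod_triang3 (a, b) (z m) (z n))|].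
apply Rplus_le_compat; [apply (Cmod_le_abs ((a, b) - z m)%C)|apply H, Hm].
Qed.

Lemma C_cauchy_telescope (z : nat -> C) (b : nat -> R) (S : R) :
  (forall j, 0 <= b j) -> is_lim_seq (Rsum b) (Finite S) ->
  (forall n, Cmod (z (Datatypes.S n) - z n)%C <= b n) ->
  forall n m, (n <= m)%nat -> Cmod (z m - z n)%C <= S - Rsum b n.
Proof.
intros Hb HS Hz n m Hnm.
apply Rle_trans with (Rsum b m - Rsum b n);
  [|generalize (Rsum_le_lim b S m Hb HS); lra].
induction Hnm as [|m Hnm IH].
- replace (z n - z n)%C with (RtoC 0) by ring; rewrite Cmod_0; lra.
- eapply Rle_trans; [apply (Cmod_triang3 _ (z m))|].
  generalize (Hz m); simpl; lra.
Qed.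

Lemma tail_lim b S : is_lim_seq (Rsum b) (Finite S) ->
  is_lim_seq (fun n => S - Rsum b n) (Finite 0).
Proof.
intros H; replace (Finite 0) with (Finite (S - S)) by (f_equal; ring).
apply is_lim_seq_minus'; [apply is_lim_seq_const|exact H].
Qed.

Lemma unif_limit (X : Type) (g : nat -> X -> C) (e : nat -> R) :
  is_lim_seq e (Finite 0) ->
  (forall n m x, (n <= m)%nat -> Cmod (g m x - g n x)%C <= e n) ->
  exists G : X -> C, forall x n, Cmod (G x - g n x)%C <= e n.
Proof.
intros He H.
apply (functional_choice (fun x y => forall n, Cmod (y - g n x)%C <= e n)).
intros x; apply (C_cauchy_complete (fun n => g n x) e He).
intros n m; apply H.
Qed.

(** Weierstrass M-test, with the tail of the series as the rate. With [X] = [unit] it serves for a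
    single sequence. *)
Lemma unif_limit_telescope (X : Type) (g : nat -> X -> C) (b : nat -> R) :
  summable b ->
  (forall n x, Cmod (g (S n) x - g n x)%C <= b n) ->
  exists (G : X -> C) (e : nat -> R), is_lim_seq e (Finite 0) /\
    forall x n, Cmod (G x - g n x)%C <= e n.
Proof.
intros [Hb [Sm HS]] H.
destruct (unif_limit X g (fun n => Sm - Rsum b n) (tail_lim b Sm HS)) as [G HG].
- intros n m x; apply (C_cauchy_telescope (fun n => g n x) b Sm); auto.
- exists G, (fun n => Sm - Rsum b n); split; [apply tail_lim, HS|exact HG].
Qed.

Lemma le_of_lim_0 (a : R) (e : nat -> R) :
  is_lim_seq e (Finite 0) -> (forall n, a <= e n) -> a <= 0.
Proof.
intros He H.
exact (is_lim_seq_le (fun _ => a) e (Finite a) (Finite 0) H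
  (is_lim_seq_const a) He).
Qed.

Lemma C_eq_of_lim (z w : C) (e : nat -> R) :
  is_lim_seq e (Finite 0) -> (forall n, Cmod (z - w)%C <= e n) -> z = w.
Proof.
intros He H.
assert (E : (z - w)%C = RtoC 0).
{ apply Cmod_eq_0, Rle_antisym; [|apply Cmod_ge_0].
  apply (le_of_lim_0 _ e He H). }
replace z with ((z - w) + w)%C by ring; rewrite E; ring.
Qed.

Lemma lim_0_scal (k : R) (e : nat -> R) :
  is_lim_seq e (Finite 0) -> is_lim_seq (fun n => k * e n) (Finite 0).
Proof.
intros He; replace (Finite 0) with (Rbar_mult (Finite k) (Finite 0))
  by (simpl; f_equal; ring).
apply is_lim_seq_scal_l, He.
Qed.

Lemma lim_0_plus (e d : nat -> R) :
  is_lim_seq e (Finite 0) -> is_lim_seq d (Finite 0) ->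
  is_lim_seq (fun n => e n + d n) (Finite 0).
Proof.
intros He Hd; replace (Finite 0) with (Finite (0 + 0)) by (f_equal; ring).
apply is_lim_seq_plus'; assumption.
Qed.

Lemma lim_0_eps (e : nat -> R) (eps : R) :
  is_lim_seq e (Finite 0) -> 0 < eps -> exists N, forall n, (N <= n)%nat -> e n < eps.
Proof.
intros He H; apply is_lim_seq_spec in He.
destruct (He (mkposreal _ H)) as [N HN]; exists N; intros n Hn.
generalize (HN n Hn), (Rle_abs (e n - 0)); simpl; lra.
Qed.

Lemma exp_le_mono x y : x <= y -> exp x <= exp y.
Proof.
intros H; destruct (Rle_lt_or_eq_dec _ _ H) as [L|E]; [|rewrite E; lra].
left; apply exp_increasing, L.
Qed.

(** * Infinite products *)

Lemma exp_pow x n : exp x ^ n = exp (INR n * x).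
Proof.
induction n as [|n IH]; [simpl; rewrite Rmult_0_l, exp_0; reflexivity|].
rewrite S_INR; simpl; rewrite IH, <- exp_plus; f_equal; ring.
Qed.

Definition PW (c : nat -> R) (n : nat) (x : R) : R :=
  Rprod (fun j => 1 + c j * x) n.

(* With [u j = 1 / t_j], [W (fun j => u j ^ 2) (t ^ 2)] is [|omega(t)|^2]. *)
Definition W (c : nat -> R) (x : R) : R :=
  real (Lim_seq (fun n => PW c n x)).

Lemma PW_S c n x : PW c (S n) x = PW c n x * (1 + c n * x).
Proof. reflexivity. Qed.

Lemma PW_incr c n m x :
  (forall j, 0 <= c j) -> 0 <= x -> (n <= m)%nat -> PW c n x <= PW c m x.
Proof.
intros Hc Hx; apply Rprod_mono; intros j.
generalize (Rmult_le_pos _ _ (Hc j) Hx); lra.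
Qed.

Lemma PW_ge1 c n x : (forall j, 0 <= c j) -> 0 <= x -> 1 <= PW c n x.
Proof. intros Hc Hx; apply (PW_incr c 0 n x Hc Hx); lia. Qed.

Lemma PW_exp c n x :
  (forall j, 0 <= c j) -> 0 <= x -> PW c n x <= exp (x * Rsum c n).
Proof.
intros Hc Hx; induction n as [|n IH].
- unfold PW; simpl; rewrite Rmult_0_r, exp_0; lra.
- unfold PW; simpl; rewrite (Rmult_plus_distr_l x), exp_plus.
  pose proof (Rmult_le_pos _ _ (Hc n) Hx).
  apply Rmult_le_compat; [generalize (PW_ge1 c n x Hc Hx); unfold PW; lra|lra
    |exact IH|].
  rewrite (Rmult_comm x); apply exp_ineq1_le.
Qed.

Lemma W_lim c x :
  summable c -> 0 <= x -> is_lim_seq (fun n => PW c n x) (Finite (W c x)).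
Proof.
intros Hc Hx; destruct (summable_bounded c Hc) as [B [_ HB]].
apply Lim_seq_correct'.
apply (ex_finite_lim_seq_incr _ (exp (x * B))).
- intros n; apply PW_incr; [apply Hc|exact Hx|lia].
- intros n; eapply Rle_trans; [apply PW_exp; [apply Hc|exact Hx]|].
  assert (x * Rsum c n <= x * B) by (apply Rmult_le_compat_l; auto).
  apply exp_le_mono, H.
Qed.

Lemma PW_le_W c n x : summable c -> 0 <= x -> PW c n x <= W c x.
Proof.
intros Hc Hx; apply (is_lim_seq_incr_compare _ _ (W_lim c x Hc Hx)).
intros m; apply PW_incr; [apply Hc|exact Hx|lia].
Qed.

Lemma W_le c x B :
  summable c -> 0 <= x -> (forall n, PW c n x <= B) -> W c x <= B.
Proof.
intros Hc Hx H.
exact (is_lim_seq_le _ _ (Finite _) (Finite _) H (W_lim c x Hc Hx)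
  (is_lim_seq_const B)).
Qed.

Lemma W_ge1 c x : summable c -> 0 <= x -> 1 <= W c x.
Proof.
intros Hc Hx; eapply Rle_trans; [|apply (PW_le_W c 0 x Hc Hx)].
unfold PW; simpl; lra.
Qed.

Lemma W_0 c : summable c -> W c 0 = 1.
Proof.
intros Hc; apply Rle_antisym; [|apply W_ge1; [exact Hc|lra]].
apply W_le; [exact Hc|lra|]; unfold PW; induction n as [|n IH]; [simpl; lra|].
cbn [Rprod]; rewrite Rmult_0_r, Rplus_0_r, Rmult_1_r; exact IH.
Qed.

Lemma W_mono c x y : summable c -> 0 <= x <= y -> W c x <= W c y.
Proof.
intros Hc Hx; apply W_le; [exact Hc|lra|intros n].
eapply Rle_trans; [|apply (PW_le_W c n y); [exact Hc|lra]].
apply Rprod_le; intros j; pose proof (proj1 Hc j); nra.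
Qed.

Lemma W_mono_c c d x : summable c -> summable d -> (forall j, c j <= d j) ->
  0 <= x -> W c x <= W d x.
Proof.
intros Hc Hd H Hx; apply W_le; [exact Hc|lra|intros n].
eapply Rle_trans; [|apply (PW_le_W d n x); [exact Hd|lra]].
apply Rprod_le; intros j; pose proof (proj1 Hc j); specialize (H j); nra.
Qed.

Lemma W_pow_le c k d x y : summable c -> summable d -> 0 <= x -> 0 <= y ->
  (forall j, 1 + c j * x <= (1 + d j * y) ^ k) -> W c x <= W d y ^ k.
Proof.
intros Hc Hd Hx Hy H; apply W_le; auto; intros n.
apply Rle_trans with (PW d n y ^ k).
- unfold PW; rewrite <- Rprod_pow; apply Rprod_le; intros j.
  pose proof (proj1 Hc j); split; [nra|apply H].
- apply pow_incr; split; [|apply PW_le_W; auto].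
  generalize (PW_ge1 d n y (proj1 Hd) Hy); lra.
Qed.

(** Bernoulli in each factor, 1 + 4y <= (1 + y)^4. For x = t^2 this is the doubling bound
    |omega(2t)| <= |omega(t)|^4. *)
Lemma W_4 c x : summable c -> 0 <= x -> W c (4 * x) <= W c x ^ 4.
Proof.
intros Hc Hx; apply W_pow_le; auto; [lra|].
intros j; pose proof (Rmult_le_pos _ _ (proj1 Hc j) Hx) as P.
replace (c j * (4 * x)) with (4 * (c j * x)) by ring.
set (y := c j * x) in *; simpl.
replace ((1 + y) * ((1 + y) * ((1 + y) * ((1 + y) * 1))))
  with (1 + 4 * y + (6 * y ^ 2 + 4 * y ^ 3 + y ^ 4)) by ring.
generalize (pow_le y 2 P), (pow_le y 3 P), (pow_le y 4 P); lra.
Qed.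

(** Factorwise from (a + b)^2 <= 2a^2 + 2b^2 and 1 + 2y <= (1 + y)^2. It splits the weight at t into
    its value at a centre r and its value at t - r. *)
Lemma W_add c a b : summable c ->
  W c ((a + b) ^ 2) <= W c (a ^ 2) ^ 2 * W c (b ^ 2) ^ 2.
Proof.
intros Hc; apply W_le; auto; [apply pow2_ge_0|intros n].
apply Rle_trans with (PW c n (a ^ 2) ^ 2 * PW c n (b ^ 2) ^ 2).
- unfold PW; rewrite <- !Rprod_pow, <- Rprod_mult.
  apply Rprod_le; intros j; pose proof (proj1 Hc j) as P.
  assert (P1 : 0 <= c j * a ^ 2) by (apply Rmult_le_pos; auto; apply pow2_ge_0).
  assert (P2 : 0 <= c j * b ^ 2) by (apply Rmult_le_pos; auto; apply pow2_ge_0).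
  assert (P3 : 0 <= c j * (a - b) ^ 2)
    by (apply Rmult_le_pos; auto; apply pow2_ge_0).
  assert (P4 : 0 <= c j * (a + b) ^ 2)
    by (apply Rmult_le_pos; auto; apply pow2_ge_0).
  split; [lra|].
  apply Rle_trans with ((1 + 2 * (c j * a ^ 2)) * (1 + 2 * (c j * b ^ 2))).
  +
    nra.
  + apply Rmult_le_compat; nra.
- apply Rmult_le_compat; try (apply pow_le);
  try (eapply Rle_trans; [|apply PW_ge1]; try apply Hc; try apply pow2_ge_0; lra);
  apply pow_incr; (split; [eapply Rle_trans; [|apply PW_ge1];
    try apply Hc; try apply pow2_ge_0; lra|apply PW_le_W; auto; apply pow2_ge_0]).
Qed.

Lemma W_poly c x j : summable c -> 0 <= x -> 1 + c j * x <= W c x.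
Proof.
intros Hc Hx; eapply Rle_trans; [|apply (PW_le_W c (S j) x Hc Hx)].
unfold PW; simpl; rewrite <- (Rmult_1_l (1 + c j * x)) at 1.
pose proof (Rmult_le_pos _ _ (proj1 Hc j) Hx).
apply Rmult_le_compat_r; [lra|apply PW_ge1; [apply Hc|exact Hx]].
Qed.

(* The first factors grow polynomially, the others contribute at most
   [exp (2 r (tail of sum u))] since 1 + y^2 <= exp (2 y). *)
Lemma W_exp_type u : summable u -> forall eps, 0 < eps ->
  exists A, forall r, 0 <= r -> W (fun j => u j ^ 2) (r ^ 2) <= A * exp (eps * r).
Proof.
intros Hu eps He.
destruct Hu as [Hu [Sm HS]].
(* A tail below eps / 4 costs exp (2 r eps / 4) = exp (eps r / 2); the other half of [eps] is left
   for the first [N] factors. *)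
destruct (lim_0_eps _ (eps / 4) (tail_lim u Sm HS)) as [N HN]; [lra|].
(* A finite product is O(exp (d r)) for every d > 0: half of [d] pays for the earlier factors, and 1
   + (u_k r)^2 <= (1 + u_k r)^2 takes a quarter twice. *)
assert (One : forall d, 0 < d -> forall k : nat, exists A, 0 < A /\ forall r, 0 <= r ->
  PW (fun j => u j ^ 2) k (r ^ 2) <= A * exp (d * r)).
{ intros d Hd k; revert d Hd; induction k as [|k IH]; intros d Hd.
  - exists 1; split; [lra|]; intros r Hr; unfold PW; simpl.
    generalize (exp_ineq1_le (d * r)), (Rmult_le_pos d r); lra.
  - destruct (IH (d / 2)) as [A [HA H]]; [lra|].
    (* Chosen so that 1 + u_k r <= K (1 + d r / 4) <= K exp (d r / 4). *)
    set (K := 1 + 4 * u k / d).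
    assert (HK : 1 <= K).
    { unfold K; assert (0 <= 4 * u k / d); [|lra].
      apply Rmult_le_pos; [generalize (Hu k); lra|].
      left; apply Rinv_0_lt_compat, Hd. }
    exists (A * (K * K)); split; [repeat apply Rmult_lt_0_compat; lra|].
    intros r Hr; rewrite PW_S.
    replace (d * r) with (d / 2 * r + (d / 4 * r + d / 4 * r)) by field.
    rewrite !exp_plus.
    replace (A * (K * K) * (exp (d / 2 * r) * (exp (d / 4 * r) * exp (d / 4 * r))))
      with ((A * exp (d / 2 * r)) * ((K * exp (d / 4 * r)) ^ 2)) by ring.
    apply Rmult_le_compat; auto.
    + generalize (PW_ge1 (fun j => u j ^ 2) k (r ^ 2)
        (fun j => pow2_ge_0 (u j)) (pow2_ge_0 r)); lra.
    + generalize (pow2_ge_0 (u k * r)); rewrite Rpow_mult_distr; lra.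
    + assert (E : 1 + u k * r <= K * exp (d / 4 * r)).
      { apply Rle_trans with (K * (1 + d / 4 * r)).
        - unfold K.
          replace ((1 + 4 * u k / d) * (1 + d / 4 * r))
            with (1 + u k * r + (4 * u k / d + d / 4 * r)) by (field; lra).
          assert (0 <= 4 * u k / d) by (unfold K in HK; lra).
          assert (0 <= d / 4 * r) by (apply Rmult_le_pos; lra); lra.
        - apply Rmult_le_compat_l; [lra|apply exp_ineq1_le]. }
      assert (0 <= u k * r) by (apply Rmult_le_pos; auto).
      apply Rle_trans with ((1 + u k * r) ^ 2); [nra|].
      apply pow_incr; lra. }
destruct (One (eps / 2) ltac:(lra) N) as [A [HA H]].
exists A; intros r Hr.
assert (Hs : summable (fun j => u j ^ 2))
  by (apply summable_sqr; split; [exact Hu|exists Sm; exact HS]).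
apply W_le; auto; [apply pow2_ge_0|].
intros n.
(* The [Rmax] with 0 lets one bound serve both n <= N and n > N. *)
apply Rle_trans with (A * exp (eps / 2 * r) * exp (2 * r * Rmax 0 (Rsum u n - Rsum u N))).
- destruct (Nat.le_gt_cases n N) as [L|L].
  + apply Rle_trans with (A * exp (eps / 2 * r)).
    * eapply Rle_trans; [|apply H, Hr].
      apply PW_incr; auto; intros; apply pow2_ge_0.
    * rewrite <- (Rmult_1_r (A * exp (eps / 2 * r))) at 1.
      apply Rmult_le_compat_l.
      -- apply Rmult_le_pos; [lra|left; apply exp_pos].
      -- assert (0 <= 2 * r * Rmax 0 (Rsum u n - Rsum u N)).
         { apply Rmult_le_pos; [lra|apply Rmax_l]. }
         generalize (exp_ineq1_le (2 * r * Rmax 0 (Rsum u n - Rsum u N))); lra.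
  + rewrite Rmax_right by (generalize (Rsum_mono u N n Hu); intros M;
      assert (Rsum u N <= Rsum u n) by (apply M; lia); lra).
    assert (L' : (N <= n)%nat) by lia; clear L.
    induction L' as [|n L IH].
    * rewrite Rminus_diag, Rmult_0_r, exp_0, Rmult_1_r; apply H, Hr.
    * rewrite PW_S.
      replace (2 * r * (Rsum u (S n) - Rsum u N))
        with (2 * r * (Rsum u n - Rsum u N) + (u n * r + u n * r)) by (simpl; ring).
      rewrite !exp_plus, <- Rmult_assoc.
      assert (0 <= u n * r) by (apply Rmult_le_pos; auto).
      apply Rmult_le_compat; [|nra|exact IH|].
      -- generalize (PW_ge1 (fun j => u j ^ 2) n (r ^ 2)
           (fun j => pow2_ge_0 (u j)) (pow2_ge_0 r)); lra.
      -- apply Rle_trans with ((1 + u n * r) * (1 + u n * r)); [nra|].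
         generalize (exp_ineq1_le (u n * r)); intros.
         apply Rmult_le_compat; lra.
- rewrite Rmult_assoc, <- exp_plus; apply Rmult_le_compat_l; [lra|].
  assert (X : Rmax 0 (Rsum u n - Rsum u N) <= eps / 4).
  { apply Rmax_lub; [lra|].
    generalize (HN N (Nat.le_refl N)), (Rsum_le_lim u Sm n Hu HS); lra. }
  assert (Y : eps / 2 * r + 2 * r * Rmax 0 (Rsum u n - Rsum u N) <= eps * r)
    by nra.
  apply exp_le_mono, Y.
Qed.

(** * The symbol prod (1 + c_j z^2) as an entire function *)

Definition pz (c : nat -> R) (n : nat) (z : C) : C :=
  Cprod (fun j => (1 + RtoC (c j) * (z * z))%C) n.

Lemma Cmod_RtoC_pos x : 0 <= x -> Cmod (RtoC x) = x.
Proof. intros H; rewrite Cmod_R; apply Rabs_right; lra. Qed.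

Lemma pz_le c n z : (forall j, 0 <= c j) -> Cmod (pz c n z) <= PW c n (Cmod z ^ 2).
Proof.
intros Hc; unfold PW, pz; induction n as [|n IH]; simpl.
- rewrite Cmod_1; lra.
- rewrite Cmod_mult; apply Rmult_le_compat; try apply Cmod_ge_0; [exact IH|].
  eapply Rle_trans; [apply Cmod_triangle|].
  rewrite !Cmod_mult, Cmod_1, Cmod_RtoC_pos by apply Hc; lra.
Qed.

Lemma pz_le_W c n z R : summable c -> Cmod z <= R -> Cmod (pz c n z) <= W c (R ^ 2).
Proof.
intros Hc Hz; eapply Rle_trans; [apply pz_le, Hc|].
assert (H : 0 <= Cmod z ^ 2 <= R ^ 2).
{ split; [apply pow2_ge_0|apply pow_incr; split; [apply Cmod_ge_0|exact Hz]]. }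
eapply Rle_trans; [|apply W_mono; [exact Hc|exact H]].
apply PW_le_W; [exact Hc|apply H].
Qed.

Lemma pz_step c n z : (pz c (S n) z - pz c n z)%C = (RtoC (c n) * (z * z) * pz c n z)%C.
Proof. unfold pz; simpl; ring. Qed.

(** The product rule, made explicit because the derivative of the limit is constructed as the limit
    of these values. *)
Fixpoint pz_deriv (c : nat -> R) (n : nat) (z : C) : C :=
  match n with
  | O => RtoC 0
  | S m => (pz_deriv c m z * (1 + RtoC (c m) * (z * z))
            + pz c m z * (RtoC (2 * c m) * z))%C
  end.

Section Disc.

Variables (c : nat -> R) (Rad : R) (z w : C).
Hypothesis Hc : summable c.
Hypothesis Hz : Cmod z <= Rad.
Hypothesis Hw : Cmod w <= Rad.

Let P n := PW c n (Rad ^ 2).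
Let h := Cmod (w - z)%C.

Local Lemma Rad_pos : 0 <= Rad.
Proof. eapply Rle_trans; [apply Cmod_ge_0|exact Hz]. Qed.

Local Lemma P_pos n : 0 <= P n.
Proof. generalize (PW_ge1 c n (Rad ^ 2) (proj1 Hc) (pow2_ge_0 Rad)); unfold P; lra. Qed.

Local Lemma P_succ n : P (S n) = P n * (1 + c n * Rad ^ 2).
Proof. reflexivity. Qed.

Local Lemma pz_le_P n y : Cmod y <= Rad -> Cmod (pz c n y) <= P n.
Proof.
intros Hy; eapply Rle_trans; [apply pz_le, Hc|].
apply Rprod_le; intros j; pose proof (proj1 Hc j).
assert (0 <= Cmod y ^ 2 <= Rad ^ 2).
{ split; [apply pow2_ge_0|apply pow_incr; split; [apply Cmod_ge_0|exact Hy]]. }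
nra.
Qed.

Local Lemma factor_le n y : Cmod y <= Rad ->
  Cmod (1 + RtoC (c n) * (y * y))%C <= 1 + c n * Rad ^ 2.
Proof.
intros Hy; eapply Rle_trans; [apply Cmod_triangle|].
rewrite !Cmod_mult, Cmod_1, Cmod_RtoC_pos by apply Hc.
apply Rplus_le_compat_l, Rmult_le_compat_l; [apply Hc|].
replace (Rad ^ 2) with (Rad * Rad) by ring.
apply Rmult_le_compat; try apply Cmod_ge_0; exact Hy.
Qed.

Local Lemma sum_le : Cmod (w + z)%C <= 2 * Rad.
Proof. eapply Rle_trans; [apply Cmod_triangle|lra]. Qed.

(** Change one factor at a time, with w^2 - z^2 = (w + z)(w - z) and |w + z| <= 2 Rad. Since [P n]
    and [Rsum c n] are bounded in n, the Lipschitz constant is uniform in n; the next two bounds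
    have the same form for the same reason. *)
Lemma pz_lip n : Cmod (pz c n w - pz c n z)%C <= P n * (2 * Rad * Rsum c n) * h.
Proof.
induction n as [|n IH].
- unfold pz; simpl; replace (1 - 1)%C with (RtoC 0) by ring; rewrite Cmod_0; lra.
- replace (pz c (S n) w - pz c (S n) z)%C with
    ((pz c n w - pz c n z) * (1 + RtoC (c n) * (w * w))
     + pz c n z * (RtoC (c n) * ((w + z) * (w - z))))%C by (unfold pz; simpl; ring).
  eapply Rle_trans; [apply Cmod_triangle|].
  rewrite !Cmod_mult, (Cmod_RtoC_pos (c n)) by apply Hc; fold h.
  rewrite P_succ; simpl Rsum.
  pose proof (factor_le n w Hw) as F.
  pose proof (pz_le_P n z Hz) as Q.
  pose proof sum_le as SL.
  pose proof (P_pos n) as PP.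
  pose proof (Cmod_ge_0 (w - z)%C) as Hh; fold h in Hh.
  pose proof (proj1 Hc n) as Hn.
  pose proof Rad_pos as HR.
  replace (P n * (1 + c n * Rad ^ 2) * (2 * Rad * (Rsum c n + c n)) * h)
    with (P n * (2 * Rad * Rsum c n) * h * (1 + c n * Rad ^ 2)
          + P n * (c n * (2 * Rad * h)) * (1 + c n * Rad ^ 2)) by ring.
  apply Rplus_le_compat.
  + apply Rmult_le_compat; try apply Cmod_ge_0; assumption.
  + apply Rle_trans with (P n * (c n * (2 * Rad * h))).
    * apply Rmult_le_compat; try apply Cmod_ge_0; try assumption.
      -- apply Rmult_le_pos; [exact Hn|apply Rmult_le_pos; [apply Cmod_ge_0|exact Hh]].
      -- apply Rmult_le_compat_l; [exact Hn|].
         apply Rmult_le_compat_r; assumption.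
    * assert (0 <= P n * (c n * (2 * Rad * h)))
        by (repeat apply Rmult_le_pos; try assumption; lra).
      assert (0 <= c n * Rad ^ 2) by (apply Rmult_le_pos; [exact Hn|apply pow2_ge_0]).
      nra.
Qed.

Lemma pz_deriv_le n : Cmod (pz_deriv c n z) <= P n * (2 * Rad * Rsum c n).
Proof.
induction n as [|n IH].
- simpl; rewrite Cmod_0; lra.
- simpl pz_deriv.
  eapply Rle_trans; [apply Cmod_triangle|].
  rewrite !Cmod_mult, (Cmod_RtoC_pos (2 * c n)) by (generalize (proj1 Hc n); lra).
  rewrite P_succ; simpl Rsum.
  pose proof (factor_le n z Hz) as F.
  pose proof (pz_le_P n z Hz) as Q.
  pose proof (P_pos n) as PP.
  pose proof (proj1 Hc n) as Hn.
  pose proof Rad_pos as HR.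
  replace (P n * (1 + c n * Rad ^ 2) * (2 * Rad * (Rsum c n + c n)))
    with (P n * (2 * Rad * Rsum c n) * (1 + c n * Rad ^ 2)
          + P n * (2 * c n * Rad) * (1 + c n * Rad ^ 2)) by ring.
  apply Rplus_le_compat.
  + apply Rmult_le_compat; try apply Cmod_ge_0; assumption.
  + apply Rle_trans with (P n * (2 * c n * Rad)).
    * apply Rmult_le_compat; try apply Cmod_ge_0; try assumption.
      -- apply Rmult_le_pos; [lra|apply Cmod_ge_0].
      -- apply Rmult_le_compat_l; [lra|exact Hz].
    * assert (0 <= P n * (2 * c n * Rad))
        by (repeat apply Rmult_le_pos; try assumption; lra).
      assert (0 <= c n * Rad ^ 2) by (apply Rmult_le_pos; [exact Hn|apply pow2_ge_0]).
      nra.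
Qed.

(** Adding a factor multiplies the old remainder by 1 + c_n z^2 and adds c_n times two terms of
    second order: the difference of the partial products times (w + z)(w - z), which gives 4 Rad^2
    B, and the partial product times (w - z)^2, which gives the 1. *)
Lemma pz_taylor B n : 0 <= B -> (forall n, Rsum c n <= B) ->
  Cmod (pz c n w - pz c n z - (w - z) * pz_deriv c n z)%C
  <= P n * ((1 + 4 * Rad ^ 2 * B) * Rsum c n) * h ^ 2.
Proof.
intros HB0 HB; induction n as [|n IH].
- unfold pz; simpl; replace (1 - 1 - (w - z) * 0)%C with (RtoC 0) by ring.
  rewrite Cmod_0; lra.
- replace (pz c (S n) w - pz c (S n) z - (w - z) * pz_deriv c (S n) z)%C with
    ((pz c n w - pz c n z - (w - z) * pz_deriv c n z) * (1 + RtoC (c n) * (z * z))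
     + RtoC (c n) * ((pz c n w - pz c n z) * ((w + z) * (w - z))
                     + pz c n z * ((w - z) * (w - z))))%C
    by (simpl pz_deriv; unfold pz; simpl Cprod; rewrite RtoC_mult; change (RtoC 2) with (RtoC (1 + 1)); rewrite RtoC_plus; ring).
  eapply Rle_trans; [apply Cmod_triangle|].
  rewrite !Cmod_mult, (Cmod_RtoC_pos (c n)) by apply Hc.
  rewrite P_succ; simpl Rsum.
  pose proof (factor_le n z Hz) as F.
  pose proof (P_pos n) as PP.
  pose proof (Cmod_ge_0 (w - z)%C) as Hh; fold h in Hh.
  pose proof (proj1 Hc n) as Hn.
  pose proof Rad_pos as HR.
  set (K := 1 + 4 * Rad ^ 2 * B) in *.
  replace (P n * (1 + c n * Rad ^ 2) * (K * (Rsum c n + c n)) * h ^ 2)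
    with (P n * (K * Rsum c n) * h ^ 2 * (1 + c n * Rad ^ 2)
          + c n * (P n * K * h ^ 2) * (1 + c n * Rad ^ 2)) by ring.
  apply Rplus_le_compat.
  + apply Rmult_le_compat; try apply Cmod_ge_0; assumption.
  + assert (HK : 1 <= K).
    { unfold K; assert (0 <= Rad ^ 2 * B); [|lra].
      apply Rmult_le_pos; [apply pow2_ge_0|exact HB0]. }
    apply Rle_trans with (c n * (P n * K * h ^ 2)).
    * apply Rmult_le_compat_l; [exact Hn|].
      eapply Rle_trans; [apply Cmod_triangle|].
      rewrite !Cmod_mult; fold h.
      replace (P n * K * h ^ 2) with
        (P n * (2 * Rad * B) * h * (2 * Rad * h) + P n * (h * h))
        by (unfold K; ring).
      apply Rplus_le_compat.
      -- apply Rmult_le_compat; try apply Cmod_ge_0;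
         [apply Rmult_le_pos; [apply Cmod_ge_0|exact Hh]| |].
         ++ eapply Rle_trans; [apply pz_lip|].
            apply Rmult_le_compat_r; [exact Hh|].
            apply Rmult_le_compat_l; [exact PP|].
            apply Rmult_le_compat_l; [lra|apply HB].
         ++ apply Rmult_le_compat_r; [exact Hh|apply sum_le].
      -- apply Rmult_le_compat_r; [nra|apply pz_le_P, Hz].
    * assert (0 <= c n * (P n * K * h ^ 2))
        by (repeat apply Rmult_le_pos; try assumption; try apply pow2_ge_0; lra).
      assert (0 <= c n * Rad ^ 2) by (apply Rmult_le_pos; [exact Hn|apply pow2_ge_0]).
      nra.
Qed.

End Disc.

Lemma is_derive_C_quadratic (f : C -> C) (z d : C) (K : R) :
  (forall w, Cmod (w - z)%C <= 1 ->
     Cmod (f w - f z - (w - z) * d)%C <= K * Cmod (w - z)%C ^ 2) ->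
  is_derive (K := C_AbsRing) (V := C_NormedModule) f z d.
Proof.
intros H; split.
- apply (is_linear_scal_l (K := C_AbsRing) (V := C_NormedModule)).
- intros x Hx eps.
  rewrite <- (is_filter_lim_locally_unique (K := C_AbsRing) (V := AbsRing_NormedModule C_AbsRing) _ _ Hx).
  assert (HK : 0 < Rabs K + 1) by (generalize (Rabs_pos K); lra).
  set (r := Rmin 1 (eps / (Rabs K + 1))).
  assert (Hr : 0 < r).
  { apply Rmin_glb_lt; [lra|].
    apply Rmult_lt_0_compat; [apply cond_pos|apply Rinv_0_lt_compat, HK]. }
  exists (mkposreal r Hr); intros w Hw.
  change (Cmod (w - z)%C < r) in Hw.
  change (Cmod ((f w - f z) - (w - z) * d)%C <= eps * Cmod (w - z)%C).
  assert (r <= 1) by apply Rmin_l.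
  assert (r * (Rabs K + 1) <= eps).
  { apply Rle_trans with (eps / (Rabs K + 1) * (Rabs K + 1)).
    - apply Rmult_le_compat_r; [lra|apply Rmin_r].
    - right; field; lra. }
  eapply Rle_trans; [apply H; lra|].
  pose proof (Cmod_ge_0 (w - z)%C) as P.
  generalize (Rle_abs K), (Rabs_pos K); intros.
  replace (K * Cmod (w - z)%C ^ 2) with ((K * Cmod (w - z)%C) * Cmod (w - z)%C) by ring.
  apply Rmult_le_compat_r; [exact P|].
  apply Rle_trans with (Rabs K * Cmod (w - z)%C); [apply Rmult_le_compat_r; lra|].
  apply Rle_trans with (Rabs K * r); [apply Rmult_le_compat_l; lra|nra].
Qed.

(** Differentiability of the limit comes from the Taylor remainder being uniform in n, without
    Cauchy's formula: the inequality of [pz_taylor] is passed to the limit. *)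
Lemma entire_product c : summable c ->
  exists F : C -> C,
    (forall z, exists e, is_lim_seq e (Finite 0) /\
       forall n, Cmod (F z - pz c n z)%C <= e n) /\
    (forall z, ex_derive (K := C_AbsRing) (V := C_NormedModule) F z).
Proof.
intros Hc.
assert (L : forall z, exists y : C, exists e, is_lim_seq e (Finite 0) /\
  forall n, Cmod (y - pz c n z)%C <= e n).
{ intros z.
  assert (Hb : summable (fun j => (Cmod z ^ 2 * W c (Cmod z ^ 2)) * c j)).
  { apply summable_scal; [|exact Hc].
    apply Rmult_le_pos; [apply pow2_ge_0|].
    generalize (W_ge1 c _ Hc (pow2_ge_0 (Cmod z))); lra. }
  destruct (unif_limit_telescope unit (fun n _ => pz c n z) _ Hb) as [G [e [He HG]]].
  - intros n _; rewrite pz_step, !Cmod_mult, Cmod_RtoC_pos by apply Hc.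
    replace (Cmod z ^ 2 * W c (Cmod z ^ 2) * c n)
      with (c n * (Cmod z * Cmod z) * W c (Cmod z ^ 2)) by ring.
    apply Rmult_le_compat_l.
    + generalize (proj1 Hc n), (Cmod_ge_0 z); intros.
      repeat apply Rmult_le_pos; assumption.
    + apply pz_le_W; [exact Hc|lra].
  - exists (G tt), e; auto. }
apply functional_choice in L; destruct L as [F HF].
exists F; split; [exact HF|].
intros z.
destruct (summable_bounded c Hc) as [B [HB0 HB]].
set (Rad := Cmod z + 1).
assert (Hz : Cmod z <= Rad) by (unfold Rad; lra).
assert (HR : 0 <= Rad) by (generalize (Cmod_ge_0 z); lra).
set (Q := W c (Rad ^ 2)).
assert (HQ : 1 <= Q) by (apply W_ge1; [exact Hc|apply pow2_ge_0]).
(* The two summands bound the two new terms of the product rule in [pz_deriv], up to the factor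
   c_n. *)
set (K1 := Q * (2 * Rad * B) * Rad ^ 2 + Q * (2 * Rad)).
assert (HK1 : 0 <= K1).
{ unfold K1; generalize (pow2_ge_0 Rad); intros.
  apply Rplus_le_le_0_compat; repeat apply Rmult_le_pos; lra. }
assert (Hb : summable (fun j => K1 * c j)) by (apply summable_scal; assumption).
destruct (unif_limit_telescope unit (fun n _ => pz_deriv c n z) _ Hb) as [G [e [He HG]]].
{ intros n _; simpl pz_deriv.
  replace (pz_deriv c n z * (1 + RtoC (c n) * (z * z)) + pz c n z * (RtoC (2 * c n) * z)
           - pz_deriv c n z)%C
    with (pz_deriv c n z * (RtoC (c n) * (z * z)) + pz c n z * (RtoC (2 * c n) * z))%C
    by ring.
  eapply Rle_trans; [apply Cmod_triangle|].
  pose proof (proj1 Hc n) as Hn.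
  rewrite !Cmod_mult, !Cmod_RtoC_pos by lra.
  unfold K1.
  replace ((Q * (2 * Rad * B) * Rad ^ 2 + Q * (2 * Rad)) * c n)
    with (Q * (2 * Rad * B) * (c n * (Rad * Rad)) + Q * (2 * c n * Rad)) by ring.
  apply Rplus_le_compat; apply Rmult_le_compat; try apply Cmod_ge_0.
  - repeat apply Rmult_le_pos; try apply Cmod_ge_0; lra.
  - eapply Rle_trans; [apply (pz_deriv_le c Rad z Hc Hz)|].
    apply Rmult_le_compat.
    + generalize (PW_ge1 c n (Rad ^ 2) (proj1 Hc) (pow2_ge_0 Rad)); lra.
    + repeat apply Rmult_le_pos; try lra; apply Rsum_ge0, Hc.
    + apply PW_le_W; [exact Hc|apply pow2_ge_0].
    + apply Rmult_le_compat_l; [lra|apply HB].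
  - apply Rmult_le_compat_l; [lra|].
    apply Rmult_le_compat; try apply Cmod_ge_0; lra.
  - repeat apply Rmult_le_pos; try apply Cmod_ge_0; lra.
  - apply pz_le_W; assumption.
  - apply Rmult_le_compat_l; lra. }
set (d := G tt).
exists d.
apply is_derive_C_quadratic with (Q * ((1 + 4 * Rad ^ 2 * B) * B)).
intros w Hw.
assert (Hw' : Cmod w <= Rad).
{ replace w with ((w - z) + z)%C by ring.
  eapply Rle_trans; [apply Cmod_triangle|unfold Rad; lra]. }
destruct (HF z) as [ez [Hez Hz2]], (HF w) as [ew [Hew Hw2]].
(* Errors of replacing F(w), F(z) and the derivative by their n-th approximations. *)
assert (Lim : is_lim_seq (fun n => ew n + ez n + Cmod (w - z)%C * e n) (Finite 0)).
{ apply lim_0_plus; [apply lim_0_plus; assumption|apply lim_0_scal; exact He]. }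
apply Rminus_le.
apply (le_of_lim_0 _ _ Lim); intros n.
assert (Tl : Cmod (pz c n w - pz c n z - (w - z) * pz_deriv c n z)%C
  <= Q * ((1 + 4 * Rad ^ 2 * B) * B) * Cmod (w - z)%C ^ 2).
{ eapply Rle_trans; [apply (pz_taylor c Rad z w Hc Hz Hw' B n); [lra|exact HB]|].
  apply Rmult_le_compat_r; [apply pow2_ge_0|].
  assert (0 <= Rad ^ 2 * B) by (apply Rmult_le_pos; [apply pow2_ge_0|lra]).
  apply Rmult_le_compat.
  - generalize (PW_ge1 c n (Rad ^ 2) (proj1 Hc) (pow2_ge_0 Rad)); lra.
  - apply Rmult_le_pos; [lra|apply Rsum_ge0, Hc].
  - apply PW_le_W; [exact Hc|apply pow2_ge_0].
  - apply Rmult_le_compat_l; [lra|apply HB]. }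
replace (F w - F z - (w - z) * d)%C with
  ((F w - pz c n w) - (F z - pz c n z) - (w - z) * (d - pz_deriv c n z)
   + (pz c n w - pz c n z - (w - z) * pz_deriv c n z))%C by ring.
pose proof (Cmod_triangle ((F w - pz c n w) - (F z - pz c n z) - (w - z) * (d - pz_deriv c n z))%C
  (pz c n w - pz c n z - (w - z) * pz_deriv c n z)%C).
pose proof (Cmod_sub_le ((F w - pz c n w) - (F z - pz c n z))%C
  ((w - z) * (d - pz_deriv c n z))%C) as T1.
pose proof (Cmod_sub_le (F w - pz c n w)%C (F z - pz c n z)%C) as T2.
rewrite Cmod_mult in T1.
generalize (Hz2 n), (Hw2 n), (HG tt n); fold d; intros.
assert (Cmod (w - z)%C * Cmod (d - pz_deriv c n z)%C <= Cmod (w - z)%C * e n)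
  by (apply Rmult_le_compat_l; [apply Cmod_ge_0|assumption]).
lra.
Qed.

(** * The Fourier transform of compactly supported functions *)

Definition cs (M : R) (g : R -> C) : Prop :=
  (forall x, continuous g x) /\ forall x, M < Rabs x -> g x = RtoC 0.

Lemma norm_Cmod (z : C) : @norm R_AbsRing C_R_NormedModule z = Cmod z.
Proof.
unfold norm; simpl; unfold prod_norm, Cmod; f_equal.
change (Rabs (fst z) ^ 2 + Rabs (snd z) ^ 2 = fst z ^ 2 + snd z ^ 2); rewrite !pow2_abs; ring.
Qed.

Lemma continuous_C_eps (g : R -> C) x :
  continuous g x <-> forall eps, 0 < eps ->
    exists d, 0 < d /\ forall y, Rabs (y - x) < d -> Cmod (g y - g x)%C < eps.
Proof.
split.
- intros H eps He.
  pose proof (H (fun w => Cmod (w - g x)%C < eps)) as L.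
  destruct L as [d Hd].
  + apply (locally_le_locally_norm (K := C_AbsRing) (V := C_NormedModule)).
    exists (mkposreal eps He); intros w Hw; exact Hw.
  + exists d; split; [apply cond_pos|]; intros y Hy; apply Hd, Hy.
- intros H P [eps He].
  destruct (H eps (cond_pos eps)) as [d [Hd Hy]].
  exists (mkposreal d Hd); intros y B; apply He.
  apply C_NormedModule_mixin_compat1, Hy, B.
Qed.

Lemma cs_mono M N g : M <= N -> cs M g -> cs N g.
Proof. intros H [c z]; split; auto; intros x Hx; apply z; lra. Qed.

Lemma cs_lin M a b f g : cs M f -> cs M g -> cs M (fun s => a * f s + b * g s)%C.
Proof.
intros [cf zf] [cg zg]; split.
- intros x; apply continuous_Cplus; apply continuous_Cmult; auto;
  apply continuous_const.
- intros x Hx; rewrite zf, zg by exact Hx; ring.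
Qed.

Lemma Cminus_lin (a b : C) : (a - b)%C = (1 * a + RtoC (-1) * b)%C.
Proof. apply injective_projections; simpl; ring. Qed.

Lemma cs_minus M f g : cs M f -> cs M g -> cs M (fun s => f s - g s)%C.
Proof.
intros Hf Hg.
replace (fun s => f s - g s)%C with (fun s => 1 * f s + RtoC (-1) * g s)%C
  by (apply functional_extensionality; intros; symmetry; apply Cminus_lin).
apply cs_lin; assumption.
Qed.

Lemma cs_mult M f g : (forall x, continuous f x) -> cs M g ->
  cs M (fun s => g s * f s)%C.
Proof.
intros cf [cg zg]; split.
- intros x; apply continuous_Cmult; auto.
- intros x Hx; rewrite zg by exact Hx; ring.
Qed.

Lemma continuous_C_unif (g : R -> C) (u : nat -> R -> C) e :
  is_lim_seq e (Finite 0) -> (forall n x, continuous (u n) x) ->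
  (forall x n, Cmod (g x - u n x)%C <= e n) -> forall x, continuous g x.
Proof.
intros He Hu H x; apply continuous_C_eps; intros eps Heps.
destruct (lim_0_eps e (eps / 3) He) as [N HN]; [lra|].
destruct (proj1 (continuous_C_eps _ _) (Hu N x) (eps / 3)) as [d [Hd Hy]]; [lra|].
exists d; split; [exact Hd|]; intros y Hyd; specialize (Hy y Hyd).
pose proof (HN N (Nat.le_refl N)).
pose proof (Cmod_triang3 (g y) (u N y) (g x)).
pose proof (Cmod_triang3 (u N y) (u N x) (g x)).
pose proof (H x N) as Hx; rewrite Cmod_minus_sym in Hx.
pose proof (H y N); lra.
Qed.

Lemma cs_unif M (g : R -> C) (u : nat -> R -> C) e :
  is_lim_seq e (Finite 0) -> (forall n, cs M (u n)) ->
  (forall x n, Cmod (g x - u n x)%C <= e n) -> cs M g.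
Proof.
intros He Hu H; split.
- apply (continuous_C_unif g u e He); auto; intros n; apply Hu.
- intros x Hx; apply (C_eq_of_lim _ _ e He); intros n.
  rewrite <- (proj2 (Hu n) x Hx); apply H.
Qed.

(** The radius in [cs] is an arbitrary real, whereas integrals over [-M, M] want it positive. *)
Lemma cs_pos M g : cs M g -> cs (Rmax M 1) g.
Proof. apply cs_mono, Rmax_l. Qed.

Lemma cs_bounded M g : cs M g -> exists B, 0 < B /\ forall x, Cmod (g x) <= B.
Proof.
intros Hg; apply cs_pos in Hg; set (m := Rmax M 1) in *.
assert (Hm : - m <= m) by (generalize (Rmax_r M 1); unfold m; lra).
destruct (continuity_ab_maj (fun x => Cmod (g x)) (- m) m Hm) as [X [HX _]].
- intros c _ eps He.
  destruct (proj1 (continuous_C_eps _ _) (proj1 Hg c) eps He) as [d [Hd Hy]].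
  exists d; split; [exact Hd|]; intros y [_ Hyd].
  change (Rabs (y - c) < d) in Hyd.
  change (Rabs (Cmod (g y) - Cmod (g c)) < eps).
  specialize (Hy y Hyd).
  eapply Rle_lt_trans; [apply Cmod_lip|exact Hy].
- exists (Cmod (g X) + 1); split; [generalize (Cmod_ge_0 (g X)); lra|].
  intros x; destruct (Rle_dec (Rabs x) m) as [L|L].
  + apply Rabs_le_between in L; pose proof (HX x L) as Q; cbv beta in Q; lra.
  + rewrite (proj2 Hg) by lra; rewrite Cmod_0; generalize (Cmod_ge_0 (g X)); lra.
Qed.

Lemma is_RInt_C_zero (g : R -> C) a b :
  (forall x, a < x < b -> g x = RtoC 0) -> a <= b ->
  is_RInt (V := C_R_NormedModule) g a b zero.
Proof.
intros H Hab.
apply (is_RInt_ext (V := C_R_NormedModule) (fun _ => zero)).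
- intros x Hx; rewrite Rmin_left, Rmax_right in Hx by lra.
  symmetry; apply H, Hx.
- pose proof (is_RInt_const (V := C_R_NormedModule) a b zero) as I.
  exact (eq_ind _ (is_RInt (V := C_R_NormedModule) (fun _ => zero) a b) I _
    (scal_zero_r (V := C_R_NormedModule) (b - a))).
Qed.

Lemma is_RInt_C_continuous (g : R -> C) a b : (forall x, continuous g x) ->
  is_RInt (V := C_R_NormedModule) g a b
    (RInt (V := C_R_CompleteNormedModule) g a b).
Proof.
intros Hc; apply (RInt_correct (V := C_R_CompleteNormedModule)).
apply (ex_RInt_continuous (V := C_R_CompleteNormedModule)); auto.
Qed.

Lemma is_RInt_C_widen (g : R -> C) M x y l : 0 <= M ->
  (forall x, M < Rabs x -> g x = RtoC 0) -> x <= - M -> M <= y ->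
  is_RInt (V := C_R_NormedModule) g (- M) M l ->
  is_RInt (V := C_R_NormedModule) g x y l.
Proof.
intros HM Hz Hx Hy HI.
rewrite <- (plus_zero_l (G := C_R_NormedModule) l).
apply (is_RInt_Chasles (V := C_R_NormedModule)) with (- M).
- apply is_RInt_C_zero; [|lra]. intros s Hs; apply Hz.
  rewrite Rabs_left by lra; lra.
- rewrite <- (plus_zero_r (G := C_R_NormedModule) l).
  apply (is_RInt_Chasles (V := C_R_NormedModule)) with M; [exact HI|].
  apply is_RInt_C_zero; [|lra]. intros s Hs; apply Hz.
  rewrite Rabs_right by lra; lra.
Qed.

Lemma Cint_unique (g : R -> C) M l : 0 <= M -> cs M g ->
  is_RInt (V := C_R_NormedModule) g (- M) M l -> Cint g = l.
Proof.
intros HM [Hc Hz] HI.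
assert (H : is_RInt_gen (V := C_R_NormedModule) g
  (Rbar_locally m_infty) (Rbar_locally p_infty) l).
{ intros P HP.
  exists (fun x => x < - M) (fun x => M < x).
  - exists (- M); auto.
  - exists M; auto.
  - intros x y Hx Hy; simpl; exists l; split; [|apply locally_singleton, HP].
    apply (is_RInt_C_widen g M); auto; lra. }
exact (is_RInt_gen_unique (V := C_R_CompleteNormedModule) g l H).
Qed.

Lemma is_RInt_Cint (g : R -> C) M : 0 <= M -> cs M g ->
  is_RInt (V := C_R_NormedModule) g (- M) M (Cint g).
Proof.
intros HM Hg.
pose proof (is_RInt_C_continuous g (- M) M (proj1 Hg)) as I.
rewrite (Cint_unique g M _ HM Hg I); exact I.
Qed.

Lemma Cint_bound (g : R -> C) M B : 0 <= M -> cs M g ->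
  (forall x, Cmod (g x) <= B) -> Cmod (Cint g) <= 2 * M * B.
Proof.
intros HM Hg HB; rewrite <- norm_Cmod.
pose proof (is_RInt_Cint g M HM Hg) as I.
replace (2 * M * B) with (scal (M - - M) B)
  by (unfold scal; simpl; unfold mult; simpl; ring).
apply (norm_RInt_le (V := C_R_NormedModule) g (fun _ => B) (- M) M); [lra| |exact I|].
- intros x _; rewrite norm_Cmod; apply HB.
- apply (is_RInt_const (V := R_NormedModule)).
Qed.

Lemma continuous_shift (V : UniformSpace) (g : R -> V) h :
  (forall x, continuous g x) -> forall x, continuous (fun s => g (s + h)) x.
Proof.
intros Hc x; apply (continuous_comp (fun s => s + h) g); [|apply Hc].
apply (continuous_plus (V := R_NormedModule));
  [apply continuous_id|apply continuous_const].
Qed.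

Lemma cs_shift M g h : cs M g -> cs (M + Rabs h) (fun s => g (s + h)).
Proof.
intros [Hc Hz]; split.
- apply continuous_shift, Hc.
- intros x Hx; apply Hz.
  generalize (Rabs_triang (x + h) (- h)); rewrite Rabs_Ropp.
  replace (x + h + - h) with x by ring; lra.
Qed.

Lemma cs_shift_1 M g h : Rabs h <= 1 -> cs M g -> cs (M + 1) (fun s => g (s + h)).
Proof. intros Hh Hg; apply cs_mono with (M + Rabs h); [lra|apply cs_shift, Hg]. Qed.

Lemma Cint_shift M g h : cs M g -> Cint (fun s => g (s + h)) = Cint g.
Proof.
intros Hg; apply cs_pos in Hg; set (m := Rmax M 1) in *.
assert (Hm : 0 <= m) by (generalize (Rmax_r M 1); unfold m; lra).
assert (Hh : 0 <= m + Rabs h) by (generalize (Rabs_pos h); lra).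
apply (Cint_unique _ (m + Rabs h) _ Hh (cs_shift _ _ _ Hg)).
apply (is_RInt_ext (V := C_R_NormedModule)
  (fun s => scal 1 (g (1 * s + h)))).
- intros x _.
  pose proof (scal_one (V := C_R_NormedModule) (g (1 * x + h))) as E.
  etransitivity; [exact E|f_equal; ring].
- apply (is_RInt_comp_lin (V := C_R_NormedModule)).
  apply is_RInt_C_widen with m; auto.
  + apply Hg.
  + generalize (Rle_abs h); lra.
  + generalize (Rle_abs (- h)); rewrite Rabs_Ropp; lra.
  + apply is_RInt_Cint; auto.
Qed.

Lemma cis_plus a b : cis (a + b) = (cis a * cis b)%C.
Proof.
unfold cis, Cmult; simpl; rewrite cos_plus, sin_plus; f_equal; ring.
Qed.

Lemma Cmod_cis a : Cmod (cis a) = 1.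
Proof.
unfold Cmod, cis; simpl.
replace (cos a * (cos a * 1) + sin a * (sin a * 1)) with (Rsqr (sin a) + Rsqr (cos a))
  by (unfold Rsqr; ring).
rewrite sin2_cos2; apply sqrt_1.
Qed.

Lemma cis_0 : cis 0 = RtoC 1.
Proof. unfold cis; rewrite cos_0, sin_0; reflexivity. Qed.

Lemma two_cos x : RtoC (2 * cos x) = (cis x + cis (- x))%C.
Proof.
unfold cis, Cplus, RtoC; simpl; rewrite cos_neg, sin_neg; f_equal; ring.
Qed.

Lemma cs_cis M g t : cs M g -> cs M (fun s => g s * cis (- (t * s)))%C.
Proof. intros Hg; apply cs_mult; [intros x; apply continuous_cis|exact Hg]. Qed.

Lemma fourier_bound (g : R -> C) M B t : 0 <= M -> cs M g ->
  (forall x, Cmod (g x) <= B) -> Cmod (fourier g t) <= M / PI * B.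
Proof.
intros HM Hg HB; unfold fourier.
pose proof PI_RGT_0 as HP.
rewrite Cmod_mult, Cmod_RtoC_pos
  by (left; apply Rinv_0_lt_compat; lra).
apply Rle_trans with (/ (2 * PI) * (2 * M * B)); [|right; field; lra].
apply Rmult_le_compat_l; [left; apply Rinv_0_lt_compat; lra|].
apply (Cint_bound _ M); [exact HM|apply cs_cis, Hg|].
intros x; rewrite Cmod_mult, Cmod_cis, Rmult_1_r; apply HB.
Qed.

Lemma fourier_lin_cs a b f g M t : cs M f -> cs M g ->
  fourier (fun s => a * f s + b * g s)%C t = (a * fourier f t + b * fourier g t)%C.
Proof. intros [cf zf] [cg zg]; apply fourier_lin with M; assumption. Qed.

Lemma fourier_minus M f g t : cs M f -> cs M g ->
  fourier (fun s => f s - g s)%C t = (fourier f t - fourier g t)%C.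
Proof.
intros Hf Hg; rewrite Cminus_lin, <- (fourier_lin_cs _ _ _ _ M) by assumption.
f_equal; apply functional_extensionality; intros; apply Cminus_lin.
Qed.

Lemma fourier_ext f g t : (forall s, f s = g s) -> fourier f t = fourier g t.
Proof. intros H; f_equal; apply functional_extensionality, H. Qed.

Lemma fourier_shift M g h t : cs M g ->
  fourier (fun s => g (s + h)) t = (cis (t * h) * fourier g t)%C.
Proof.
intros Hg; unfold fourier.
rewrite <- (Cint_shift M (fun s => g s * cis (- (t * s)))%C h (cs_cis _ _ _ Hg)).
(* The summand with coefficient 0 only brings the integrand into the shape required by
   [Cint_lin]. *)
assert (E : (fun s : R => g (s + h)%R * cis (- (t * s)))%C =
  (fun s : R => cis (t * h) * (g (s + h)%R * cis (- (t * (s + h))))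
     + 0 * (g (s + h)%R * cis (- (t * (s + h)))))%C).
{ apply functional_extensionality; intros s.
  replace (- (t * s)) with (t * h + - (t * (s + h))) by ring.
  rewrite cis_plus; ring. }
pose proof (cs_shift M _ h (cs_cis M g t Hg)) as [A B].
rewrite E, (Cint_lin _ _ _ _ (M + Rabs h)); auto; ring.
Qed.

Lemma fourier_mod g r t :
  fourier (fun s => cis (r * s) * g s)%C t = fourier g (t - r).
Proof.
unfold fourier; do 2 f_equal; apply functional_extensionality; intros s.
replace (- ((t - r) * s)) with (r * s + - (t * s)) by ring.
rewrite cis_plus; ring.
Qed.

Lemma fourier_unif (g : R -> C) (u : nat -> R -> C) M e t :
  0 <= M -> is_lim_seq e (Finite 0) -> (forall n, cs M (u n)) ->
  (forall x n, Cmod (g x - u n x)%C <= e n) ->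
  forall n, Cmod (fourier g t - fourier (u n) t)%C <= M / PI * e n.
Proof.
intros HM He Hu H n.
pose proof (cs_unif M g u e He Hu H) as Hg.
rewrite <- (fourier_minus M) by auto.
apply fourier_bound; [exact HM|apply cs_minus; auto|intros x; apply H].
Qed.

(** * A sup bound by the Fourier transform *)

Definition dirichlet (m : nat) (x : R) : R :=
  1 + Rsum (fun j => 2 * cos (INR (S j) * x)) m.

(* [n] times the usual Fejer kernel. *)
Definition fejer (n : nat) (x : R) : R := Rsum (fun m => dirichlet m x) n.

Lemma dirichlet_closed m x :
  dirichlet m x * sin (x / 2) = sin (INR m * x + x / 2).
Proof.
induction m as [|m IH].
- unfold dirichlet; simpl; rewrite Rplus_0_r, Rmult_0_l, Rplus_0_l, Rmult_1_l; reflexivity.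
- replace (dirichlet (S m) x) with (dirichlet m x + 2 * cos (INR (S m) * x))
    by (unfold dirichlet; cbn [Rsum]; ring).
  rewrite Rmult_plus_distr_r, IH.
  replace (INR m * x + x / 2) with (INR (S m) * x - x / 2)
    by (rewrite S_INR; field).
  rewrite sin_minus, sin_plus; ring.
Qed.

(** Telescoping: by [dirichlet_closed] the n-th increment is sin (a + b) sin (b - a) = sin^2 b -
    sin^2 a with a = n x / 2 and b = (n + 1) x / 2. *)
Lemma fejer_closed n x :
  fejer n x * sin (x / 2) ^ 2 = sin (INR n * (x / 2)) ^ 2.
Proof.
induction n as [|n IH].
- unfold fejer; simpl; rewrite !Rmult_0_l, sin_0; ring.
- replace (fejer (S n) x) with (fejer n x + dirichlet n x)
    by (unfold fejer; simpl; ring).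
  rewrite Rmult_plus_distr_r, IH.
  replace (dirichlet n x * sin (x / 2) ^ 2)
    with (dirichlet n x * sin (x / 2) * sin (x / 2)) by ring.
  rewrite dirichlet_closed.
  replace (INR n * x + x / 2) with (INR n * (x / 2) + INR (S n) * (x / 2))
    by (rewrite S_INR; field).
  assert (E : sin (x / 2) = sin (INR (S n) * (x / 2) - INR n * (x / 2)))
    by (f_equal; rewrite S_INR; ring).
  rewrite E.
  set (a := INR n * (x / 2)); set (b := INR (S n) * (x / 2)).
  rewrite sin_plus, sin_minus.
  assert (Ca : cos a ^ 2 = 1 - sin a ^ 2)
    by (generalize (sin2_cos2 a); unfold Rsqr; intros; lra).
  assert (Cb : cos b ^ 2 = 1 - sin b ^ 2)
    by (generalize (sin2_cos2 b); unfold Rsqr; intros; lra).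
  replace ((sin a * cos b + cos a * sin b) * (sin b * cos a - cos b * sin a))
    with (sin b ^ 2 * cos a ^ 2 - sin a ^ 2 * cos b ^ 2) by ring.
  rewrite Ca, Cb; ring.
Qed.

(** Read off the closed form when its divisor is nonzero and off the cosine sum at 0; the two cases
    cover the period [-PI, PI]. *)
Lemma fejer_ge0 n x : sin (x / 2) <> 0 \/ x = 0 -> 0 <= fejer n x.
Proof.
intros [H|H].
- assert (P : 0 < sin (x / 2) ^ 2) by (apply pow2_gt_0, H).
  apply Rmult_le_reg_r with (1 := P).
  rewrite fejer_closed, Rmult_0_l; apply pow2_ge_0.
- subst x; apply Rsum_ge0; intros m; unfold dirichlet.
  assert (0 <= Rsum (fun j => 2 * cos (INR (S j) * 0)) m); [|lra].
  apply Rsum_ge0; intros j; rewrite Rmult_0_r, cos_0; lra.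
Qed.

Lemma fejer_away n x s : 0 < s -> s <= Rabs (sin (x / 2)) -> fejer n x <= / s ^ 2.
Proof.
intros Hs H.
assert (Hp : s ^ 2 <= sin (x / 2) ^ 2)
  by (rewrite <- (pow2_abs (sin _)); apply pow_incr; lra).
assert (P : 0 < s ^ 2) by (apply pow_lt, Hs).
apply Rmult_le_reg_r with (s ^ 2); [exact P|].
rewrite Rinv_l by lra.
assert (Hn : 0 <= fejer n x).
{ apply fejer_ge0; left; intros E; rewrite E, Rabs_R0 in H; lra. }
apply Rle_trans with (fejer n x * sin (x / 2) ^ 2).
- apply Rmult_le_compat_l; assumption.
- rewrite fejer_closed.
  generalize (sin2_cos2 (INR n * (x / 2))), (Rle_0_sqr (cos (INR n * (x / 2)))).
  unfold Rsqr; intros; simpl; lra.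
Qed.

Lemma continuous_cos_lin k x : continuous (fun s => cos (k * s)) x.
Proof.
apply (continuous_comp (fun s => k * s) cos); [|apply continuous_cos].
apply (continuous_mult (K := R_AbsRing));
  [apply continuous_const|apply continuous_id].
Qed.

Lemma continuous_sin_lin k x : continuous (fun s => sin (k * s)) x.
Proof.
apply (continuous_comp (fun s => k * s) sin); [|apply continuous_sin].
apply (continuous_mult (K := R_AbsRing));
  [apply continuous_const|apply continuous_id].
Qed.

Lemma continuous_Rsum (a : nat -> R -> R) n x :
  (forall j, continuous (a j) x) -> continuous (fun s => Rsum (fun j => a j s) n) x.
Proof.
intros H; induction n as [|n IH]; simpl; [apply continuous_const|].
apply (continuous_plus (V := R_NormedModule)); auto.
Qed.

Lemma continuous_dirichlet m lam x : continuous (fun s => dirichlet m (lam * s)) x.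
Proof.
apply (continuous_plus (V := R_NormedModule)); [apply continuous_const|].
apply (continuous_Rsum (fun j s => 2 * cos (INR (S j) * (lam * s)))).
intros j; apply (continuous_mult (K := R_AbsRing)); [apply continuous_const|].
apply (continuous_ext (fun s => cos ((INR (S j) * lam) * s)));
  [intros s; f_equal; ring|apply continuous_cos_lin].
Qed.

Lemma continuous_RtoC (u : R -> R) x :
  continuous u x -> continuous (fun s => RtoC (u s)) x.
Proof. intros H; apply continuous_Cpair; [exact H|apply continuous_const]. Qed.

Lemma is_RInt_cos k p : k <> 0 ->
  is_RInt (fun s => cos (k * s)) (- p) p (2 * sin (k * p) / k).
Proof.
intros Hk.
replace (2 * sin (k * p) / k)
  with (minus (sin (k * p) / k) (sin (k * - p) / k)).
- apply (is_RInt_derive (V := R_CompleteNormedModule) (fun s => sin (k * s) / k)).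
  + intros x _; auto_derive; [exact I|field; exact Hk].
  + intros x _; apply continuous_cos_lin.
- unfold minus, plus, opp; simpl.
  replace (k * - p) with (- (k * p)) by ring; rewrite sin_neg; field; exact Hk.
Qed.

Lemma sin_INR_PI j : sin (INR j * PI) = 0.
Proof.
induction j as [|j IH]; [simpl; rewrite Rmult_0_l; apply sin_0|].
rewrite S_INR, Rmult_plus_distr_r, Rmult_1_l, sin_plus, IH, sin_PI; ring.
Qed.

Lemma is_RInt_dirichlet m lam : 0 < lam ->
  is_RInt (fun s => dirichlet m (lam * s)) (- (PI / lam)) (PI / lam) (2 * (PI / lam)).
Proof.
intros Hl; induction m as [|m IH].
- apply (is_RInt_ext (fun _ => 1)).
  + intros s _; unfold dirichlet; simpl; ring.
  + replace (2 * (PI / lam)) with (scal (PI / lam - - (PI / lam)) 1)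
      by (unfold scal; simpl; unfold mult; simpl; ring).
    apply (is_RInt_const (V := R_NormedModule)).
- apply (is_RInt_ext (fun s => plus (dirichlet m (lam * s))
    (scal 2 (cos ((INR (S m) * lam) * s))))).
  + intros s _; unfold dirichlet; cbn [Rsum]; unfold plus, scal; simpl.
    unfold mult; simpl; rewrite !(Rmult_assoc _ lam s); ring.
  + replace (2 * (PI / lam)) with (plus (2 * (PI / lam))
      (scal 2 (2 * sin (INR (S m) * lam * (PI / lam)) / (INR (S m) * lam)))).
    * apply (is_RInt_plus (V := R_NormedModule)); [exact IH|].
      apply (is_RInt_scal (V := R_NormedModule)), is_RInt_cos.
      apply Rmult_integral_contrapositive; split; [|lra].
      apply not_0_INR; lia.
    * replace (INR (S m) * lam * (PI / lam)) with (INR (S m) * PI) by (field; lra).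
      rewrite sin_INR_PI; unfold plus, scal; simpl plus; unfold mult; simpl mult.
      unfold Rdiv; rewrite Rmult_0_r, Rmult_0_l, Rmult_0_r, Rplus_0_r; reflexivity.
Qed.

Lemma is_RInt_fejer n lam : 0 < lam ->
  is_RInt (fun s => fejer n (lam * s)) (- (PI / lam)) (PI / lam)
    (INR n * (2 * (PI / lam))).
Proof.
intros Hl; induction n as [|n IH].
- apply (is_RInt_ext (fun _ => 0)); [reflexivity|].
  replace (INR 0 * (2 * (PI / lam))) with (scal (PI / lam - - (PI / lam)) 0)
    by (unfold scal; simpl; unfold mult; simpl; ring).
  apply (is_RInt_const (V := R_NormedModule)).
- rewrite S_INR, Rmult_plus_distr_r, Rmult_1_l.
  apply (is_RInt_plus (V := R_NormedModule)); [exact IH|apply is_RInt_dirichlet, Hl].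
Qed.

(** Telescoping: the right side increases by 4 / ((2m + 1)(2m + 3)), and (2m + 1)(2m + 3) < 4 (m +
    1)^2. *)
Lemma sum_inv_sqr m : Rsum (fun j => / INR (S j) ^ 2) m <= 2 - 2 / (2 * INR m + 1).
Proof.
induction m as [|m IH]; [simpl; lra|].
cbn [Rsum]; rewrite !S_INR in *.
pose proof (pos_INR m).
assert (/ (INR m + 1) ^ 2 <= 2 / (2 * INR m + 1) - 2 / (2 * (INR m + 1) + 1)); [|lra].
replace (2 / (2 * INR m + 1) - 2 / (2 * (INR m + 1) + 1))
  with (/ ((2 * INR m + 1) * (2 * INR m + 3) / 4)) by (field; lra).
apply Rinv_le_contravar; nra.
Qed.

Lemma fourier_two_cos G M t : cs M G ->
  Cint (fun s => G s * RtoC (2 * cos (t * s)))%C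
  = (RtoC (2 * PI) * (fourier G t + fourier G (- t)))%C.
Proof.
intros HG; pose proof PI_RGT_0 as HP.
replace (fun s => (G s * RtoC (2 * cos (t * s)))%C)
  with (fun s => (1 * (G s * cis (- (- t * s))) + 1 * (G s * cis (- (t * s))))%C).
- destruct (cs_cis M G t HG) as [c1 z1], (cs_cis M G (- t) HG) as [c2 z2].
  rewrite (Cint_lin _ _ _ _ M) by assumption.
  unfold fourier.
  assert (E : (RtoC (2 * PI) * RtoC (/ (2 * PI)))%C = RtoC 1)
    by (rewrite <- RtoC_mult, Rinv_r by lra; reflexivity).
  set (a := Cint _); set (b := Cint _).
  transitivity ((RtoC (2 * PI) * RtoC (/ (2 * PI))) * (a + b))%C;
    [rewrite E; ring|ring].
- apply functional_extensionality; intros s; rewrite two_cos.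
  replace (- (- t * s)) with (t * s) by ring; ring.
Qed.

Lemma fourier_decay_step B t x : 0 < Rabs t -> (1 + t ^ 2) * x <= B ->
  0 <= x -> x <= B * / t ^ 2.
Proof.
intros Ht H Hx.
assert (P : 0 < t ^ 2) by (rewrite <- pow2_abs; apply pow_lt, Ht).
apply Rmult_le_reg_r with (t ^ 2); [exact P|].
rewrite Rmult_assoc, Rinv_l by lra; nra.
Qed.

Lemma decay_ge0 G B : (forall t, (1 + t ^ 2) * Cmod (fourier G t) <= B) -> 0 <= B.
Proof.
intros HB; apply Rle_trans with (2 := HB 0), Rmult_le_pos; [|apply Cmod_ge_0].
generalize (pow2_ge_0 0); lra.
Qed.

(** Up to 2 PI the integral is a symmetric partial sum of the values of the transform at the points
    j lam, which are summed in absolute value: B at 0 and B / (j lam)^2 at each of the two points +-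
    j lam. *)
Lemma Cint_dirichlet_bound G M lam B m : 0 < lam -> cs M G ->
  (forall t, (1 + t ^ 2) * Cmod (fourier G t) <= B) ->
  Cmod (Cint (fun s => G s * RtoC (dirichlet m (lam * s))))%C
  <= 2 * PI * (B * (1 + 2 / lam ^ 2 * Rsum (fun j => / INR (S j) ^ 2) m)).
Proof.
intros Hl HG HB; pose proof PI_RGT_0 as HP.
assert (HC : forall u : R -> R, (forall x, continuous u x) ->
  cs M (fun s => G s * RtoC (u s))%C).
{ intros u Hu; apply cs_mult; [|exact HG]; intros x; apply continuous_RtoC, Hu. }
induction m as [|m IH].
- replace (fun s => (G s * RtoC (dirichlet 0 (lam * s)))%C)
    with (fun s => (1 * (G s * cis (- (0 * s))) + 0 * (G s * cis (- (0 * s))))%C).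
  + destruct (cs_cis M G 0 HG) as [c z].
    rewrite (Cint_lin _ _ _ _ M) by assumption.
    replace (1 * Cint (fun s => G s * cis (- (0 * s))) + 0 * Cint (fun s => G s * cis (- (0 * s))))%C
      with (RtoC (2 * PI) * fourier G 0)%C.
    * rewrite Cmod_mult, Cmod_RtoC_pos by lra.
      apply Rmult_le_compat_l; [lra|].
      generalize (HB 0); simpl; lra.
    * unfold fourier; rewrite Cmult_assoc, <- RtoC_mult, Rinv_r by lra; ring.
  + apply functional_extensionality; intros s.
    unfold dirichlet; cbn [Rsum]; rewrite Rmult_0_l, Ropp_0, cis_0, Rplus_0_r; ring.
- set (t := INR (S m) * lam).
  assert (Ht : 0 < t) by (apply Rmult_lt_0_compat; [apply lt_0_INR; lia|exact Hl]).
  replace (fun s => (G s * RtoC (dirichlet (S m) (lam * s)))%C)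
    with (fun s => (1 * (G s * RtoC (dirichlet m (lam * s)))
       + 1 * (G s * RtoC (2 * cos (t * s))))%C).
  + destruct (HC _ (continuous_dirichlet m lam)) as [c1 z1].
    destruct (HC (fun s => 2 * cos (t * s))) as [c2 z2].
    { intros x; apply (continuous_mult (K := R_AbsRing));
        [apply continuous_const|apply continuous_cos_lin]. }
    rewrite (Cint_lin _ _ _ _ M) by assumption.
    rewrite (fourier_two_cos G M) by assumption.
    rewrite !Cmult_1_l.
    eapply Rle_trans; [apply Cmod_triangle|].
    cbn [Rsum].
    replace (2 * PI * (B * (1 + 2 / lam ^ 2 * (Rsum (fun j : nat => / INR (S j) ^ 2) m + / INR (S m) ^ 2))))
      with (2 * PI * (B * (1 + 2 / lam ^ 2 * Rsum (fun j : nat => / INR (S j) ^ 2) m))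
        + 2 * PI * (B * / t ^ 2 + B * / t ^ 2)).
    * apply Rplus_le_compat; [exact IH|].
      rewrite Cmod_mult, Cmod_RtoC_pos by lra.
      apply Rmult_le_compat_l; [lra|].
      eapply Rle_trans; [apply Cmod_triangle|].
      apply Rplus_le_compat.
      -- apply fourier_decay_step; [rewrite Rabs_right; lra|apply HB|apply Cmod_ge_0].
      -- replace (t ^ 2) with ((- t) ^ 2) by ring.
         apply fourier_decay_step; [rewrite Rabs_left; lra|apply HB|apply Cmod_ge_0].
    * unfold t; field; repeat split; first [lra|apply not_0_INR; lia].
  + apply functional_extensionality; intros s.
    unfold dirichlet; cbn [Rsum]; rewrite <- !(Rmult_assoc (INR _) lam s); fold t.
    rewrite !RtoC_plus; ring.
Qed.

Lemma continuous_fejer n lam x : continuous (fun s => fejer n (lam * s)) x.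
Proof.
apply (continuous_Rsum (fun m s => dirichlet m (lam * s))).
intros m; apply continuous_dirichlet.
Qed.

Lemma Cint_fejer_bound G M lam B n : 0 < lam -> cs M G ->
  (forall t, (1 + t ^ 2) * Cmod (fourier G t) <= B) ->
  Cmod (Cint (fun s => G s * RtoC (fejer n (lam * s))))%C
  <= INR n * (2 * PI * (B * (1 + 4 / lam ^ 2))).
Proof.
intros Hl HG HB; pose proof PI_RGT_0 as HP.
assert (HB0 : 0 <= B).
{ exact (decay_ge0 G B HB). }
assert (HC : forall u : R -> R, (forall x, continuous u x) ->
  cs M (fun s => G s * RtoC (u s))%C).
{ intros u Hu; apply cs_mult; [|exact HG]; intros x; apply continuous_RtoC, Hu. }
induction n as [|n IH].
- replace (fun s => (G s * RtoC (fejer 0 (lam * s)))%C)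
    with (fun s => (0 * G s + 0 * G s)%C)
    by (apply functional_extensionality; intros s; unfold fejer; simpl; ring).
  destruct HG as [c z]; rewrite (Cint_lin _ _ _ _ M) by assumption.
  replace (0 * Cint G + 0 * Cint G)%C with (RtoC 0) by ring.
  rewrite Cmod_0; simpl; lra.
- replace (fun s => (G s * RtoC (fejer (S n) (lam * s)))%C)
    with (fun s => (1 * (G s * RtoC (fejer n (lam * s)))
       + 1 * (G s * RtoC (dirichlet n (lam * s))))%C).
  + destruct (HC _ (continuous_dirichlet n lam)) as [c1 z1].
    destruct (HC _ (continuous_fejer n lam)) as [c2 z2].
    rewrite (Cint_lin _ _ _ _ M) by assumption.
    rewrite !Cmult_1_l.
    eapply Rle_trans; [apply Cmod_triangle|].
    rewrite S_INR, Rmult_plus_distr_r, Rmult_1_l.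
    apply Rplus_le_compat; [exact IH|].
    eapply Rle_trans; [apply (Cint_dirichlet_bound G M lam B n); assumption|].
    apply Rmult_le_compat_l; [lra|].
    apply Rmult_le_compat_l; [exact HB0|].
    apply Rplus_le_compat_l.
    replace (4 / lam ^ 2) with (2 / lam ^ 2 * 2) by (field; lra).
    apply Rmult_le_compat_l.
    * left; apply Rmult_lt_0_compat; [lra|apply Rinv_0_lt_compat, pow_lt, Hl].
    * eapply Rle_trans; [apply sum_inv_sqr|].
      assert (0 < 2 / (2 * INR n + 1)); [|lra].
      generalize (pos_INR n); intros; apply Rdiv_lt_0_compat; lra.
  + apply functional_extensionality; intros s.
    unfold fejer; cbn [Rsum]; rewrite !RtoC_plus; ring.
Qed.

(* Substitute for Fourier inversion: the Fejer means converge to the function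
   and are bounded by the sum of the absolute Fourier coefficients. *)
Lemma fourier_sup_at_0 G M B : 0 < M -> cs M G ->
  (forall t, (1 + t ^ 2) * Cmod (fourier G t) <= B) ->
  Cmod (G 0) <= PI / M * (1 + 4 / (PI / M) ^ 2) * B.
Proof.
intros HM HG HB; pose proof PI_RGT_0 as HP.
(* With this scaling [-M, M] is exactly one period of the kernel. *)
set (lam := PI / M).
assert (Hl : 0 < lam) by (apply Rdiv_lt_0_compat; lra).
assert (Hp : PI / lam = M) by (unfold lam; field; lra).
destruct (cs_bounded M G HG) as [S [HS0 HS]].
set (D := lam * (1 + 4 / lam ^ 2) * B).
(* Approximate identity: for |s| < d the continuity of [G] contributes at most [eps], and elsewhere
   the kernel is at most 1 / s0^2 whatever n is, so that dividing by its mass 2 M n leaves O(1 /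
   n). *)
assert (Key : forall eps, 0 < eps -> exists K, forall n, (1 <= n)%nat ->
  Cmod (G 0) <= D + eps + K / INR n).
{ intros eps He.
  destruct (proj1 (continuous_C_eps _ _) (proj1 HG 0) eps He) as [d0 [Hd0 Hy]].
  set (d := Rmin d0 M).
  assert (Hd : 0 < d) by (apply Rmin_glb_lt; assumption).
  assert (HdM : d <= M) by apply Rmin_r.
  assert (Hdd : d <= d0) by apply Rmin_l.
  set (s0 := sin (lam * d / 2)).
  assert (Hang : forall s, 0 <= s <= M -> 0 <= lam * s / 2 <= PI / 2).
  { intros s Hs; split.
    - apply Rmult_le_pos; [apply Rmult_le_pos; lra|lra].
    - apply Rle_trans with (lam * M / 2); [|right; unfold lam; field; lra].
      apply Rmult_le_compat_r; [lra|apply Rmult_le_compat_l; lra]. }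
  assert (Hs0 : 0 < s0).
  { apply sin_gt_0.
    - apply Rmult_lt_0_compat; [apply Rmult_lt_0_compat; lra|lra].
    - generalize (Hang d); lra. }
  assert (Hsin : forall s, d <= Rabs s <= M -> s0 <= Rabs (sin (lam * s / 2))).
  { assert (Q : forall s, d <= s <= M -> s0 <= sin (lam * s / 2)).
    { intros s Hs; apply sin_incr_1; try (generalize (Hang d), (Hang s); lra).
      apply Rmult_le_compat_r; [lra|apply Rmult_le_compat_l; lra]. }
    intros s Hs; destruct (Rle_dec 0 s) as [L|L].
    - rewrite Rabs_right in Hs by lra.
      eapply Rle_trans; [apply (Q s Hs)|apply Rle_abs].
    - rewrite Rabs_left in Hs by lra.
      rewrite <- Rabs_Ropp, <- sin_neg.
      replace (- (lam * s / 2)) with (lam * (- s) / 2) by field.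
      eapply Rle_trans; [apply (Q (- s) Hs)|apply Rle_abs]. }
  assert (Hsn : forall s, Rabs s <= M -> sin (lam * s / 2) <> 0 \/ lam * s = 0).
  { assert (Q : forall s, 0 < s <= M -> sin (lam * s / 2) <> 0).
    { intros s Hs; apply Rgt_not_eq, sin_gt_0.
      - apply Rmult_lt_0_compat; [apply Rmult_lt_0_compat; lra|lra].
      - generalize (Hang s); lra. }
    intros s Hs; destruct (Rtotal_order s 0) as [L|[L|L]].
    - left; rewrite Rabs_left in Hs by lra; intros E.
      apply (Q (- s)); [lra|].
      replace (lam * - s / 2) with (- (lam * s / 2)) by field.
      rewrite sin_neg, E; ring.
    - right; rewrite L; ring.
    - left; rewrite Rabs_right in Hs by lra; apply Q; lra. }
  exists (2 * S * / s0 ^ 2); intros n Hn.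
  assert (Hn0 : 0 < INR n) by (apply lt_0_INR; lia).
  set (Fn := fun s => fejer n (lam * s)).
  assert (IF : is_RInt Fn (- M) M (INR n * (2 * M))).
  { rewrite <- Hp; apply is_RInt_fejer, Hl. }
  assert (IG : is_RInt (V := C_R_NormedModule) (fun s => G s * RtoC (Fn s))%C (- M) M
    (Cint (fun s => G s * RtoC (Fn s))%C)).
  { apply is_RInt_Cint; [lra|]; apply cs_mult; [|exact HG].
    intros x; apply continuous_RtoC, continuous_fejer. }
  assert (I0 : is_RInt (V := C_R_NormedModule) (fun s => G 0 * RtoC (Fn s))%C (- M) M
    (G 0 * RtoC (INR n * (2 * M)))%C).
  { apply is_RInt_Cmult.
    apply (is_RInt_fct_extend_pair (U := R_NormedModule) (V := R_NormedModule)).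
    - exact IF.
    - simpl.
      pose proof (is_RInt_const (V := R_NormedModule) (- M) M 0) as I.
      apply (is_RInt_ext (fun _ => 0)); [reflexivity|].
      exact (eq_ind _ (is_RInt (fun _ => 0) (- M) M) I _
        (scal_zero_r (V := R_NormedModule) (M - - M))). }
  pose proof (is_RInt_minus (V := C_R_NormedModule) _ _ _ _ _ _ I0 IG) as ID.
  assert (IB : is_RInt (fun s => plus (scal eps (Fn s)) (2 * S * / s0 ^ 2)) (- M) M
    (plus (scal eps (INR n * (2 * M))) (scal (M - - M) (2 * S * / s0 ^ 2)))).
  { apply (is_RInt_plus (V := R_NormedModule)).
    - apply (is_RInt_scal (V := R_NormedModule)), IF.
    - apply (is_RInt_const (V := R_NormedModule)). }
  assert (HMM : - M <= M) by lra.
  assert (Hpt : forall s, - M <= s <= M ->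
    norm (minus (G 0 * RtoC (Fn s))%C (G s * RtoC (Fn s))%C : C_R_NormedModule)
    <= plus (scal eps (Fn s)) (2 * S * / s0 ^ 2)).
  { intros s Hs; rewrite norm_Cmod.
    change (Cmod (G 0 * RtoC (Fn s) - G s * RtoC (Fn s))%C
      <= eps * Fn s + 2 * S * / s0 ^ 2).
    replace (G 0 * RtoC (Fn s) - G s * RtoC (Fn s))%C
      with ((G 0 - G s) * RtoC (Fn s))%C by ring.
    assert (Hs' : Rabs s <= M) by (apply Rabs_le_between; lra).
    assert (HF : 0 <= Fn s) by (apply fejer_ge0, Hsn, Hs').
    rewrite Cmod_mult, Cmod_RtoC_pos by exact HF.
    assert (Hsq : 0 < / s0 ^ 2) by (apply Rinv_0_lt_compat, pow_lt, Hs0).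
    destruct (Rlt_dec (Rabs s) d) as [L|L].
    - assert (Cmod (G 0 - G s)%C <= eps).
      { rewrite Cmod_minus_sym; left; apply Hy; rewrite Rminus_0_r; lra. }
      assert (0 <= 2 * S * / s0 ^ 2) by (apply Rmult_le_pos; lra).
      assert (Cmod (G 0 - G s)%C * Fn s <= eps * Fn s)
        by (apply Rmult_le_compat_r; assumption).
      lra.
    - assert (Fn s <= / s0 ^ 2).
      { apply fejer_away; [exact Hs0|apply Hsin; lra]. }
      assert (Cmod (G 0 - G s)%C <= 2 * S).
      { eapply Rle_trans; [apply Cmod_sub_le|generalize (HS 0), (HS s); lra]. }
      assert (0 <= eps * Fn s) by (apply Rmult_le_pos; lra).
      assert (Cmod (G 0 - G s)%C * Fn s <= 2 * S * / s0 ^ 2)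
        by (apply Rmult_le_compat; try apply Cmod_ge_0; assumption).
      lra. }
  pose proof (norm_RInt_le (V := C_R_NormedModule) _ _ _ _ _ _ HMM Hpt ID IB) as NB.
  clear Hpt ID IB.
  rewrite norm_Cmod in NB.
  change (Cmod (G 0 * RtoC (INR n * (2 * M)) - Cint (fun s => G s * RtoC (Fn s)))%C
    <= eps * (INR n * (2 * M)) + (M - - M) * (2 * S * / s0 ^ 2)) in NB.
  pose proof (Cint_fejer_bound G M lam B n Hl HG HB) as CB.
  fold (Fn) in CB.
  pose proof (Cmod_le_sub (G 0 * RtoC (INR n * (2 * M)))%C
    (Cint (fun s => G s * RtoC (Fn s)))%C) as T.
  assert (HnM : 0 < INR n * (2 * M)) by (apply Rmult_lt_0_compat; lra).
  rewrite Cmod_mult, Cmod_RtoC_pos in T by lra.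
  apply Rmult_le_reg_r with (1 := HnM).
  apply Rle_trans with (1 := T).
  apply Rle_trans with (eps * (INR n * (2 * M)) + (M - - M) * (2 * S * / s0 ^ 2)
    + INR n * (2 * PI * (B * (1 + 4 / lam ^ 2)))).
  - apply Rplus_le_compat; [exact NB|exact CB].
  - right; unfold D; unfold lam; field; repeat split; try lra. }
apply le_epsilon; intros eps He.
destruct (Key (eps / 2)) as [K HK]; [lra|].
destruct (lim_0_eps (fun n => K * / INR n) (eps / 2)) as [N HN].
- apply lim_0_scal.
  apply (is_lim_seq_inv INR p_infty); [apply is_lim_seq_INR|discriminate].
- lra.
- specialize (HK (Datatypes.S N)); specialize (HN (Datatypes.S N)).
  pose proof (HK ltac:(lia)) as H1; pose proof (HN ltac:(lia)) as H2.
  fold lam; fold D; unfold Rdiv in H1; lra.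
Qed.

(** Translation brings the point x to 0: the modulus of the transform is unchanged, and for |x| <= M
    the support stays in [- 2m, 2m], so one constant serves all points. *)
Lemma fourier_sup M : exists K, 0 < K /\ forall g B, cs M g ->
  (forall t, (1 + t ^ 2) * Cmod (fourier g t) <= B) -> forall x, Cmod (g x) <= K * B.
Proof.
set (m := Rmax M 1).
assert (Hm : 1 <= m) by apply Rmax_r.
pose proof PI_RGT_0 as HP.
assert (Hl : 0 < PI / (m + m)) by (apply Rdiv_lt_0_compat; lra).
set (K := PI / (m + m) * (1 + 4 / (PI / (m + m)) ^ 2)).
assert (HK : 0 < K).
{ apply Rmult_lt_0_compat; [exact Hl|].
  assert (0 < 4 / (PI / (m + m)) ^ 2); [|lra].
  apply Rdiv_lt_0_compat; [lra|apply pow_lt, Hl]. }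
exists K; split; [exact HK|].
intros g B Hg HB x.
assert (HB0 : 0 <= B).
{ exact (decay_ge0 g B HB). }
destruct (Rle_dec (Rabs x) M) as [L|L].
- assert (Hgx : cs (m + m) (fun s => g (s + x))).
  { apply cs_mono with (m + Rabs x); [generalize (Rmax_l M 1); unfold m; lra|].
    apply cs_shift, cs_pos, Hg. }
  replace (g x) with (g (0 + x)) by (f_equal; ring).
  apply (fourier_sup_at_0 (fun s => g (s + x)) (m + m) B); [lra|exact Hgx|].
  intros t; rewrite (fourier_shift M g x t Hg), Cmod_mult, Cmod_cis, Rmult_1_l.
  apply HB.
- rewrite (proj2 Hg) by lra; rewrite Cmod_0; apply Rmult_le_pos; lra.
Qed.

(** The sup bound for the difference, with B = 0. *)
Lemma fourier_inj M g h : cs M g -> cs M h ->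
  (forall t, fourier g t = fourier h t) -> forall x, g x = h x.
Proof.
intros Hg Hh E x; destruct (fourier_sup M) as [K [_ HK]].
specialize (HK (fun s => g s - h s)%C 0 (cs_minus M _ _ Hg Hh)).
apply (C_eq_of_lim _ _ (fun _ => 0)); [apply is_lim_seq_const|intros _].
rewrite <- (Rmult_0_r K); apply HK; intros t.
rewrite (fourier_minus M), E by assumption.
replace (fourier h t - fourier h t)%C with (RtoC 0) by ring.
rewrite Cmod_0; lra.
Qed.

(** * Elementary bounds for sine and cosine *)

Lemma sin_le_abs y : Rabs (sin y) <= Rabs y.
Proof.
assert (P : forall y, 0 < y -> Rabs (sin y) <= y).
{ intros x Hx; apply Rabs_le; split; [|left; apply sin_lt_x, Hx].
  destruct (Rle_dec x PI) as [L|L].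
  - generalize (sin_ge_0 x); lra.
  - generalize (SIN_bound x), PI2_1; lra. }
destruct (Rtotal_order y 0) as [L|[L|L]].
- rewrite <- (Rabs_Ropp y), <- (Rabs_Ropp (sin y)), <- sin_neg.
  rewrite (Rabs_right (- y)) by lra; apply P; lra.
- subst; rewrite sin_0; lra.
- rewrite (Rabs_right y) by lra; apply P, L.
Qed.

Lemma one_minus_cos x : 0 <= 1 - cos x <= x ^ 2 / 2.
Proof.
assert (E : 1 - cos x = 2 * sin (x / 2) ^ 2).
{ replace x with (2 * (x / 2)) at 1 by field; rewrite cos_2a_sin; ring. }
rewrite E, <- (pow2_abs (sin _)).
assert (H : Rabs (sin (x / 2)) ^ 2 <= Rabs (x / 2) ^ 2).
{ apply pow_incr; split; [apply Rabs_pos|apply sin_le_abs]. }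
rewrite (pow2_abs (x / 2)) in H.
generalize (pow2_ge_0 (Rabs (sin (x / 2)))); lra.
Qed.

Lemma x_minus_sin x : 0 <= x -> 0 <= x - sin x <= x ^ 3 / 2.
Proof.
intros Hx; destruct (Rle_lt_or_eq_dec _ _ Hx) as [L|L];
  [|subst; rewrite sin_0; simpl; lra].
destruct (MVT_gen (fun y => y - sin y) 0 x (fun y => 1 - cos y)) as [c [Hc E]].
- intros y _; auto_derive; [exact I|ring].
- intros y _; apply continuity_pt_filterlim.
  apply (continuous_minus (V := R_NormedModule));
    [apply continuous_id|apply continuous_sin].
- rewrite Rmin_left, Rmax_right in Hc by lra.
  rewrite sin_0 in E; generalize (one_minus_cos c); intros B.
  assert (c ^ 2 <= x ^ 2) by (apply pow_incr; lra).
  replace (x - sin x) with ((1 - cos c) * x) by lra.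
  split; [apply Rmult_le_pos; lra|].
  replace (x ^ 3 / 2) with (x ^ 2 / 2 * x) by field.
  apply Rmult_le_compat_r; lra.
Qed.

(** By the half-angle formula the quantity is 4 (y^2 - sin^2 y) with y = |x| / 2, and y^2 - sin^2 y
    = (y - sin y)(y + sin y). *)
Lemma second_diff_cos x : Rabs (2 * cos x - 2 + x ^ 2) <= x ^ 4 / 4.
Proof.
assert (P : forall y, 0 <= y -> 0 <= y ^ 2 - sin y ^ 2 <= y ^ 4).
{ intros y Hy; generalize (x_minus_sin y Hy), (Rle_abs (- sin y)), (sin_le_abs y).
  rewrite Rabs_Ropp, (Rabs_right y) by lra; intros.
  replace (y ^ 2 - sin y ^ 2) with ((y - sin y) * (y + sin y)) by ring.
  split; [apply Rmult_le_pos; lra|].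
  replace (y ^ 4) with (y ^ 3 / 2 * (2 * y)) by field.
  apply Rmult_le_compat; lra. }
assert (E : 2 * cos x - 2 + x ^ 2 = 4 * (Rabs (x / 2) ^ 2 - sin (Rabs (x / 2)) ^ 2)).
{ rewrite pow2_abs.
  replace (sin (Rabs (x / 2)) ^ 2) with (sin (x / 2) ^ 2).
  - replace x with (2 * (x / 2)) at 1 by field; rewrite cos_2a_sin; field.
  - unfold Rabs; destruct (Rcase_abs _); [rewrite sin_neg; ring|reflexivity]. }
generalize (P _ (Rabs_pos (x / 2))); intros B.
replace (Rabs (x / 2) ^ 4) with (x ^ 4 / 16) in B.
- rewrite E, Rabs_right; lra.
- replace (Rabs (x / 2) ^ 4) with ((Rabs (x / 2) ^ 2) ^ 2) by ring.
  rewrite pow2_abs; field.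
Qed.

(** * Supports *)

Lemma supp_local (g : R -> C) x : ~ supp g x ->
  exists d, 0 < d /\ forall y, Rabs (y - x) < d -> g y = RtoC 0.
Proof.
intros H; apply not_all_ex_not in H; destruct H as [V H].
apply imply_to_and in H; destruct H as [[d Hd] H].
exists d; split; [apply cond_pos|]; intros y Hy.
apply NNPP; intros E; apply H; exists y; split; [apply Hd, Hy|exact E].
Qed.

(** Pointwise vanishing off [supp g] is enough because [supp g] is closed. *)
Lemma supp_incl (g h : R -> C) :
  (forall x, ~ supp g x -> h x = RtoC 0) -> included (supp h) (supp g).
Proof.
intros H x Hx; apply (adherence_P2 _ (adherence_P3 (fun x => g x <> RtoC 0))).
intros V HV; destruct (Hx V HV) as [y [Hy1 Hy2]].
exists y; split; [exact Hy1|].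
apply NNPP; intros E; apply Hy2, H, E.
Qed.

Lemma supp_out_of (g : R -> C) x : ~ supp g x -> g x = RtoC 0.
Proof.
intros H; destruct (supp_local g x H) as [d [Hd Hy]]; apply Hy.
rewrite Rminus_diag, Rabs_R0; exact Hd.
Qed.

Lemma cs_of_supp M (g h : R -> C) : cs M g -> (forall x, continuous h x) ->
  included (supp h) (supp g) -> cs M h.
Proof.
intros [_ Hz] Hc Hi; split; [exact Hc|].
apply supp_out; intros x Hx; apply (proj1 (supp_out g M) Hz), Hi, Hx.
Qed.

(** * Symmetric second differences *)

Definition step (n : nat) : R := / INR (S n).

Lemma step_pos n : 0 < step n.
Proof. apply Rinv_0_lt_compat, lt_0_INR; lia. Qed.

Lemma step_le n m : (n <= m)%nat -> step m <= step n.
Proof.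
intros H; apply Rinv_le_contravar; [apply lt_0_INR; lia|apply le_INR; lia].
Qed.

Lemma step_le1 n : step n <= 1.
Proof. replace 1 with (step 0) by (unfold step; simpl; field); apply step_le; lia. Qed.

Lemma step_abs n : Rabs (step n) <= 1.
Proof. rewrite Rabs_right; [apply step_le1|generalize (step_pos n); lra]. Qed.

Lemma step_abs_opp n : Rabs (- step n) <= 1.
Proof. rewrite Rabs_Ropp; apply step_abs. Qed.

Lemma step_lim : is_lim_seq step (Finite 0).
Proof.
apply (is_lim_seq_incr_1 (fun n => / INR n) (Finite 0)).
apply (is_lim_seq_inv INR p_infty); [apply is_lim_seq_INR|discriminate].
Qed.

Definition sdiff (n : nat) (g : R -> C) (x : R) : C :=
  (RtoC (/ step n ^ 2) * (g (x + step n)%R + g (x + - step n)%R)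
   + RtoC (- 2 / step n ^ 2) * g x)%C.

Lemma cs_sdiff M g n : cs M g -> cs (M + 1) (sdiff n g).
Proof.
intros Hg; unfold sdiff.
apply (cs_lin (M + 1) _ _ (fun x => (g (x + step n)%R + g (x + - step n)%R)%C) g).
- destruct (cs_shift_1 M g _ (step_abs n) Hg) as [c1 z1].
  destruct (cs_shift_1 M g _ (step_abs_opp n) Hg) as [c2 z2].
  split.
  + intros x; apply continuous_Cplus; auto.
  + intros x Hx; rewrite z1, z2 by exact Hx; ring.
- apply cs_mono with M; [lra|exact Hg].
Qed.

Definition sdmult (n : nat) (t : R) : R := (2 * cos (t * step n) - 2) / step n ^ 2.

Lemma fourier_sdiff M g n t : cs M g ->
  fourier (sdiff n g) t = (RtoC (sdmult n t) * fourier g t)%C.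
Proof.
intros Hg; pose proof (step_pos n) as Hn.
pose proof (cs_shift_1 M g _ (step_abs n) Hg) as A1.
pose proof (cs_shift_1 M g _ (step_abs_opp n) Hg) as A2.
transitivity (fourier (fun x => RtoC (/ step n ^ 2)
   * (1 * g (x + step n)%R + 1 * g (x + - step n)%R)
   + RtoC (- 2 / step n ^ 2) * g x)%C t).
{ apply fourier_ext; intros s; unfold sdiff; ring. }
rewrite (fourier_lin_cs _ _ _ _ (M + 1)).
- rewrite (fourier_lin_cs _ _ _ _ (M + 1)) by assumption.
  rewrite !(fourier_shift M) by exact Hg.
  replace (t * - step n) with (- (t * step n)) by ring.
  replace (RtoC (sdmult n t))
    with (RtoC (/ step n ^ 2) * RtoC (2 * cos (t * step n)) + RtoC (- 2 / step n ^ 2))%C.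
  + rewrite two_cos; ring.
  + rewrite <- RtoC_mult, <- RtoC_plus; f_equal; unfold sdmult; field; lra.
- apply cs_lin; assumption.
- apply cs_mono with M; [lra|exact Hg].
Qed.

Lemma sdmult_approx n t : Rabs (sdmult n t + t ^ 2) <= t ^ 4 * step n ^ 2.
Proof.
pose proof (step_pos n) as Hn.
assert (Hp : 0 < step n ^ 2) by (apply pow_lt, Hn).
replace (sdmult n t + t ^ 2)
  with ((2 * cos (t * step n) - 2 + (t * step n) ^ 2) * / step n ^ 2)
  by (unfold sdmult; field; lra).
rewrite Rabs_mult, (Rabs_right (/ _)) by (left; apply Rinv_0_lt_compat, Hp).
apply Rle_trans with ((t * step n) ^ 4 / 4 * / step n ^ 2).
- apply Rmult_le_compat_r; [left; apply Rinv_0_lt_compat, Hp|apply second_diff_cos].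
- replace ((t * step n) ^ 4 / 4 * / step n ^ 2) with (t ^ 4 * step n ^ 2 / 4)
    by (field; lra).
  assert (0 <= t ^ 4 * step n ^ 2); [|lra].
  apply Rmult_le_pos; [|lra].
  replace (t ^ 4) with ((t ^ 2) ^ 2) by ring; apply pow2_ge_0.
Qed.

(** * The bilinear pairing of functions *)

(** No conjugation: this is the pairing by which [represents] identifies a function with a
    functional. *)
Definition pair (g h : R -> C) : C := Cint (fun s => g s * h s)%C.

Lemma pair_comm g h : pair g h = pair h g.
Proof.
unfold pair; f_equal; apply functional_extensionality; intros; apply Cmult_comm.
Qed.

Lemma pair_lin_l M a b f g h : cs M f -> cs M g -> cs M h ->
  pair (fun s => a * f s + b * g s)%C h = (a * pair f h + b * pair g h)%C.
Proof.
intros [cf zf] [cg zg] [ch zh]; unfold pair.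
replace (fun s => ((a * f s + b * g s) * h s)%C)
  with (fun s => (a * (f s * h s) + b * (g s * h s))%C)
  by (apply functional_extensionality; intros; ring).
apply (Cint_lin _ _ _ _ M).
- intros x; apply continuous_Cmult; auto.
- intros x; apply continuous_Cmult; auto.
- intros x Hx; rewrite zf by exact Hx; ring.
- intros x Hx; rewrite zg by exact Hx; ring.
Qed.

Lemma pair_lin_r M a b f g h : cs M f -> cs M g -> cs M h ->
  pair h (fun s => a * f s + b * g s)%C = (a * pair h f + b * pair h g)%C.
Proof.
intros; rewrite pair_comm, (pair_lin_l M), !(pair_comm h) by assumption; reflexivity.
Qed.

Lemma pair_ext_l f g h : (forall x, f x = g x) -> pair f h = pair g h.
Proof. intros H; f_equal; apply functional_extensionality, H. Qed.

Lemma pair_shift M g h a : cs M g -> cs M h ->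
  pair (fun s => g (s + a)) h = pair g (fun s => h (s + - a)).
Proof.
intros Hg [ch zh]; unfold pair.
rewrite <- (Cint_shift M (fun s => g s * h (s + - a)%R)%C a).
- f_equal; apply functional_extensionality; intros s; do 2 f_equal; ring.
- apply (cs_mult M (fun s => h (s + - a))); [|exact Hg].
  apply (cs_shift M); split; assumption.
Qed.

Lemma pair_unif M g h (u : nat -> R -> C) e : 0 <= M -> cs M h ->
  is_lim_seq e (Finite 0) -> (forall n, cs M (u n)) ->
  (forall x n, Cmod (g x - u n x)%C <= e n) ->
  exists K, forall n, Cmod (pair g h - pair (u n) h)%C <= K * e n.
Proof.
intros HM Hh He Hu H; destruct (cs_bounded M h Hh) as [B [HB0 HB]].
pose proof (cs_unif M g u e He Hu H) as Hg.
exists (2 * M * B); intros n.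
rewrite Cminus_lin, <- (pair_lin_l M) by auto.
replace (2 * M * B * e n) with (2 * M * (e n * B)) by ring.
apply Cint_bound; [exact HM| |].
- apply (cs_mult M h); [apply Hh|apply cs_lin; auto].
- intros x; rewrite Cmod_mult; apply Rmult_le_compat; try apply Cmod_ge_0; [|apply HB].
  rewrite <- Cminus_lin; apply H.
Qed.

(** Translations by h and - h are adjoint to each other, and the difference is symmetric in the
    two. *)
Lemma pair_sdiff M g h n : cs M g -> cs M h -> pair (sdiff n g) h = pair g (sdiff n h).
Proof.
intros Hg Hh; pose proof (step_pos n) as Hn.
assert (A0 : forall f, cs M f -> cs (M + 1) f).
{ intros f; apply cs_mono; lra. }
assert (E : forall f s, sdiff n f s = (RtoC (/ step n ^ 2)
   * (1 * f (s + step n)%R + 1 * f (s + - step n)%R)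
   + RtoC (- 2 / step n ^ 2) * f s)%C) by (intros; unfold sdiff; ring).
rewrite (pair_ext_l _ _ h (E g)).
rewrite (pair_comm g (sdiff n h)), (pair_ext_l _ _ g (E h)).
pose proof (cs_shift_1 M g _ (step_abs n) Hg) as A1.
pose proof (cs_shift_1 M g _ (step_abs_opp n) Hg) as A2.
pose proof (cs_shift_1 M h _ (step_abs n) Hh) as A3.
pose proof (cs_shift_1 M h _ (step_abs_opp n) Hh) as A4.
pose proof (A0 g Hg) as A0g; pose proof (A0 h Hh) as A0h; clear A0 E.
rewrite (pair_lin_l (M + 1)), (pair_lin_l (M + 1))
  by (first [assumption|apply cs_lin; assumption]).
rewrite (pair_lin_l (M + 1)), (pair_lin_l (M + 1))
  by (first [assumption|apply cs_lin; assumption]).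
rewrite !(pair_shift M g h) by assumption.
rewrite !(pair_shift M h g) by assumption.
rewrite Ropp_involutive.
rewrite (pair_comm h g), (pair_comm h (fun s => g (s + step n))),
  (pair_comm h (fun s => g (s + - step n))).
rewrite !(pair_shift M g h), Ropp_involutive by assumption; ring.
Qed.

(** * Rapidly decreasing Fourier transforms *)

(** Abstracts w = |rho|^2 on the real axis. The polynomial lower bound comes from a single factor of
    the product and turns decay against w into decay against powers of 1 + t^2. *)
Definition weight (w : R -> R) : Prop :=
  (forall t, 1 <= w t) /\ exists K, 0 < K /\ forall t, 1 + t ^ 2 <= K * w t.

(** Membership in D_rho in terms of the weight w = |rho|^2; [in_D_rap] proves the equivalence. *)
Definition rap (w : R -> R) (g : R -> C) : Prop :=
  (exists M, cs M g) /\
  forall n, exists B, forall t, Cmod (fourier g t) * w t ^ n <= B.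

Lemma rap_lin w a b f g : weight w -> rap w f -> rap w g ->
  rap w (fun s => a * f s + b * g s)%C.
Proof.
intros [Hw _] [[M Hf] Bf] [[N Hg] Bg].
apply (cs_mono _ (Rmax M N)) in Hf; [|apply Rmax_l].
apply (cs_mono _ (Rmax M N)) in Hg; [|apply Rmax_r].
split; [exists (Rmax M N); apply cs_lin; assumption|].
intros n; destruct (Bf n) as [B1 H1], (Bg n) as [B2 H2].
exists (Cmod a * B1 + Cmod b * B2); intros t.
rewrite (fourier_lin_cs _ _ _ _ (Rmax M N)) by assumption.
apply Rle_trans with ((Cmod a * Cmod (fourier f t) + Cmod b * Cmod (fourier g t)) * w t ^ n).
- apply Rmult_le_compat_r; [apply pow_le; generalize (Hw t); lra|].
  rewrite <- !Cmod_mult; apply Cmod_triangle.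
- rewrite Rmult_plus_distr_r, !Rmult_assoc.
  apply Rplus_le_compat; apply Rmult_le_compat_l; auto using Cmod_ge_0.
Qed.

Lemma rap_inj w f g : rap w f -> rap w g ->
  (forall t, fourier f t = fourier g t) -> forall x, f x = g x.
Proof.
intros [[M Hf] _] [[N Hg] _].
apply (cs_mono _ (Rmax M N)) in Hf; [|apply Rmax_l].
apply (cs_mono _ (Rmax M N)) in Hg; [|apply Rmax_r].
apply (fourier_inj (Rmax M N)); assumption.
Qed.

Lemma rap_multiplier w k K (m : R -> C) M f g : weight w -> rap w f -> cs M g ->
  (forall t, fourier g t = (m t * fourier f t)%C) ->
  (forall t, Cmod (m t) <= K * w t ^ k) -> rap w g.
Proof.
intros [Hw _] [_ Bf] Hg E Hm; split; [exists M; exact Hg|].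
intros n; destruct (Bf (k + n)%nat) as [B HB]; exists (K * B); intros t.
assert (HK : 0 <= K).
{ assert (0 < w t ^ k) by (apply pow_lt; generalize (Hw t); lra).
  apply Rmult_le_reg_r with (w t ^ k); [assumption|].
  generalize (Cmod_ge_0 (m t)), (Hm t); lra. }
rewrite E, Cmod_mult.
apply Rle_trans with (K * w t ^ k * Cmod (fourier f t) * w t ^ n).
- apply Rmult_le_compat_r; [apply pow_le; generalize (Hw t); lra|].
  apply Rmult_le_compat_r; [apply Cmod_ge_0|apply Hm].
- replace (K * w t ^ k * Cmod (fourier f t) * w t ^ n)
    with (K * (Cmod (fourier f t) * w t ^ (k + n))) by (rewrite pow_add; ring).
  apply Rmult_le_compat_l; [exact HK|apply HB].
Qed.

Lemma rap_decay w g k : weight w -> rap w g ->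
  exists B, 0 <= B /\ forall t, (1 + t ^ 2) ^ k * Cmod (fourier g t) <= B.
Proof.
intros [Hw [K [HK0 HK]]] [_ Bg]; destruct (Bg k) as [B HB].
exists (K ^ k * B); split.
- apply Rmult_le_pos; [apply pow_le; lra|].
  eapply Rle_trans; [|apply (HB 0)]; apply Rmult_le_pos; [apply Cmod_ge_0|].
  apply pow_le; generalize (Hw 0); lra.
- intros t; apply Rle_trans with ((K * w t) ^ k * Cmod (fourier g t)).
  + apply Rmult_le_compat_r; [apply Cmod_ge_0|].
    apply pow_incr; split; [generalize (pow2_ge_0 t); lra|apply HK].
  + rewrite Rpow_mult_distr, Rmult_assoc; apply Rmult_le_compat_l; [apply pow_le; lra|].
    rewrite Rmult_comm; apply HB.
Qed.

Lemma lim_0_ge_N (a : R) (e : nat -> R) N :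
  is_lim_seq e (Finite 0) -> (forall n, (N <= n)%nat -> a <= e n) -> a <= 0.
Proof.
intros He H.
apply (le_of_lim_0 a (fun n => e (n + N)%nat)).
- apply is_lim_seq_incr_n, He.
- intros n; apply H; lia.
Qed.

(** The uniform approximation by [sdiff n g] is part of the conclusion because [pair_second] passes
    to the limit in it. *)
Lemma second_derivative w g M : weight w -> rap w g -> cs M g ->
  exists g2 e, rap w g2 /\ cs M g2 /\
    (forall t, fourier g2 t = (RtoC (- t ^ 2) * fourier g t)%C) /\
    included (supp g2) (supp g) /\
    is_lim_seq e (Finite 0) /\
    forall x n, Cmod (g2 x - sdiff n g x)%C <= e n.
Proof.
intros Hw Rg Hg.
(* Power 3: one factor 1 + t^2 is consumed by [fourier_sup], two absorb the t^4 of
   [sdmult_approx]. *)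
destruct (rap_decay w g 3 Hw Rg) as [B [HB0 HB]].
destruct (fourier_sup (M + 1)) as [K [HK0 HK]].
set (e := fun n => (K * (2 * B)) * step n).
assert (He : is_lim_seq e (Finite 0)) by (apply lim_0_scal, step_lim).
assert (Hsd : forall n t, (1 + t ^ 2) * (Rabs (sdmult n t + t ^ 2) * Cmod (fourier g t))
  <= B * step n).
{ intros n t; pose proof (step_pos n); pose proof (step_le1 n).
  pose proof (pow2_ge_0 t) as Ht.
  apply Rle_trans with ((1 + t ^ 2) ^ 3 * Cmod (fourier g t) * step n).
  - replace ((1 + t ^ 2) * (Rabs (sdmult n t + t ^ 2) * Cmod (fourier g t)))
      with ((1 + t ^ 2) * Rabs (sdmult n t + t ^ 2) * Cmod (fourier g t)) by ring.
    replace ((1 + t ^ 2) ^ 3 * Cmod (fourier g t) * step n)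
      with ((1 + t ^ 2) * ((1 + t ^ 2) ^ 2 * step n) * Cmod (fourier g t)) by ring.
    apply Rmult_le_compat_r; [apply Cmod_ge_0|].
    apply Rmult_le_compat_l; [lra|].
    eapply Rle_trans; [apply sdmult_approx|].
    assert (0 <= step n ^ 2 <= step n) by nra.
    apply Rmult_le_compat; [|lra| |lra].
    + replace (t ^ 4) with ((t ^ 2) ^ 2) by ring; apply pow2_ge_0.
    + replace (t ^ 4) with ((t ^ 2) ^ 2) by ring; apply pow_incr; lra.
  - apply Rmult_le_compat_r; [lra|apply HB]. }
destruct (unif_limit R (fun n x => sdiff n g x) e He) as [g2 H2].
{ intros n m x Hnm.
  unfold e; rewrite Rmult_assoc.
  apply (HK (fun x => sdiff m g x - sdiff n g x)%C).
  - apply cs_minus; apply cs_sdiff, Hg.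
  - intros t; rewrite (fourier_minus (M + 1)) by apply cs_sdiff, Hg.
    rewrite !(fourier_sdiff M) by exact Hg.
    replace (RtoC (sdmult m t) * fourier g t - RtoC (sdmult n t) * fourier g t)%C
      with (RtoC ((sdmult m t + t ^ 2) - (sdmult n t + t ^ 2)) * fourier g t)%C
      by (apply injective_projections; simpl; ring).
    rewrite Cmod_mult, Cmod_R.
    apply Rle_trans with ((1 + t ^ 2) * (Rabs (sdmult m t + t ^ 2) * Cmod (fourier g t))
      + (1 + t ^ 2) * (Rabs (sdmult n t + t ^ 2) * Cmod (fourier g t))).
    + rewrite <- Rmult_plus_distr_l, <- Rmult_plus_distr_r.
      apply Rmult_le_compat_l; [generalize (pow2_ge_0 t); lra|].
      apply Rmult_le_compat_r; [apply Cmod_ge_0|].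
      unfold Rminus; eapply Rle_trans; [apply Rabs_triang|rewrite Rabs_Ropp; lra].
    + generalize (Hsd m t), (Hsd n t); intros.
      assert (B * step m <= B * step n)
        by (apply Rmult_le_compat_l; [exact HB0|apply step_le, Hnm]).
      lra. }
(* The differences live in [- M - 1, M + 1] only; the radius M is recovered from the inclusion of
   supports, which holds because near a point off [supp g] all three values in a difference vanish
   once the step is small. *)
assert (C2 : cs (M + 1) g2).
{ apply (cs_unif (M + 1) g2 (fun n => sdiff n g) e He); [|exact H2].
  intros n; apply cs_sdiff, Hg. }
assert (S2 : included (supp g2) (supp g)).
{ apply supp_incl; intros x Hx.
  destruct (supp_local g x Hx) as [d [Hd Hy]].
  destruct (lim_0_eps step d step_lim Hd) as [N HN].
  apply Cmod_eq_0, Rle_antisym; [|apply Cmod_ge_0].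
  apply (lim_0_ge_N _ e N He); intros n Hn.
  pose proof (H2 x n) as Q; unfold sdiff in Q.
  pose proof (step_pos n); specialize (HN n Hn).
  rewrite (Hy (x + step n)), (Hy (x + - step n)), (Hy x) in Q.
  - replace (g2 x - (RtoC (/ step n ^ 2) * (0 + 0) + RtoC (-2 / step n ^ 2) * 0))%C
      with (g2 x) in Q by ring; exact Q.
  - rewrite Rminus_diag, Rabs_R0; exact Hd.
  - replace (x + - step n - x) with (- step n) by ring.
    rewrite Rabs_Ropp, Rabs_right; lra.
  - replace (x + step n - x) with (step n) by ring; rewrite Rabs_right; lra. }
assert (C2' : cs M g2) by (apply (cs_of_supp M g); auto; apply C2).
assert (F2 : forall t, fourier g2 t = (RtoC (- t ^ 2) * fourier g t)%C).
{ intros t; apply (C_eq_of_lim _ _ (fun n => (Rmax (M + 1) 1 / PI) * e n + B * step n)).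
  - apply lim_0_plus; apply lim_0_scal; [exact He|apply step_lim].
  - intros n.
    eapply Rle_trans; [apply (Cmod_triang3 _ (fourier (sdiff n g) t))|].
    apply Rplus_le_compat.
    + apply (fourier_unif g2 (fun n => sdiff n g) (Rmax (M + 1) 1) e); auto.
      * generalize (Rmax_r (M + 1) 1); lra.
      * intros k; apply cs_pos, cs_sdiff, Hg.
    + rewrite (fourier_sdiff M) by exact Hg.
      replace (RtoC (sdmult n t) * fourier g t - RtoC (- t ^ 2) * fourier g t)%C
        with (RtoC (sdmult n t + t ^ 2) * fourier g t)%C
        by (apply injective_projections; simpl; ring).
      rewrite Cmod_mult, Cmod_R.
      eapply Rle_trans; [|apply (Hsd n t)].
      rewrite <- (Rmult_1_l (Rabs _ * _)) at 1.
      apply Rmult_le_compat_r; [|generalize (pow2_ge_0 t); lra].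
      apply Rmult_le_pos; [apply Rabs_pos|apply Cmod_ge_0]. }
exists g2, e; split; [|repeat split; auto; try apply C2'].
destruct Hw as [Hw1 [Kw [HKw0 HKw]]].
apply (rap_multiplier w 1 Kw (fun t => RtoC (- t ^ 2)) M g); auto.
- split; [exact Hw1|exists Kw; auto].
- intros t; rewrite Cmod_R, Rabs_Ropp, Rabs_right
    by (apply Rle_ge, pow2_ge_0).
  rewrite pow_1; generalize (HKw t); lra.
Qed.

Lemma common_cs (f g : R -> C) : (exists M, cs M f) -> (exists M, cs M g) ->
  exists M, 0 <= M /\ cs M f /\ cs M g.
Proof.
intros [M Hf] [N Hg]; exists (Rmax (Rmax M 1) N); split; [|split].
- generalize (Rmax_l (Rmax M 1) N), (Rmax_r M 1); lra.
- apply (cs_mono (Rmax M 1)); [apply Rmax_l|apply cs_pos, Hf].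
- apply (cs_mono N); [apply Rmax_r|exact Hg].
Qed.

(** Two integrations by parts, as the limit of the discrete symmetry [pair_sdiff]; [g2] and [h2] are
    identified with the limits by injectivity of the transform. *)
Lemma pair_second w g h g2 h2 : weight w -> rap w g -> rap w h -> rap w g2 -> rap w h2 ->
  (forall t, fourier g2 t = (RtoC (- t ^ 2) * fourier g t)%C) ->
  (forall t, fourier h2 t = (RtoC (- t ^ 2) * fourier h t)%C) ->
  pair g2 h = pair g h2.
Proof.
intros Hw Rg Rh Rg2 Rh2 Fg Fh.
destruct (common_cs g h (proj1 Rg) (proj1 Rh)) as [M [HM [Hg Hh]]].
destruct (second_derivative w g M Hw Rg Hg) as [g3 [e [Rg3 [Cg3 [Fg3 [_ [He Ag]]]]]]].
destruct (second_derivative w h M Hw Rh Hh) as [h3 [d [Rh3 [Ch3 [Fh3 [_ [Hd Ah]]]]]]].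
assert (Eg : forall x, g2 x = g3 x).
{ apply (rap_inj w); auto; intros t; rewrite Fg, Fg3; reflexivity. }
assert (Eh : forall x, h2 x = h3 x).
{ apply (rap_inj w); auto; intros t; rewrite Fh, Fh3; reflexivity. }
rewrite (pair_ext_l _ _ h Eg), (pair_comm g h2), (pair_ext_l _ _ g Eh).
assert (S : forall f, cs M f -> cs (M + 1) f) by (intros f; apply cs_mono; lra).
destruct (pair_unif (M + 1) g3 h (fun n => sdiff n g) e) as [K1 H1]; auto;
  [lra|intros n; apply cs_sdiff, Hg|].
destruct (pair_unif (M + 1) h3 g (fun n => sdiff n h) d) as [K2 H2]; auto;
  [lra|intros n; apply cs_sdiff, Hh|].
apply (C_eq_of_lim _ _ (fun n => K1 * e n + K2 * d n)).
- apply lim_0_plus; apply lim_0_scal; assumption.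
- intros n; eapply Rle_trans; [apply (Cmod_triang3 _ (pair (sdiff n g) h))|].
  apply Rplus_le_compat; [apply H1|].
  rewrite (pair_sdiff M) by assumption.
  rewrite Cmod_minus_sym, (pair_comm g); apply H2.
Qed.

(** * The operator with symbol [prod (1 + c_j z^2)] *)

Section Operator.

Variables (w : R -> R) (c : nat -> R) (F : C -> C) (Kc : R).
Hypothesis Hw : weight w.
Hypothesis Hc : summable c.
Hypothesis Hwc : forall t, W c (t ^ 2) <= Kc * w t.
Hypothesis HF : forall z, exists e, is_lim_seq e (Finite 0) /\
  forall n, Cmod (F z - pz c n z)%C <= e n.

Definition mlt (n : nat) (t : R) : C := pz c n (Ci * RtoC t)%C.

Lemma mlt_S n t : mlt (S n) t = (mlt n t + RtoC (c n) * (RtoC (- t ^ 2) * mlt n t))%C.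
Proof.
unfold mlt, pz; simpl Cprod; set (p := Cprod _ n).
replace ((Ci * RtoC t) * (Ci * RtoC t))%C with (RtoC (- t ^ 2))
  by (apply injective_projections; simpl; ring).
ring.
Qed.

Lemma Cmod_Ci_mult t : Cmod (Ci * RtoC t)%C ^ 2 = t ^ 2.
Proof.
rewrite Cmod_mult, Cmod_R.
replace (Cmod Ci) with 1; [rewrite Rmult_1_l; apply pow2_abs|].
unfold Cmod, Ci; simpl; rewrite <- sqrt_1 at 1; f_equal; ring.
Qed.

Lemma mlt_le n t : Cmod (mlt n t) <= Kc * w t.
Proof.
eapply Rle_trans; [apply pz_le, Hc|].
rewrite Cmod_Ci_mult; eapply Rle_trans; [|apply Hwc].
apply PW_le_W; [exact Hc|apply pow2_ge_0].
Qed.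

Lemma symbol_le t : Cmod (F (Ci * RtoC t)%C) <= Kc * w t.
Proof.
destruct (HF (Ci * RtoC t)%C) as [e [He H]].
apply Rminus_le, (le_of_lim_0 _ e He); intros n.
generalize (Cmod_le_sub (F (Ci * RtoC t)%C) (mlt n t)), (H n), (mlt_le n t).
unfold mlt; lra.
Qed.

(** Each factor 1 + c_j D^2 preserves supports, so the radius M does not depend on n; [fourier_sup]
    then applies with one constant to all increments. *)
Lemma partial_op M n : forall g, rap w g -> cs M g -> exists G, rap w G /\ cs M G /\
  (forall t, fourier G t = (mlt n t * fourier g t)%C) /\ included (supp G) (supp g).
Proof.
induction n as [|n IH]; intros g Rg Hg.
- exists g; split; [exact Rg|split; [exact Hg|split; [|intros x Hx; exact Hx]]].
  intros t; unfold mlt, pz; simpl; ring.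
- destruct (IH g Rg Hg) as [G [RG [CG [FG SG]]]].
  destruct (second_derivative w G M Hw RG CG) as [G2 [_ [RG2 [CG2 [FG2 [SG2 _]]]]]].
  exists (fun s => 1 * G s + RtoC (c n) * G2 s)%C.
  split; [apply rap_lin; assumption|].
  split; [apply cs_lin; assumption|split].
  + intros t; rewrite (fourier_lin_cs _ _ _ _ M), FG2, FG, mlt_S by assumption; ring.
  + apply supp_incl; intros x Hx.
    rewrite (supp_out_of G), (supp_out_of G2); [ring| |].
    * intros H; apply Hx, SG, SG2, H.
    * intros H; apply Hx, SG, H.
Qed.

Lemma op_approx g M : rap w g -> cs M g -> exists G u e, rap w G /\ cs M G /\
  (forall t, fourier G t = (F (Ci * RtoC t) * fourier g t)%C) /\
  included (supp G) (supp g) /\ is_lim_seq e (Finite 0) /\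
  (forall n, rap w (u n) /\ cs M (u n) /\
     forall t, fourier (u n) t = (mlt n t * fourier g t)%C) /\
  forall x n, Cmod (G x - u n x)%C <= e n.
Proof.
intros Rg Hg.
destruct (functional_choice _ (fun n => partial_op M n g Rg Hg)) as [u Hu].
assert (HB : exists B, 0 <= B /\ forall n t,
  (1 + t ^ 2) * (t ^ 2 * (Cmod (mlt n t) * Cmod (fourier g t))) <= B).
{ destruct Hw as [Hw1 [Kw [HKw0 HKw]]], Rg as [_ Bg].
  (* Power 3 of the weight: one each for 1 + t^2, for t^2 and for the multiplier [mlt n t]. *)
  destruct (Bg 3%nat) as [B HB].
  assert (HKc : 0 <= Kc).
  { generalize (W_ge1 c (0 ^ 2) Hc (pow2_ge_0 0)), (Hwc 0), (Hw1 0); nra. }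
  exists (Kw ^ 2 * Kc * B); split.
  - repeat apply Rmult_le_pos; try lra.
    eapply Rle_trans; [|apply (HB 0)]; apply Rmult_le_pos; [apply Cmod_ge_0|].
    apply pow_le; generalize (Hw1 0); lra.
  - intros n t; generalize (pow2_ge_0 t), (HKw t), (Hw1 t); intros.
    apply Rle_trans with (Kw * w t * (Kw * w t * (Kc * w t * Cmod (fourier g t)))).
    + assert (0 <= Cmod (mlt n t) * Cmod (fourier g t))
        by (apply Rmult_le_pos; apply Cmod_ge_0).
      apply Rmult_le_compat; [lra| |lra|]; [apply Rmult_le_pos; lra|].
      apply Rmult_le_compat; [lra|lra|lra|].
      apply Rmult_le_compat_r; [apply Cmod_ge_0|apply mlt_le].
    + replace (Kw * w t * (Kw * w t * (Kc * w t * Cmod (fourier g t))))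
        with (Kw ^ 2 * Kc * (Cmod (fourier g t) * w t ^ 3)) by ring.
      apply Rmult_le_compat_l; [|apply HB].
      apply Rmult_le_pos; [apply pow2_ge_0|exact HKc]. }
destruct HB as [B [HB0 HB]].
destruct (fourier_sup M) as [K [HK0 HK]].
assert (Hb : summable (fun j => (K * B) * c j))
  by (apply summable_scal; [apply Rmult_le_pos; lra|exact Hc]).
destruct (unif_limit_telescope R u _ Hb) as [G [e [He HG]]].
{ intros n x.
  destruct (Hu n) as [_ [Cn [Fn _]]], (Hu (S n)) as [_ [Cn' [Fn' _]]].
  rewrite Rmult_assoc.
  apply (HK (fun x => u (S n) x - u n x)%C).
  - apply cs_minus; assumption.
  - intros t; rewrite (fourier_minus M), Fn, Fn', mlt_S by assumption.
    replace ((mlt n t + RtoC (c n) * (RtoC (- t ^ 2) * mlt n t)) * fourier g t -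
      mlt n t * fourier g t)%C
      with (RtoC (c n) * (RtoC (- t ^ 2) * (mlt n t * fourier g t)))%C by ring.
    pose proof (proj1 Hc n) as Hn.
    rewrite !Cmod_mult, !Cmod_R, Rabs_Ropp, !Rabs_right
      by (try apply Rle_ge, pow2_ge_0; lra).
    generalize (HB n t); intros Q.
    replace ((1 + t ^ 2) * (c n * (t ^ 2 * (Cmod (mlt n t) * Cmod (fourier g t)))))
      with ((1 + t ^ 2) * (t ^ 2 * (Cmod (mlt n t) * Cmod (fourier g t))) * c n) by ring.
    apply Rmult_le_compat_r; assumption. }
assert (CG : cs M G) by (apply (cs_unif M G u e); auto; intros n; apply Hu).
assert (FG : forall t, fourier G t = (F (Ci * RtoC t) * fourier g t)%C).
{ intros t; destruct (HF (Ci * RtoC t)%C) as [d [Hd H]].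
  apply (C_eq_of_lim _ _ (fun n => Rmax M 1 / PI * e n + Cmod (fourier g t) * d n)).
  - apply lim_0_plus; apply lim_0_scal; assumption.
  - intros n; eapply Rle_trans; [apply (Cmod_triang3 _ (fourier (u n) t))|].
    apply Rplus_le_compat.
    + apply (fourier_unif G u (Rmax M 1) e); auto.
      * generalize (Rmax_r M 1); lra.
      * intros k; apply cs_pos, Hu.
    + destruct (Hu n) as [_ [_ [Fn _]]]; rewrite Fn.
      replace (mlt n t * fourier g t - F (Ci * RtoC t) * fourier g t)%C
        with (fourier g t * (mlt n t - F (Ci * RtoC t)))%C by ring.
      rewrite Cmod_mult, Cmod_minus_sym.
      apply Rmult_le_compat_l; [apply Cmod_ge_0|apply H]. }
exists G, u, e; split; [|split; [exact CG|split; [exact FG|split; [|split; [exact He|split]]]]].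
- apply (rap_multiplier w 1 Kc (fun t => F (Ci * RtoC t)%C) M g); auto.
  intros t; rewrite pow_1; apply symbol_le.
- apply supp_incl; intros x Hx.
  apply (C_eq_of_lim _ _ e He); intros n.
  rewrite <- (supp_out_of (u n) x); [apply HG|].
  intros H; apply Hx; destruct (Hu n) as [_ [_ [_ Sn]]]; apply Sn, H.
- intros n; destruct (Hu n) as [A1 [A2 [A3 _]]]; auto.
- exact HG.
Qed.

(** The last factor 1 + c_n D^2 is moved onto h by [pair_second], and the induction hypothesis is
    applied with (1 + c_n D^2) h in place of h; hence the quantification over all four functions. *)
Lemma pair_partial n : forall g h G H, rap w g -> rap w h -> rap w G -> rap w H ->
  (forall t, fourier G t = (mlt n t * fourier g t)%C) ->
  (forall t, fourier H t = (mlt n t * fourier h t)%C) ->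
  pair G h = pair g H.
Proof.
induction n as [|n IH]; intros g h G H Rg Rh RG RH FG FH.
- assert (EG : forall x, G x = g x).
  { apply (rap_inj w); auto; intros t; rewrite FG; unfold mlt, pz; simpl; ring. }
  assert (EH : forall x, H x = h x).
  { apply (rap_inj w); auto; intros t; rewrite FH; unfold mlt, pz; simpl; ring. }
  rewrite (pair_ext_l _ _ h EG), (pair_comm g H), (pair_ext_l _ _ g EH), pair_comm.
  reflexivity.
- destruct (common_cs g h (proj1 Rg) (proj1 Rh)) as [M [HM [Cg Ch]]].
  destruct (partial_op M n g Rg Cg) as [gn [Rgn [Cgn [Fgn _]]]].
  destruct (second_derivative w gn M Hw Rgn Cgn) as [gn2 [_ [Rgn2 [Cgn2 [Fgn2 _]]]]].
  destruct (second_derivative w h M Hw Rh Ch) as [h2 [_ [Rh2 [Ch2 [Fh2 _]]]]].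
  assert (EG : forall x, G x = (1 * gn x + RtoC (c n) * gn2 x)%C).
  { apply (rap_inj w); [exact RG|apply rap_lin; assumption|].
    intros t; rewrite FG, (fourier_lin_cs _ _ _ _ M), Fgn2, Fgn, mlt_S by assumption.
    ring. }
  rewrite (pair_ext_l _ _ h EG), (pair_lin_l M) by assumption.
  rewrite (pair_second w gn h gn2 h2) by assumption.
  rewrite <- (pair_lin_r M) by assumption.
  refine (IH g _ gn H Rg (rap_lin w _ _ _ _ Hw Rh Rh2) Rgn RH Fgn _).
  intros t; rewrite FH, (fourier_lin_cs _ _ _ _ M), Fh2, mlt_S by assumption; ring.
Qed.

Lemma pair_op g h G H : rap w g -> rap w h -> rap w G -> rap w H ->
  (forall t, fourier G t = (F (Ci * RtoC t) * fourier g t)%C) ->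
  (forall t, fourier H t = (F (Ci * RtoC t) * fourier h t)%C) ->
  pair G h = pair g H.
Proof.
intros Rg Rh RG RH FG FH.
destruct (common_cs g h (proj1 Rg) (proj1 Rh)) as [M [HM [Cg Ch]]].
destruct (op_approx g M Rg Cg) as [G' [u [e [RG' [_ [FG' [_ [He [Hu HG]]]]]]]]].
destruct (op_approx h M Rh Ch) as [H' [v [d [RH' [_ [FH' [_ [Hd [Hv HH]]]]]]]]].
assert (EG : forall x, G x = G' x).
{ apply (rap_inj w); auto; intros t; rewrite FG, FG'; reflexivity. }
assert (EH : forall x, H x = H' x).
{ apply (rap_inj w); auto; intros t; rewrite FH, FH'; reflexivity. }
rewrite (pair_ext_l _ _ h EG), (pair_comm g H), (pair_ext_l _ _ g EH).
destruct (pair_unif M G' h u e) as [K1 H1]; auto; [intros n; apply Hu|].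
destruct (pair_unif M H' g v d) as [K2 H2]; auto; [intros n; apply Hv|].
apply (C_eq_of_lim _ _ (fun n => K1 * e n + K2 * d n)).
- apply lim_0_plus; apply lim_0_scal; assumption.
- intros n; eapply Rle_trans; [apply (Cmod_triang3 _ (pair (u n) h))|].
  apply Rplus_le_compat; [apply H1|].
  destruct (Hu n) as [Ru [_ Fu]], (Hv n) as [Rv [_ Fv]].
  rewrite (pair_partial n g h (u n) (v n) Rg Rh Ru Rv Fu Fv).
  rewrite Cmod_minus_sym, (pair_comm g); apply H2.
Qed.

End Operator.

(** * The strong dual *)

Lemma Cmod_Cpow (z : C) n : Cmod (z ^ n)%C = Cmod z ^ n.
Proof.
induction n as [|n IH]; simpl; [apply Cmod_1|rewrite Cmod_mult, IH; reflexivity].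
Qed.

Lemma Cminus_0_r (z : C) : (z - RtoC 0)%C = z.
Proof. ring. Qed.

Lemma summable_series u : (forall j, 0 <= u j) -> ex_series u -> summable u.
Proof.
intros Hu [l Hl]; apply summable_bound with l; [exact Hu|].
assert (E : forall n, sum_n u n = Rsum u (S n)).
{ induction n as [|n IH]; [rewrite sum_O; simpl; ring|].
  rewrite sum_Sn, IH; reflexivity. }
intros n; destruct n as [|n].
- eapply Rle_trans; [apply (Rsum_mono u 0 1 Hu); lia|].
  rewrite <- E; apply (is_lim_seq_incr_compare (sum_n u) l Hl).
  intros k; rewrite !E; apply Rsum_mono; auto.
- rewrite <- E; apply (is_lim_seq_incr_compare (sum_n u) l Hl).
  intros k; rewrite !E; apply Rsum_mono; auto.
Qed.

(** For real t, |1 + i t u_j|^2 = 1 + u_j^2 t^2 with u_j = 1 / t_j, so the complex product is traded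
    for a real one. An infinite t_j gives u_j = 0, and 0 < u_0 records that the first one is
    finite. *)
Lemma in_Omega_W omega : in_Omega omega -> exists u : nat -> R,
  summable u /\ 0 < u O /\
  forall t : R, Cmod (omega (RtoC t)) ^ 2 = W (fun j => u j ^ 2) (t ^ 2).
Proof.
intros [t [H0 [H1 [Hincr [Hs Hlim]]]]].
set (u := fun j => real (Rbar_inv (t j))).
assert (Hpos : forall j, Rbar_lt (Finite 0) (t j)).
{ induction j as [|j IH]; [exact H0|].
  eapply Rbar_lt_le_trans; [exact IH|apply Hincr]. }
assert (Hu : forall j, 0 <= u j).
{ intros j; unfold u; specialize (Hpos j); destruct (t j) as [r| |]; simpl in *; try lra.
  left; apply Rinv_0_lt_compat, Hpos. }
assert (Hsu : summable u) by (apply summable_series; assumption).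
exists u; split; [exact Hsu|split].
- unfold u; destruct (t O) as [r| |]; simpl in *; try easy.
  apply Rinv_0_lt_compat, H0.
- intros x.
  assert (P : forall n, Cmod (Cprod (fun j => (1 + Ci * RtoC x * RtoC (u j))%C) n) ^ 2
    = PW (fun j => u j ^ 2) n (x ^ 2)).
  { induction n as [|n IH]; [unfold PW; simpl; rewrite Cmod_1; ring|].
    rewrite PW_S, <- IH; cbn [Cprod]; rewrite Cmod_mult, Rpow_mult_distr.
    f_equal.
    unfold Cmod; rewrite pow2_sqrt; [simpl; ring|].
    apply Rplus_le_le_0_compat; apply pow2_ge_0. }
  assert (L : is_lim_seq
    (fun n => Cmod (Cprod (fun j => (1 + Ci * RtoC x * RtoC (u j))%C) n))
    (Finite (Cmod (omega (RtoC x))))).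
  { apply is_lim_seq_spec; intros eps.
    assert (Q : locally (T := C_UniformSpace) (omega (RtoC x))
      (fun z => Cmod (z - omega (RtoC x))%C < eps)).
    { apply (locally_le_locally_norm (K := C_AbsRing) (V := C_NormedModule)).
      exists eps; intros w Hw; exact Hw. }
    destruct (Hlim (RtoC x) _ Q) as [N HN].
    exists N; intros n Hn.
    eapply Rle_lt_trans; [apply Cmod_lip|apply (HN n Hn)]. }
  assert (L2 : is_lim_seq (fun n => PW (fun j => u j ^ 2) n (x ^ 2))
    (Finite (Cmod (omega (RtoC x)) ^ 2))).
  { apply (is_lim_seq_ext
      (fun n => Cmod (Cprod (fun j => (1 + Ci * RtoC x * RtoC (u j))%C) n)
              * Cmod (Cprod (fun j => (1 + Ci * RtoC x * RtoC (u j))%C) n))).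
    - intros n; rewrite <- P; ring.
    - replace (Cmod (omega (RtoC x)) ^ 2)
        with (Cmod (omega (RtoC x)) * Cmod (omega (RtoC x))) by ring.
      apply is_lim_seq_mult'; exact L. }
  pose proof (W_lim _ _ (summable_sqr u Hsu) (pow2_ge_0 x)) as L3.
  apply is_lim_seq_unique in L2; apply is_lim_seq_unique in L3.
  rewrite L2 in L3; injection L3; auto.
Qed.

Lemma weight_W u : summable u -> 0 < u O ->
  weight (fun t => W (fun j => u j ^ 2) (t ^ 2)).
Proof.
intros Hu H0; pose proof (summable_sqr u Hu) as Hs.
split; [intros t; apply W_ge1; [exact Hs|apply pow2_ge_0]|].
assert (P : 0 < u O ^ 2) by (apply pow_lt, H0).
exists (1 + / u O ^ 2); split; [generalize (Rinv_0_lt_compat _ P); lra|].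
intros t; pose proof (pow2_ge_0 t).
pose proof (W_poly _ (t ^ 2) O Hs (pow2_ge_0 t)) as Q; cbv beta in Q.
pose proof (W_ge1 _ _ Hs (pow2_ge_0 t)) as Q1.
pose proof (Rinv_0_lt_compat _ P).
apply Rle_trans with (1 * W (fun j => u j ^ 2) (t ^ 2)
  + / u O ^ 2 * W (fun j => u j ^ 2) (t ^ 2)); [|right; ring].
apply Rplus_le_compat; [lra|].
apply Rle_trans with (/ u O ^ 2 * (u O ^ 2 * t ^ 2)).
- right; field; lra.
- apply Rmult_le_compat_l; lra.
Qed.

Lemma pnorm_intro omega n phi (b e : R) : b < e ->
  (forall t, Cmod (fourier phi t * omega (RtoC t) ^ n)%C <= b) ->
  Rbar_lt (pnorm omega n phi) (Finite e).
Proof.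
intros Hb H; apply Rbar_le_lt_trans with (Finite b); [|exact Hb].
apply (Lub_Rbar_correct (fun y => exists t : R,
    y = Cmod (fourier phi t * omega (RtoC t) ^ n)%C)).
intros y [t ->]; apply H.
Qed.

Lemma pnorm_elim omega n phi (e : R) : Rbar_lt (pnorm omega n phi) (Finite e) ->
  forall t, Cmod (fourier phi t * omega (RtoC t) ^ n)%C <= e.
Proof.
intros H t.
assert (Q : Rbar_le (Finite (Cmod (fourier phi t * omega (RtoC t) ^ n)%C)) (Finite e)).
{ apply Rbar_le_trans with (pnorm omega n phi); [|apply Rbar_lt_le, H].
  apply (proj1 (Lub_Rbar_correct (fun y => exists t : R,
    y = Cmod (fourier phi t * omega (RtoC t) ^ n)%C))).
  exists t; reflexivity. }
exact Q.
Qed.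

Lemma in_D_rap rho w phi : (forall t, w t = Cmod (rho (RtoC t)) ^ 2) ->
  (forall t, 1 <= w t) -> in_D rho phi <-> rap w phi.
Proof.
intros E Hw.
assert (H1 : forall t, 1 <= Cmod (rho (RtoC t))).
{ intros t; specialize (Hw t); rewrite E in Hw.
  generalize (Cmod_ge_0 (rho (RtoC t))); nra. }
rewrite in_D_iff; split.
- intros [Hc [[M HM] HB]]; split; [exists M; split; assumption|].
  (* [rap] includes the power 0 while [in_D] speaks of powers at least 1, hence [S n]; the 2 comes
     from w = |rho|^2. *)
  intros n; destruct (HB (2 * S n)%nat) as [B HB']; [lia|].
  exists B; intros t; eapply Rle_trans; [|apply (HB' t)].
  rewrite Cmod_mult, Cmod_Cpow, pow_mult, <- E.
  apply Rmult_le_compat_l; [apply Cmod_ge_0|].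
  apply Rle_pow; [apply Hw|lia].
- intros [[M [Hc HM]] HB]; split; [exact Hc|split; [exists M; exact HM|]].
  intros n _; destruct (HB n) as [B HB']; exists B; intros t.
  eapply Rle_trans; [|apply (HB' t)].
  rewrite Cmod_mult, Cmod_Cpow; apply Rmult_le_compat_l; [apply Cmod_ge_0|].
  apply pow_incr; rewrite E; split; [apply Cmod_ge_0|].
  specialize (H1 t); nra.
Qed.

Lemma D_nbhs0_mono omega (U V : Dspace omega -> Prop) :
  (forall x, U x -> V x) -> D_nbhs0 omega U -> D_nbhs0 omega V.
Proof. intros H [Z [Z1 [Z2 Z3]]]; exists Z; auto. Qed.

Section Dual.

Variables (rho : C -> C) (w : R -> R) (c : nat -> R) (F : C -> C) (Kc : R).
Hypothesis Hw : weight w.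
Hypothesis Hrho : forall t, w t = Cmod (rho (RtoC t)) ^ 2.
Hypothesis Hc : summable c.
Hypothesis Hwc : forall t, W c (t ^ 2) <= Kc * w t.
Hypothesis HF : forall z, exists e, is_lim_seq e (Finite 0) /\
  forall n, Cmod (F z - pz c n z)%C <= e n.

Lemma rap_D (phi : Dspace rho) : rap w phi.
Proof. apply (in_D_rap rho w); [exact Hrho|apply Hw|apply (proj2_sig phi)]. Qed.

Lemma D_inj (phi psi : Dspace rho) :
  (forall t, fourier phi t = fourier psi t) -> phi = psi.
Proof. intros H; apply D_ext, (rap_inj w); auto using rap_D. Qed.

Lemma D_common (phi psi : Dspace rho) : exists M, 0 <= M /\ cs M phi /\ cs M psi.
Proof. apply common_cs; apply rap_D. Qed.

Lemma fourier_D_plus (phi psi : Dspace rho) t :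
  fourier (plus phi psi : Dspace rho) t = (fourier phi t + fourier psi t)%C.
Proof.
destruct (D_common phi psi) as [M [_ [H1 H2]]].
transitivity (fourier (fun s => 1 * phi s + 1 * psi s)%C t).
- apply fourier_ext; intros s; change (phi s + psi s = 1 * phi s + 1 * psi s)%C; ring.
- rewrite (fourier_lin_cs _ _ _ _ M) by assumption; ring.
Qed.

Lemma fourier_D_scal a (phi : Dspace rho) t :
  fourier (scal (a : C_Ring) phi : Dspace rho) t = (a * fourier phi t)%C.
Proof.
destruct (D_common phi phi) as [M [_ [H1 H2]]].
transitivity (fourier (fun s => a * phi s + 0 * phi s)%C t).
- apply fourier_ext; intros s; change (a * phi s = a * phi s + 0 * phi s)%C; ring.
- rewrite (fourier_lin_cs _ _ _ _ M) by assumption; ring.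
Qed.

(** [T] is chosen pointwise from [op_approx]; since the transform of [T phi] is prescribed,
    injectivity yields linearity and commutation with translations. *)
Lemma operator_exists : exists T : Dspace rho -> Dspace rho,
  ultradiff_op rho T /\ constant_coeff rho T /\ forall phi : Dspace rho, fD F phi (T phi).
Proof.
assert (Q : forall phi : Dspace rho, exists psi : Dspace rho,
  fD F phi psi /\ included (supp psi) (supp phi)).
{ intros phi; destruct (rap_D phi) as [[M HM] _].
  destruct (op_approx w c F Kc Hw Hc Hwc HF phi M (rap_D phi) HM)
    as [G [u [e [RG [_ [FG [SG _]]]]]]].
  assert (DG : in_D rho G) by (apply (in_D_rap rho w); [exact Hrho|apply Hw|exact RG]).
  exists (exist _ G DG); split; [exact FG|exact SG]. }
apply functional_choice in Q; destruct Q as [T HT].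
assert (FT : forall phi : Dspace rho, fD F phi (T phi)) by (intros phi; apply HT).
exists T; split; [split; [split|]|split; [|exact FT]].
- intros x y; apply D_inj; intros t.
  rewrite FT, !fourier_D_plus, !FT; ring.
- intros a x; apply D_inj; intros t.
  rewrite FT, !fourier_D_scal, !FT; ring.
- intros phi; apply HT.
- intros a phi psi H s.
  destruct (rap_D (T phi)) as [[M HM] _], (rap_D phi) as [[N HN] _].
  destruct (rap_D (T psi)) as [[M' HM'] _].
  pose proof (cs_shift M _ (- a) HM) as S1.
  apply (cs_mono _ (Rmax (M + Rabs (- a)) M')) in S1; [|apply Rmax_l].
  apply (cs_mono _ (Rmax (M + Rabs (- a)) M')) in HM'; [|apply Rmax_r].
  apply (fourier_inj _ (T psi) (fun s => T phi (s + - a)) HM' S1).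
  intros t; rewrite FT, (fourier_shift M (T phi)), FT by exact HM.
  rewrite (fourier_ext psi (fun s => phi (s + - a)) t H).
  rewrite (fourier_shift N phi) by exact HN; ring.
Qed.

Lemma Cmod_rho_ge1 t : 1 <= Cmod (rho (RtoC t)).
Proof.
pose proof (proj1 Hw t) as H; rewrite Hrho in H.
generalize (Cmod_ge_0 (rho (RtoC t))); nra.
Qed.

Lemma Kc_ge0 : 0 <= Kc.
Proof.
generalize (W_ge1 c (0 ^ 2) Hc (pow2_ge_0 0)), (Hwc 0), (proj1 Hw 0); nra.
Qed.

Lemma operator_nbhs0 T U : ultradiff_op rho T -> (forall phi : Dspace rho, fD F phi (T phi)) ->
  D_nbhs0 rho U -> D_nbhs0 rho (fun phi => U (T phi)).
Proof.
intros [[Tp Ts] Tsupp] FT [V [V1 [V2 V3]]].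
exists (fun phi => V (T phi)); split; [|split].
- intros x y a b Hx Hy Hab; rewrite Tp, !Ts; apply V1; assumption.
- intros phi; apply V2.
- intros K HK; destruct (V3 K HK) as [n [eps H]].
  pose proof Kc_ge0 as HKc.
  (* The 2 leaves room for a strict inequality between suprema; [Kc + 1] excludes a zero
     denominator. *)
  assert (He : 0 < eps / (2 * (Kc + 1))).
  { apply Rdiv_lt_0_compat; [apply cond_pos|lra]. }
  (* |F(it)| <= Kc |rho(t)|^2, so the k-th norm of [T phi] is controlled by the norm of index k + 2
     of [phi]. *)
  exists (n + 2)%nat, (mkposreal _ He); intros phi [P1 [P2 P3]] Hp.
  simpl in Hp.
  apply H.
  + destruct (rap_D (T phi)) as [[M' [CT _]] _]; split; [exact CT|split].
    * intros x Hx; apply P2, Tsupp, Hx.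
    * destruct (proj2_sig (T phi)) as [K' [_ [_ [_ Q]]]]; exact Q.
  + intros k Hk.
    apply pnorm_intro with (Kc * (eps / (2 * (Kc + 1)))).
    * apply Rle_lt_trans with ((Kc + 1) * (eps / (2 * (Kc + 1)))).
      -- apply Rmult_le_compat_r; lra.
      -- replace ((Kc + 1) * (eps / (2 * (Kc + 1)))) with (eps / 2) by (field; lra).
         generalize (cond_pos eps); lra.
    * intros t; rewrite FT, !Cmod_mult.
      pose proof (pnorm_elim _ _ _ _ (Hp (k + 2)%nat ltac:(lia)) t) as B.
      rewrite Cmod_mult, Cmod_Cpow, pow_add, <- Hrho in B.
      apply Rle_trans with (Kc * (Cmod (fourier phi t) * (Cmod (rho (RtoC t)) ^ k * w t))).
      -- rewrite Cmod_Cpow.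
         replace (Kc * (Cmod (fourier phi t) * (Cmod (rho (RtoC t)) ^ k * w t)))
           with (Kc * w t * Cmod (fourier phi t) * Cmod (rho (RtoC t)) ^ k) by ring.
         apply Rmult_le_compat_r; [apply pow_le, Cmod_ge_0|].
         apply Rmult_le_compat_r; [apply Cmod_ge_0|].
         apply (symbol_le w c F Kc); assumption.
      -- apply Rmult_le_compat_l; [exact HKc|exact B].
Qed.

Section Transpose.

Variable T : Dspace rho -> Dspace rho.
Hypothesis HT : ultradiff_op rho T.
Hypothesis FT : forall phi : Dspace rho, fD F phi (T phi).

Lemma transpose_in_dual L : in_dual rho L -> in_dual rho (fun phi => L (T phi)).
Proof.
destruct HT as [[Tp Ts] _]; intros [[Lp Ls] Lc]; split; [split|].
- intros x y; rewrite Tp; apply Lp.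
- intros a x; rewrite Ts; apply Ls.
- intros phi P HP.
  pose proof (operator_nbhs0 T _ HT FT (Lc (T phi) P HP)) as H.
  apply (D_nbhs0_mono rho _ _) with (2 := H).
  intros chi; rewrite Tp; auto.
Qed.

(* The symbol is even, so the transpose of [f(D)] is [f(D)] itself. *)
Definition transpose (L : dual rho) : dual rho :=
  exist _ (fun phi => L (T phi)) (transpose_in_dual L (proj2_sig L)).

(** Strong continuity: the transposes of two functionals are close on [B] when the functionals are
    close on [T(B)], and [T] preserves boundedness. Agreement with f(D) on functions is the symmetry
    [pair_op]. *)
Lemma transpose_extension : dual_extension rho F transpose.
Proof.
destruct HT as [[Tp Ts] _].
split; [split|split].
- intros L M; apply dual_ext; reflexivity.
- intros a L; apply dual_ext; reflexivity.
- intros L U [B [eps [HB HU]]].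
  exists (fun psi => exists phi, B phi /\ psi = T phi), eps; split.
  + intros V HV; destruct (HB _ (operator_nbhs0 T V HT FT HV)) as [r Hr].
    exists r; intros a psi Ha [phi [Hphi ->]].
    rewrite <- Ts; apply Hr; assumption.
  + intros M HM; apply HU; intros phi Hphi.
    apply HM; exists phi; auto.
- intros phi psi L M Hfd HL HM; apply dual_ext; intros chi.
  change (L (T chi) = M chi); rewrite HL, HM.
  symmetry; apply (pair_op w c F Kc Hw Hc Hwc HF phi chi psi (T chi));
    try apply rap_D; [exact Hfd|apply FT].
Qed.

End Transpose.

(** The set of all chi with |chi(0)| < e is absolutely convex, and on each D_rho(K) the sup bound by
    the transform makes it a neighbourhood of 0. *)
Lemma delta_in_dual : in_dual rho (fun phi => phi 0).
Proof.
split; [split; reflexivity|].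
intros phi P [e He].
exists (fun chi : Dspace rho => Cmod (chi 0) < e); split; [|split].
- intros x0 y0 a b Hx Hy Hab.
  pose (x := x0 : Dspace rho); pose (y := y0 : Dspace rho).
  change (Cmod (x 0) < e) in Hx; change (Cmod (y 0) < e) in Hy.
  change (Cmod (a * x 0 + b * y 0)%C < e).
  eapply Rle_lt_trans; [apply Cmod_triangle|]; rewrite !Cmod_mult.
  pose proof (Cmod_ge_0 a); pose proof (Cmod_ge_0 b).
  pose proof (Cmod_ge_0 (x 0)); pose proof (Cmod_ge_0 (y 0)).
  set (m := Rmax (Cmod (x 0)) (Cmod (y 0))).
  assert (Hm : m < e) by (apply Rmax_lub_lt; assumption).
  assert (Cmod (x 0) <= m) by apply Rmax_l.
  assert (Cmod (y 0) <= m) by apply Rmax_r.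
  apply Rle_lt_trans with ((Cmod a + Cmod b) * m); [|nra].
  rewrite Rmult_plus_distr_r; apply Rplus_le_compat; apply Rmult_le_compat_l; assumption.
- intros chi Hchi; apply He.
  apply C_NormedModule_mixin_compat1.
  change (Cmod ((phi 0 + chi 0) - phi 0)%C < e).
  replace (phi 0 + chi 0 - phi 0)%C with (chi 0) by ring; exact Hchi.
- intros K HK.
  destruct (compact_P1 K HK) as [m [M HM]].
  set (N := Rmax (Rabs m) (Rabs M)).
  destruct (fourier_sup N) as [A [HA0 HA]].
  destruct Hw as [Hw1 [Kw [HKw0 HKw]]].
  assert (Hd : 0 < e / (2 * (A * Kw))).
  { apply Rdiv_lt_0_compat; [apply cond_pos|].
    apply Rmult_lt_0_compat; [lra|apply Rmult_lt_0_compat; assumption]. }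
  (* The second norm carries |rho|^2 = w, which dominates 1 + t^2 up to [Kw], as [fourier_sup]
     requires. *)
  exists 2%nat, (mkposreal _ Hd); intros chi [P1 [P2 _]] Hp.
  assert (Hcs : cs N chi).
  { split; [exact P1|]; apply supp_out; intros x Hx.
    apply Rabs_le_between; destruct (HM x (P2 x Hx)).
    generalize (RmaxAbs m x M); unfold N; tauto. }
  pose proof (pnorm_elim _ _ _ _ (Hp 2%nat ltac:(lia))) as B; simpl in B.
  apply Rle_lt_trans with (A * (Kw * (e / (2 * (A * Kw))))).
  + apply (HA chi _ Hcs); intros t.
    specialize (B t).
    replace (Cmod (fourier chi t * (rho (RtoC t) * (rho (RtoC t) * 1)))%C)
      with (Cmod (fourier chi t) * w t) in B
      by (rewrite Hrho, !Cmod_mult, Cmod_1; ring).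
    apply Rle_trans with (Kw * (Cmod (fourier chi t) * w t)).
    * replace (Kw * (Cmod (fourier chi t) * w t)) with (Kw * w t * Cmod (fourier chi t)) by ring.
      apply Rmult_le_compat_r; [apply Cmod_ge_0|apply HKw].
    * apply Rmult_le_compat_l; lra.
  + replace (A * (Kw * (e / (2 * (A * Kw))))) with (e / 2) by (field; lra).
    generalize (cond_pos e); lra.
Qed.

Definition delta : dual rho := exist _ _ delta_in_dual.

(* If [f(D) E = delta] is solvable, the continuity of [E] on [D_rho([-2,2])] bounds
   [phi 0 = E (f(D) phi)] by finitely many norms of [f(D) phi]. *)
Lemma not_invertible_criterion :
  (forall n eps, 0 < eps -> exists phi, rap w phi /\ cs 2 phi /\ 1 <= Cmod (phi 0) /\
     forall t, Cmod (F (Ci * RtoC t) * fourier phi t)%C * w t ^ n <= eps) ->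
  ~ invertible_in_dual rho F.
Proof.
intros Htest Hinv.
destruct operator_exists as [T [HT [_ FT]]].
destruct (Hinv (transpose T HT FT) (transpose_extension T HT FT) delta) as [L HL].
destruct (proj2_sig L) as [[Lp Ls] Lc].
assert (Q : locally (T := C_UniformSpace) (L (D_zero rho)) (fun z => Cmod z < 1)).
{ assert (E : L (D_zero rho) = RtoC 0).
  { replace (D_zero rho) with (scal (RtoC 0 : C_Ring) (D_zero rho)).
    - pose proof (Ls (RtoC 0) (D_zero rho)) as Z.
      etransitivity; [exact Z|].
      change (RtoC 0 * L (D_zero rho) = RtoC 0)%C; ring.
    - apply D_ext; intros s; change (RtoC 0 * RtoC 0 = RtoC 0)%C; ring. }
  rewrite E.
  apply (locally_le_locally_norm (K := C_AbsRing) (V := C_NormedModule)).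
  exists (mkposreal 1 Rlt_0_1); intros z Hz.
  change (Cmod (z - RtoC 0)%C < 1) in Hz.
  rewrite Cminus_0_r in Hz; exact Hz. }
destruct (Lc (D_zero rho) _ Q) as [V [_ [V2 V3]]].
destruct (V3 (fun x => - 2 <= x <= 2) (compact_P3 (-2) 2)) as [n [eps H]].
destruct (Htest n (eps / 2)) as [phi0 [Rphi [Cphi [H0 Hb]]]].
{ generalize (cond_pos eps); lra. }
assert (Dphi : in_D rho phi0) by (apply (in_D_rap rho w); [exact Hrho|apply Hw|exact Rphi]).
set (phi := exist _ phi0 Dphi : Dspace rho).
assert (VT : V (T phi)).
{ apply H.
  - destruct (rap_D (T phi)) as [[M' [CT _]] _]; split; [exact CT|split].
    + intros x Hx; apply (proj1 (supp_out phi0 2) (proj2 Cphi)).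
      apply (proj2 HT phi), Hx.
    + destruct (proj2_sig (T phi)) as [K' [_ [_ [_ R]]]]; exact R.
  - intros k Hk; apply pnorm_intro with (eps / 2);
      [generalize (cond_pos eps); lra|].
    intros t; rewrite FT, Cmod_mult, Cmod_Cpow.
    eapply Rle_trans; [|apply (Hb t)].
    apply Rmult_le_compat_l; [apply Cmod_ge_0|].
    pose proof (Cmod_rho_ge1 t) as H1.
    apply Rle_trans with (Cmod (rho (RtoC t)) ^ n); [apply Rle_pow; [exact H1|lia]|].
    rewrite Hrho; apply pow_incr; split; [lra|nra]. }
apply V2 in VT.
assert (E : L (T phi) = phi0 0).
{ change (transpose T HT FT L phi = phi0 0); rewrite HL; reflexivity. }
assert (E2 : plus (D_zero rho) (T phi) = T phi) by apply (plus_zero_l (G := D_AbelianGroup rho)).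
rewrite E2 in VT.
change (Cmod (L (T phi)) < 1) in VT; rewrite E in VT; lra.
Qed.

End Dual.

(** It bounds (sin x / x)^2 by 1 / (1 + x^2 / 16), so that box averages produce products of the same
    shape as [PW]. For |x| > 2 use sin^2 <= 1; otherwise the half-angle formula with y / 2 <= sin y
    <= y, where y = |x| / 2. *)
Lemma sin_sqr_bound x : sin x ^ 2 * (1 + x ^ 2 / 16) <= x ^ 2.
Proof.
destruct (Rle_dec (Rabs x) 2) as [L|L].
- set (y := Rabs x / 2).
  assert (Hy : 0 <= y <= 1) by (unfold y; generalize (Rabs_pos x); lra).
  assert (E : sin x ^ 2 = 4 * sin y ^ 2 * (1 - sin y ^ 2)).
  { replace (sin x ^ 2) with (sin (2 * y) ^ 2).
    - rewrite sin_2a; replace (1 - sin y ^ 2) with (cos y ^ 2); [ring|].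
      generalize (sin2_cos2 y); unfold Rsqr; simpl; lra.
    - unfold y; replace (2 * (Rabs x / 2)) with (Rabs x) by field.
      unfold Rabs; destruct (Rcase_abs x); [rewrite sin_neg; ring|reflexivity]. }
  assert (Hx : x ^ 2 = 4 * y ^ 2).
  { unfold y; rewrite <- (pow2_abs x); field. }
  generalize (x_minus_sin y (proj1 Hy)); intros S.
  assert (S1 : y / 2 <= sin y) by (simpl in S; nra).
  rewrite E, Hx.
  assert (S2 : y ^ 2 / 4 <= sin y ^ 2) by (simpl; nra).
  assert (S3 : sin y ^ 2 <= y ^ 2) by (apply pow_incr; lra).
  assert (S4 : y ^ 2 <= 1) by (simpl; nra).
  set (A := y ^ 2) in *; set (b := sin y ^ 2) in *.
  apply Rle_trans with (4 * A * (1 - b) * (1 + 4 * A / 16)).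
  + apply Rmult_le_compat_r; [lra|]; apply Rmult_le_compat_r; lra.
  +
    rewrite Rmult_assoc; nra.
- assert (H : 4 <= x ^ 2) by (rewrite <- pow2_abs; simpl; nra).
  assert (sin x ^ 2 <= 1).
  { generalize (sin2_cos2 x), (Rle_0_sqr (cos x)); unfold Rsqr; simpl; lra. }
  apply Rle_trans with (1 * (1 + x ^ 2 / 16)); [|lra].
  apply Rmult_le_compat_r; lra.
Qed.

(** * Box averages *)

(** Convolution with the normalised indicator of [-a, a], which multiplies the transform by sin (a
    t) / (a t). *)
Definition avg (a : R) (g : R -> R) (x : R) : R := RInt g (x - a) (x + a) / (2 * a).

Lemma ex_RInt_cont (g : R -> R) a b : (forall x, continuous g x) -> ex_RInt g a b.
Proof. intros H; apply (ex_RInt_continuous (V := R_CompleteNormedModule)); auto. Qed.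

Lemma avg_le a g x B : 0 < a -> (forall x, continuous g x) ->
  (forall y, x - a <= y <= x + a -> g y <= B) -> avg a g x <= B.
Proof.
intros Ha Hc H; unfold avg.
apply Rmult_le_reg_r with (2 * a); [lra|].
unfold Rdiv; rewrite Rmult_assoc, Rinv_l, Rmult_1_r by lra.
replace (B * (2 * a)) with (RInt (fun _ => B) (x - a) (x + a)).
- apply RInt_le; [lra|apply ex_RInt_cont, Hc|apply ex_RInt_const|].
  intros y Hy; apply H; lra.
- rewrite RInt_const; unfold scal; simpl; unfold mult; simpl; ring.
Qed.

Lemma avg_opp a g x : (forall x, continuous g x) ->
  avg a (fun y => - g y) x = - avg a g x.
Proof.
intros Hc; unfold avg.
rewrite (RInt_opp (V := R_CompleteNormedModule)) by apply ex_RInt_cont, Hc.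
change (- RInt g (x - a) (x + a) * / (2 * a) = - (RInt g (x - a) (x + a) * / (2 * a)))%R.
apply Ropp_mult_distr_l_reverse.
Qed.

Lemma avg_ge a g x B : 0 < a -> (forall x, continuous g x) ->
  (forall y, x - a <= y <= x + a -> B <= g y) -> B <= avg a g x.
Proof.
intros Ha Hc H.
assert (Q : avg a (fun y => - g y) x <= - B).
{ apply avg_le; [exact Ha| |].
  - intros y; apply (continuous_opp (V := R_NormedModule)), Hc.
  - intros y Hy; generalize (H y Hy); lra. }
rewrite avg_opp in Q by exact Hc; lra.
Qed.

Lemma avg_shift a g x h : (forall x, continuous g x) ->
  avg a g (x + h) = avg a (fun y => g (y + h)) x.
Proof.
intros Hc; unfold avg; f_equal.
transitivity (RInt (fun y => scal 1 (g (1 * y + h))) (x - a) (x + a)).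
- rewrite (RInt_comp_lin (V := R_CompleteNormedModule) g) by apply ex_RInt_cont, Hc.
  replace (1 * (x - a) + h) with (x + h - a) by ring.
  replace (1 * (x + a) + h) with (x + h + a) by ring; reflexivity.
- apply RInt_ext; intros y _; unfold scal; simpl; unfold mult; simpl; rewrite !Rmult_1_l; reflexivity.
Qed.

Lemma avg_minus a f g x : (forall x, continuous f x) -> (forall x, continuous g x) ->
  avg a (fun y => f y - g y) x = avg a f x - avg a g x.
Proof.
intros Hf Hg; unfold avg.
rewrite (RInt_minus (V := R_CompleteNormedModule)) by (apply ex_RInt_cont; assumption).
change ((RInt f (x - a) (x + a) + - RInt g (x - a) (x + a)) * / (2 * a) =
  RInt f (x - a) (x + a) * / (2 * a) - RInt g (x - a) (x + a) * / (2 * a))%R.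
rewrite Rmult_plus_distr_r, Ropp_mult_distr_l_reverse; reflexivity.
Qed.

Definition lipschitz (L : R) (g : R -> R) : Prop :=
  forall x y, Rabs (g x - g y) <= L * Rabs (x - y).

Lemma lipschitz_continuous L g : lipschitz L g -> forall x, continuous g x.
Proof.
intros H x.
apply continuity_pt_filterlim; intros eps He.
assert (HL : 0 < Rabs L + 1) by (generalize (Rabs_pos L); lra).
exists (eps / (Rabs L + 1)); split; [apply Rdiv_lt_0_compat; lra|].
intros y [_ Hy].
change (Rabs (y - x) < eps / (Rabs L + 1)) in Hy.
change (Rabs (g y - g x) < eps).
eapply Rle_lt_trans; [apply H|].
apply Rle_lt_trans with (Rabs L * Rabs (y - x)).
- apply Rmult_le_compat_r; [apply Rabs_pos|apply Rle_abs].
- apply Rle_lt_trans with ((Rabs L + 1) * Rabs (y - x)).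
  + generalize (Rabs_pos (y - x)); lra.
  + replace eps with ((Rabs L + 1) * (eps / (Rabs L + 1))) at 1 by (field; lra).
    apply Rmult_lt_compat_l; assumption.
Qed.

(** Properties that survive averaging, with a controlled change of M and r, as well as uniform
    limits. The plateau on [-r, r] yields the lower bound for the test functions at 0. *)
Definition bump (M L r : R) (g : R -> R) : Prop :=
  lipschitz L g /\ (forall x, 0 <= g x <= 1) /\
  (forall x, M < Rabs x -> g x = 0) /\ (forall x, Rabs x <= r -> 1 <= g x).

Lemma bump_avg M L r g a : 0 < a -> bump M L r g -> bump (M + a) L (r - a) (avg a g).
Proof.
intros Ha [HL [Hb [Hs H1]]].
pose proof (lipschitz_continuous L g HL) as Hc.
split; [|split; [|split]].
- assert (P : forall x h, avg a g (x + h) - avg a g x <= L * Rabs h).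
  { intros x h; rewrite avg_shift by exact Hc.
    assert (Hc' : forall y, continuous (fun y => g (y + h)) y).
    { apply continuous_shift, Hc. }
    rewrite <- avg_minus by assumption.
    apply avg_le; [exact Ha| |].
    - intros y; apply (continuous_minus (V := R_NormedModule)); auto.
    - intros y _; eapply Rle_trans; [apply Rle_abs|].
      eapply Rle_trans; [apply HL|]; right; do 2 f_equal; ring. }
  intros x y; apply Rabs_le; split.
  + generalize (P x (y - x)); replace (x + (y - x)) with y by ring.
    rewrite (Rabs_minus_sym y x); lra.
  + generalize (P y (x - y)); replace (y + (x - y)) with x by ring; lra.
- intros x; split.
  + apply avg_ge; [exact Ha|exact Hc|intros; apply Hb].
  + apply avg_le; [exact Ha|exact Hc|intros; apply Hb].
- intros x Hx.
  assert (Z : forall y, x - a <= y <= x + a -> g y = 0).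
  { intros y Hy; apply Hs.
    assert (Rabs (x - y) <= a) by (apply Rabs_le; lra).
    generalize (Rabs_triang (x - y) y); replace (x - y + y) with x by ring; lra. }
  apply Rle_antisym.
  + apply avg_le; [exact Ha|exact Hc|]; intros y Hy; rewrite Z by exact Hy; lra.
  + apply avg_ge; [exact Ha|exact Hc|]; intros y Hy; rewrite Z by exact Hy; lra.
- intros x Hx; apply avg_ge; [exact Ha|exact Hc|].
  intros y Hy; apply H1.
  assert (Rabs (y - x) <= a) by (apply Rabs_le; lra).
  generalize (Rabs_triang (y - x) x); replace (y - x + x) with y by ring; lra.
Qed.

Lemma avg_close L g a x : 0 < a -> lipschitz L g -> 0 <= L ->
  Rabs (avg a g x - g x) <= L * a.
Proof.
intros Ha HL HL0; pose proof (lipschitz_continuous L g HL) as Hc.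
assert (Q : forall y, x - a <= y <= x + a -> Rabs (g y - g x) <= L * a).
{ intros y Hy; eapply Rle_trans; [apply HL|].
  apply Rmult_le_compat_l; [exact HL0|apply Rabs_le; lra]. }
apply Rabs_le; split.
- assert (g x - L * a <= avg a g x); [|lra].
  apply avg_ge; [exact Ha|exact Hc|]; intros y Hy.
  generalize (Q y Hy), (Rle_abs (- (g y - g x))); rewrite Rabs_Ropp; lra.
- assert (avg a g x <= g x + L * a); [|lra].
  apply avg_le; [exact Ha|exact Hc|]; intros y Hy.
  generalize (Q y Hy), (Rle_abs (g y - g x)); lra.
Qed.

Definition emb (g : R -> R) (x : R) : C := RtoC (g x).

Lemma cs_emb M L r g : bump M L r g -> cs M (emb g).
Proof.
intros [HL [_ [Hs _]]]; split.
- intros x; apply continuous_RtoC, (lipschitz_continuous L), HL.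
- intros x Hx; unfold emb; rewrite Hs by exact Hx; reflexivity.
Qed.

Lemma is_derive_avg a g x : 0 < a -> (forall x, continuous g x) ->
  is_derive (avg a g) x ((g (x + a) - g (x - a)) / (2 * a)).
Proof.
intros Ha Hc.
set (G := fun y => RInt g 0 y).
assert (HG : forall y, is_derive G y (g y)).
{ intros y; apply (is_derive_RInt (V := R_NormedModule) g G 0 y); [|apply Hc].
  apply filter_forall; intros z; apply (RInt_correct (V := R_CompleteNormedModule)).
  apply ex_RInt_cont, Hc. }
apply (is_derive_ext (fun y => (G (y + a) - G (y - a)) / (2 * a))).
- intros y; unfold avg, G; f_equal.
  rewrite <- (RInt_Chasles (V := R_CompleteNormedModule) g 0 (y - a) (y + a))
    by apply ex_RInt_cont, Hc.
  unfold plus; simpl; ring.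
- assert (D1 := HG (x + a)); assert (D2 := HG (x - a)).
  auto_derive.
  + split; [exists (g (x + a)); exact D1|split; [|exact I]].
    exists (g (x - a)); exact D2.
  + replace (Derive (fun y => G y) (x + a)) with (g (x + a))
      by (symmetry; apply is_derive_unique, D1).
    replace (Derive (fun y => G y) (x + - a)) with (g (x - a))
      by (symmetry; apply is_derive_unique, D2).
    field; lra.
Qed.

(** Integration by parts: the derivative of the average is a symmetric difference quotient of g,
    whose transform is i sin (a t) / a times that of g. Multiplied out by a t, the identity also
    covers t = 0. *)
Lemma fourier_avg M L r g a t : 0 <= M -> 0 < a -> bump M L r g ->
  (RtoC (a * t) * fourier (emb (avg a g)) t)%C = (RtoC (sin (a * t)) * fourier (emb g) t)%C.
Proof.
intros HM Ha Hg; pose proof (bump_avg M L r g a Ha Hg) as Hag.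
pose proof (cs_emb _ _ _ _ Hg) as Cg; pose proof (cs_emb _ _ _ _ Hag) as Cag.
pose proof (lipschitz_continuous L g (proj1 Hg)) as Hc.
pose proof (lipschitz_continuous L _ (proj1 Hag)) as Hca.
set (A := avg a g) in *.
set (A' := fun x => (g (x + a) - g (x - a)) / (2 * a)).
assert (DA : forall x, is_derive A x (A' x)).
{ intros x; apply is_derive_avg; assumption. }
assert (cA' : forall x, continuous A' x).
{ intros x; apply (continuous_mult (K := R_AbsRing)); [|apply continuous_const].
  apply (continuous_minus (V := R_NormedModule));
    [apply continuous_shift|apply (continuous_shift _ g (- a))]; exact Hc. }
set (N := M + a + 1).
assert (AN : A N = 0) by (apply (proj1 (proj2 (proj2 Hag))); rewrite Rabs_right;
  unfold N; lra).
assert (AN' : A (- N) = 0) by (apply (proj1 (proj2 (proj2 Hag)));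
  rewrite Rabs_Ropp, Rabs_right; unfold N; lra).
(* [I1] and [I2] are the real and imaginary parts of the integral of the derivative of A(s) exp (- i
   t s); the boundary terms vanish because [N] lies outside the support. *)
assert (I1 : is_RInt (fun s => A' s * cos (t * s) - t * (A s * sin (t * s))) (- N) N 0).
{ replace 0 with (minus (A N * cos (t * N)) (A (- N) * cos (t * - N)))
    by (rewrite AN, AN'; unfold minus, plus, opp; simpl; ring).
  apply (is_RInt_derive (V := R_CompleteNormedModule) (fun s => A s * cos (t * s))).
  - intros x _; specialize (DA x).
    auto_derive; [exists (A' x); exact DA|].
    replace (Derive (fun x => A x) x) with (A' x) by (symmetry; apply is_derive_unique, DA).
    ring.
  - intros x _; apply (continuous_minus (V := R_NormedModule)).
    + apply (continuous_mult (K := R_AbsRing)); [apply cA'|apply continuous_cos_lin].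
    + apply (continuous_mult (K := R_AbsRing)); [apply continuous_const|].
      apply (continuous_mult (K := R_AbsRing)); [apply Hca|apply continuous_sin_lin]. }
assert (I2 : is_RInt (fun s => - (A' s * sin (t * s)) - t * (A s * cos (t * s))) (- N) N 0).
{ replace 0 with (minus (- (A N * sin (t * N))) (- (A (- N) * sin (t * - N))))
    by (rewrite AN, AN'; unfold minus, plus, opp; simpl; ring).
  apply (is_RInt_derive (V := R_CompleteNormedModule) (fun s => - (A s * sin (t * s)))).
  - intros x _; specialize (DA x).
    auto_derive; [exists (A' x); exact DA|].
    replace (Derive (fun x => A x) x) with (A' x) by (symmetry; apply is_derive_unique, DA).
    ring.
  - intros x _; apply (continuous_minus (V := R_NormedModule)).
    + apply (continuous_opp (V := R_NormedModule)).
      apply (continuous_mult (K := R_AbsRing)); [apply cA'|apply continuous_sin_lin].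
    + apply (continuous_mult (K := R_AbsRing)); [apply continuous_const|].
      apply (continuous_mult (K := R_AbsRing)); [apply Hca|apply continuous_cos_lin]. }
assert (CA' : cs (M + a) (emb A')).
{ split; [intros x; apply continuous_RtoC, cA'|].
  intros x Hx; unfold emb, A'.
  assert (Z : forall h, Rabs h <= a -> g (x + h) = 0).
  { intros h Hh; apply (proj1 (proj2 (proj2 Hg))).
    generalize (Rabs_triang (x + h) (- h)); rewrite Rabs_Ropp.
    replace (x + h + - h) with x by ring; lra. }
  replace (x - a) with (x + - a) by ring; rewrite (Z a), (Z (- a)) by (try rewrite Rabs_Ropp; rewrite Rabs_right; lra).
  f_equal; field; lra. }
assert (HN : M + a <= N) by (unfold N; lra).
pose proof (cs_cis _ _ t (cs_mono _ _ _ HN CA')) as C1.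
pose proof (cs_cis _ _ t (cs_mono _ _ _ HN Cag)) as C2.
assert (Z : Cint (fun s => 1 * (emb A' s * cis (- (t * s)))
   + (Ci * RtoC (- t)) * (emb A s * cis (- (t * s))))%C = RtoC 0).
{ apply (Cint_unique _ N); [unfold N; lra|apply cs_lin; assumption|].
  apply (is_RInt_fct_extend_pair (U := R_NormedModule) (V := R_NormedModule)).
  - refine (is_RInt_ext _ _ _ _ _ _ I1); intros s _.
    unfold emb, cis; simpl; rewrite cos_neg, sin_neg; ring.
  - refine (is_RInt_ext _ _ _ _ _ _ I2); intros s _.
    unfold emb, cis; simpl; rewrite cos_neg, sin_neg; ring. }
rewrite (Cint_lin _ _ _ _ N) in Z; try apply C1; try apply C2.
assert (F1 : fourier (emb A') t = (Ci * RtoC (sin (t * a) / a) * fourier (emb g) t)%C).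
{ transitivity (fourier (fun s => RtoC (/ (2 * a)) * emb g (s + a)%R
    + RtoC (- / (2 * a)) * emb g (s + - a)%R)%C t).
  - apply fourier_ext; intros s; unfold emb, A'.
    rewrite <- !RtoC_mult, <- RtoC_plus; f_equal; unfold Rminus; field; lra.
  - rewrite (fourier_lin_cs _ _ (fun s => emb g (s + a)) (fun s => emb g (s + - a))
      (M + Rabs a)).
    + rewrite !(fourier_shift M) by exact Cg.
      replace (t * - a) with (- (t * a)) by ring.
      unfold cis; rewrite cos_neg, sin_neg.
      destruct (fourier (emb g) t) as [p q].
      apply injective_projections; simpl; field; lra.
    + apply cs_shift, Cg.
    + rewrite <- (Rabs_Ropp a); apply cs_shift, Cg. }
unfold fourier in F1 at 1.
set (X := Cint (fun s => (emb A' s * cis (- (t * s)))%C)) in *.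
assert (F2 : fourier (emb A) t = (RtoC (/ (2 * PI)) * Cint (fun s => (emb A s * cis (- (t * s)))%C))%C)
  by reflexivity.
set (Y := Cint (fun s => (emb A s * cis (- (t * s)))%C)) in *.
assert (Z2 : (Ci * RtoC t * fourier (emb A) t)%C = (Ci * RtoC (sin (t * a) / a) * fourier (emb g) t)%C).
{ rewrite <- F1, F2.
  replace X with ((1 * X + Ci * RtoC (- t) * Y) + Ci * RtoC t * Y)%C.
  - rewrite Z; ring.
  - rewrite RtoC_opp; ring. }
transitivity (RtoC (- a) * Ci * (Ci * RtoC t * fourier (emb A) t))%C.
- destruct (fourier (emb A) t) as [p q]; apply injective_projections; simpl; ring.
- rewrite Z2; rewrite (Rmult_comm t a).
  destruct (fourier (emb g) t) as [p q]; apply injective_projections; simpl; field; lra.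
Qed.

Lemma fourier_avg_mod M L r g a t : 0 <= M -> 0 < a -> bump M L r g -> t <> 0 ->
  Cmod (fourier (emb (avg a g)) t) = Rabs (sin (a * t)) / Rabs (a * t) * Cmod (fourier (emb g) t).
Proof.
intros HM Ha Hg Ht.
assert (P : 0 < Rabs (a * t)) by (apply Rabs_pos_lt; nra).
apply Rmult_eq_reg_l with (Rabs (a * t)); [|lra].
rewrite <- Cmod_R, <- Cmod_mult, (fourier_avg M L r) by assumption.
rewrite Cmod_mult, !Cmod_R; field; lra.
Qed.

Fixpoint iavg (n : nat) (a : R) (g : R -> R) : R -> R :=
  match n with O => g | S m => avg a (iavg m a g) end.

Lemma bump_iavg n M L r g a : 0 < a -> bump M L r g ->
  bump (M + INR n * a) L (r - INR n * a) (iavg n a g).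
Proof.
intros Ha Hg; induction n as [|n IH].
- simpl; replace (M + 0 * a) with M by ring; replace (r - 0 * a) with r by ring; exact Hg.
- cbn [iavg]; rewrite S_INR.
  replace (M + (INR n + 1) * a) with (M + INR n * a + a) by ring.
  replace (r - (INR n + 1) * a) with (r - INR n * a - a) by ring.
  apply bump_avg; assumption.
Qed.

Lemma iavg_close n M L r g a x : 0 < a -> 0 <= L -> bump M L r g ->
  Rabs (iavg n a g x - g x) <= L * (INR n * a).
Proof.
intros Ha HL Hg; induction n as [|n IH].
- simpl; rewrite Rminus_diag, Rabs_R0; lra.
- cbn [iavg]; rewrite S_INR.
  pose proof (avg_close L (iavg n a g) a x Ha (proj1 (bump_iavg n M L r g a Ha Hg)) HL).
  replace (avg a (iavg n a g) x - g x)
    with ((avg a (iavg n a g) x - iavg n a g x) + (iavg n a g x - g x)) by ring.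
  eapply Rle_trans; [apply Rabs_triang|]; lra.
Qed.

(** One factor from [sin_sqr_bound] per average; the squares let these factors accumulate into a
    product comparable with [PW]. *)
Lemma fourier_iavg_decay n M L r g a t : 0 <= M -> 0 < a -> bump M L r g -> t <> 0 ->
  Cmod (fourier (emb (iavg n a g)) t) ^ 2 * (1 + (a * t) ^ 2 / 16) ^ n
  <= Cmod (fourier (emb g) t) ^ 2.
Proof.
intros HM Ha Hg Ht; induction n as [|n IH]; [simpl; lra|].
cbn [iavg].
pose proof (bump_iavg n M L r g a Ha Hg) as Hn.
rewrite (fourier_avg_mod (M + INR n * a) L (r - INR n * a)); try assumption;
  [|generalize (Rmult_le_pos _ _ (pos_INR n) (Rlt_le _ _ Ha)); lra].
set (X := Cmod (fourier (emb (iavg n a g)) t)) in *.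
assert (P : 0 < Rabs (a * t)) by (apply Rabs_pos_lt; nra).
assert (P2 : 0 < (a * t) ^ 2) by (rewrite <- pow2_abs; apply pow_lt, P).
eapply Rle_trans; [|exact IH].
pose proof (sin_sqr_bound (a * t)) as SB.
rewrite <- (pow2_abs (a * t)), <- (pow2_abs (sin (a * t))) in SB.
rewrite <- (pow2_abs (a * t)).
assert (HZ : 0 < 1 + Rabs (a * t) ^ 2 / 16) by (rewrite pow2_abs; lra).
set (Z := 1 + Rabs (a * t) ^ 2 / 16) in *.
set (V := Rabs (a * t)) in *; set (U := Rabs (sin (a * t))) in *.
replace ((U / V * X) ^ 2 * Z ^ S n) with ((U ^ 2 * Z / V ^ 2) * (X ^ 2 * Z ^ n))
  by (simpl; field; lra).
rewrite <- (Rmult_1_l (X ^ 2 * Z ^ n)) at 2.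
apply Rmult_le_compat_r.
- apply Rmult_le_pos; [apply pow2_ge_0|apply pow_le; lra].
- apply Rmult_le_reg_r with (V ^ 2); [apply pow_lt, P|].
  replace (U ^ 2 * Z / V ^ 2 * V ^ 2) with (U ^ 2 * Z) by (field; lra); lra.
Qed.

(** The other use of averaging: |sin y / y|^n <= |y|^(-n) is exponentially small in n once |y| >= e,
    while the minimum with 1 shows that nothing is lost elsewhere. *)
Lemma fourier_iavg_far n M L r g a t : 0 <= M -> 0 < a -> bump M L r g -> t <> 0 ->
  Cmod (fourier (emb (iavg n a g)) t)
  <= (Rmin 1 (/ Rabs (a * t))) ^ n * Cmod (fourier (emb g) t).
Proof.
intros HM Ha Hg Ht; induction n as [|n IH]; [simpl; lra|].
cbn [iavg].
pose proof (bump_iavg n M L r g a Ha Hg) as Hn.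
rewrite (fourier_avg_mod (M + INR n * a) L (r - INR n * a)); try assumption;
  [|generalize (Rmult_le_pos _ _ (pos_INR n) (Rlt_le _ _ Ha)); lra].
assert (P : 0 < Rabs (a * t)) by (apply Rabs_pos_lt; nra).
pose proof (Rinv_0_lt_compat _ P) as PI'.
cbn [pow]; rewrite Rmult_assoc.
apply Rmult_le_compat; [|apply Cmod_ge_0| |exact IH].
- apply Rmult_le_pos; [apply Rabs_pos|lra].
- apply Rmin_glb.
  + apply Rmult_le_reg_r with (Rabs (a * t)); [exact P|].
    unfold Rdiv; rewrite Rmult_assoc, Rinv_l, Rmult_1_r, Rmult_1_l by lra.
    apply sin_le_abs.
  + unfold Rdiv; rewrite <- (Rmult_1_l (/ Rabs (a * t))) at 2.
    apply Rmult_le_compat_r; [lra|].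
    apply Rabs_le, SIN_bound.
Qed.

(** * Test functions *)

(** A trapezoid, 1 up to 3/4 and 0 from 7/8 on. A total averaging width of 1/8 then leaves the
    support in [-1, 1] and a plateau on [-5/8, 5/8]. *)
Definition tent (x : R) : R := Rmax 0 (Rmin 1 (7 - 8 * Rabs x)).

Lemma bump_tent : bump (7 / 8) 8 (3 / 4) tent.
Proof.
unfold tent; split; [|split; [|split]].
- intros x y.
  generalize (Rabs_triang_inv2 x y); unfold Rmax, Rmin.
  set (d := Rabs (x - y)); set (a := Rabs x); set (b := Rabs y); clearbody d a b.
  intros H; apply Rabs_le_between in H.
  repeat destruct (Rle_dec _ _); apply Rabs_le; lra.
- intros x; unfold Rmax, Rmin; repeat destruct (Rle_dec _ _); lra.
- intros x Hx; unfold Rmax, Rmin; repeat destruct (Rle_dec _ _); lra.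
- intros x Hx; unfold Rmax, Rmin; repeat destruct (Rle_dec _ _); lra.
Qed.

(* du Bois-Reymond: with the tails R_j of the series, 1 / sqrt R_j works, since
   (R_j - R_(j+1)) / sqrt R_j <= 2 (sqrt R_j - sqrt R_(j+1)). *)
Lemma slow_multiplier s : summable s -> (forall j, 0 < s j) ->
  exists N : nat -> nat, summable (fun j => INR (N j) * s j) /\
    forall k : nat, exists J, forall j, (J <= j)%nat -> (k <= N j)%nat.
Proof.
intros [Hs0 [Sm HS]] Hs.
set (T := fun j => Sm - Rsum s j).
assert (HT : forall j, 0 < T j).
{ intros j; unfold T; pose proof (Rsum_le_lim s Sm (S j) Hs0 HS) as Q.
  simpl in Q; specialize (Hs j); lra. }
assert (HTs : forall j, T j - T (S j) = s j) by (intros j; unfold T; simpl; ring).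
assert (Hq : forall j, 0 < sqrt (T j)) by (intros j; apply sqrt_lt_R0, HT).
destruct (functional_choice (fun j (n : nat) => INR n <= / sqrt (T j) < INR n + 1))
  as [N HN].
{ intros j; destruct (nfloor_ex (/ sqrt (T j))) as [n Hn];
    [left; apply Rinv_0_lt_compat, Hq|exists n; exact Hn]. }
exists N; split.
- apply summable_bound with (2 * sqrt (T O)).
  + intros j; apply Rmult_le_pos; [apply pos_INR|apply Hs0].
  + assert (Q : forall n, Rsum (fun j => INR (N j) * s j) n <= 2 * sqrt (T O) - 2 * sqrt (T n)).
    { induction n as [|n IH]; [simpl; lra|]; simpl Rsum.
      assert (INR (N n) * s n <= 2 * sqrt (T n) - 2 * sqrt (T (S n))); [|lra].
      apply Rle_trans with (/ sqrt (T n) * s n);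
        [apply Rmult_le_compat_r; [apply Hs0|apply HN]|].
      apply Rmult_le_reg_l with (sqrt (T n)); [apply Hq|].
      rewrite <- Rmult_assoc, Rinv_r, Rmult_1_l by (generalize (Hq n); lra).
      rewrite <- HTs.
      pose proof (sqrt_sqrt (T n) (Rlt_le _ _ (HT n))) as E1.
      pose proof (sqrt_sqrt (T (S n)) (Rlt_le _ _ (HT (S n)))) as E2.
      set (x := sqrt (T n)) in *; set (y := sqrt (T (S n))) in *.
      generalize (pow2_ge_0 (x - y)); simpl; lra. }
    intros n; generalize (Q n), (Hq n); lra.
- intros k.
  assert (P : 0 < INR k + 1) by (generalize (pos_INR k); lra).
  destruct (lim_0_eps T (/ (INR k + 1) ^ 2) (tail_lim s Sm HS)) as [J HJ].
  { apply Rinv_0_lt_compat, pow_lt, P. }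
  exists J; intros j Hj.
  assert (Q : sqrt (T j) < / (INR k + 1)).
  { rewrite <- (sqrt_pow2 (/ (INR k + 1))) by (left; apply Rinv_0_lt_compat, P).
    apply sqrt_lt_1_alt; split; [left; apply HT|].
    rewrite pow_inv; apply HJ, Hj. }
  apply Rinv_lt_contravar in Q.
  + rewrite Rinv_inv in Q; apply INR_le; generalize (HN j); lra.
  + apply Rmult_lt_0_compat; [apply Hq|apply Rinv_0_lt_compat, P].
Qed.

(** A coefficient [eta] below 1 is compensated by repeating the factor [m] times, m >= 1 / eta. *)
Lemma bernoulli_pow eta m y : 0 <= y -> 0 <= eta -> 1 <= INR m * eta ->
  1 + y <= (1 + eta * y) ^ m.
Proof.
intros Hy He Hm; apply Rle_trans with (1 + INR m * (eta * y)).
- rewrite <- Rmult_assoc; assert (1 * y <= INR m * eta * y)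
    by (apply Rmult_le_compat_r; assumption); lra.
- destruct (Rle_lt_or_eq_dec 0 (eta * y)) as [L|E]; [apply Rmult_le_pos; assumption| |].
  + apply poly, L.
  + rewrite <- E, Rmult_0_r, Rplus_0_r, pow1; lra.
Qed.

(* The finitely many factors with small multiplicity are polynomial, hence
   absorbed by a single later factor of large multiplicity. *)
Lemma product_absorb (s : nat -> R) (N : nat -> nat) eta K :
  (forall j, 0 < s j) -> (exists B, forall j, s j <= B) -> 0 < eta ->
  (forall k : nat, exists J, forall j, (J <= j)%nat -> (k <= N j)%nat) ->
  exists D n0, 0 < D /\ forall x n, 0 <= x -> (n0 <= n)%nat ->
    PW (fun j => s j ^ 2) n x ^ K <= D * Rprod (fun j => (1 + eta * (s j ^ 2 * x)) ^ N j) n.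
Proof.
intros Hs [B HB] He HN.
destruct (nfloor_ex (/ eta)) as [m0 Hm0]; [left; apply Rinv_0_lt_compat, He|].
set (m := S m0).
assert (Hm : 1 <= INR m * eta).
{ unfold m; rewrite S_INR.
  apply Rle_trans with (/ eta * eta); [rewrite Rinv_l; lra|].
  apply Rmult_le_compat_r; lra. }
(* From [J] on every factor of the right side dominates the [K]-th power of its own counterpart. *)
destruct (HN (m * K)%nat) as [J HJ].
(* The factor at [j1] pays [K] powers for itself and [K] for each of the [J] first ones. *)
destruct (HN (m * (K + K * J))%nat) as [J1 HJ1].
set (j1 := Nat.max J J1).
specialize (HJ1 j1 ltac:(unfold j1; lia)).
assert (Hp1 : 0 < s j1 ^ 2) by (apply pow_lt, Hs).
(* As s_j <= B, this gives 1 + s_j^2 x <= D0 (1 + s_j1^2 x) for every j. *)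
set (D0 := 1 + B ^ 2 / s j1 ^ 2).
assert (HD0 : 1 <= D0).
{ unfold D0; assert (0 <= B ^ 2 / s j1 ^ 2); [|lra].
  apply Rmult_le_pos; [apply pow2_ge_0|left; apply Rinv_0_lt_compat, Hp1]. }
exists (D0 ^ (K * J)), (S j1); split; [apply pow_lt; lra|].
intros x n Hx Hn.
set (y := fun j => s j ^ 2 * x).
assert (Hy : forall j, 0 <= y j) by (intros j; apply Rmult_le_pos; [apply pow2_ge_0|exact Hx]).
set (r := fun j => (1 + eta * y j) ^ N j).
assert (Hr1 : forall j, 1 <= r j).
{ intros j; apply pow_R1_Rle.
  generalize (Rmult_le_pos _ _ (Rlt_le _ _ He) (Hy j)); lra. }
set (X := 1 + y j1).
assert (HX : 1 <= X) by (unfold X; generalize (Hy j1); lra).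
assert (Big : forall j k, (m * k <= N j)%nat -> (1 + y j) ^ k <= r j).
{ intros j k Hk; unfold r.
  assert (B1 : 1 <= 1 + eta * y j)
    by (generalize (Rmult_le_pos _ _ (Rlt_le _ _ He) (Hy j)); lra).
  apply Rle_trans with ((1 + eta * y j) ^ (m * k)); [|apply Rle_pow; assumption].
  rewrite pow_mult; apply pow_incr; split; [generalize (Hy j); lra|].
  apply bernoulli_pow; auto; lra. }
assert (Small : forall j, (1 + y j) ^ K <= D0 ^ K * X ^ K).
{ intros j; rewrite <- Rpow_mult_distr; apply pow_incr; split; [generalize (Hy j); lra|].
  unfold D0, X.
  assert (s j ^ 2 <= B ^ 2) by (apply pow_incr; split; [left; apply Hs|apply HB]).
  assert (y j <= B ^ 2 * x) by (apply Rmult_le_compat_r; assumption).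
  replace ((1 + B ^ 2 / s j1 ^ 2) * (1 + y j1))
    with (1 + y j1 + B ^ 2 / s j1 ^ 2 + B ^ 2 * x) by (unfold y; field; generalize (Hs j1); lra).
  assert (0 <= B ^ 2 / s j1 ^ 2) by (unfold D0 in HD0; lra).
  generalize (Hy j1); lra. }
assert (PS : forall k, PW (fun j => s j ^ 2) k x ^ K = Rprod (fun j => (1 + y j) ^ K) k)
  by (intros k; rewrite Rprod_pow; reflexivity).
rewrite PS; change (Rprod (fun j => (1 + y j) ^ K) n <= D0 ^ (K * J) * Rprod r n).
assert (HL0 : forall j, 0 <= (1 + y j) ^ K)
  by (intros j; apply pow_le; generalize (Hy j); lra).
assert (HA : forall k, (k <= J)%nat ->
  Rprod (fun j => (1 + y j) ^ K) k <= (D0 ^ K * X ^ K) ^ k).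
{ induction k as [|k IH]; intros Hk; [simpl; lra|].
  cbn [Rprod]; rewrite <- (tech_pow_Rmult _ k), (Rmult_comm _ ((D0 ^ K * X ^ K) ^ k)).
  apply Rmult_le_compat; [apply Rprod_ge0, HL0|apply HL0|apply IH; lia|apply Small]. }
assert (HB2 : forall k, (J <= k)%nat -> (k <= j1)%nat ->
  Rprod (fun j => (1 + y j) ^ K) k <= (D0 ^ K * X ^ K) ^ J * Rprod r k).
{ intros k Hk; induction Hk as [|k Hk IH]; intros Hk1.
  - eapply Rle_trans; [apply HA; lia|].
    rewrite <- (Rmult_1_r ((D0 ^ K * X ^ K) ^ J)) at 1.
    apply Rmult_le_compat_l; [|apply (Rprod_mono r 0 J Hr1); lia].
    apply pow_le, Rmult_le_pos; apply pow_le; lra.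
  - cbn [Rprod]; rewrite <- Rmult_assoc.
    apply Rmult_le_compat; [apply Rprod_ge0, HL0|apply HL0|apply IH; lia|].
    apply Big, HJ, Hk. }
assert (HC : Rprod (fun j => (1 + y j) ^ K) (S j1) <= D0 ^ (K * J) * Rprod r (S j1)).
{ cbn [Rprod].
  apply Rle_trans with ((D0 ^ K * X ^ K) ^ J * Rprod r j1 * (1 + y j1) ^ K).
  - apply Rmult_le_compat_r; [apply HL0|apply HB2; unfold j1; lia].
  - rewrite Rpow_mult_distr, <- !pow_mult.
    replace (D0 ^ (K * J) * X ^ (K * J) * Rprod r j1 * (1 + y j1) ^ K)
      with (D0 ^ (K * J) * (Rprod r j1 * (X ^ K * X ^ (K * J)))) by (unfold X; ring).
    apply Rmult_le_compat_l; [apply pow_le; lra|].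
    apply Rmult_le_compat_l; [apply Rprod_ge0; intros j; generalize (Hr1 j); lra|].
    rewrite <- pow_add; apply Big, HJ1. }
induction Hn as [|n Hn IH]; [exact HC|].
cbn [Rprod]; rewrite <- Rmult_assoc.
apply Rmult_le_compat; [apply Rprod_ge0, HL0|apply HL0|exact IH|].
apply Big, HJ; unfold j1 in Hn; lia.
Qed.

(** An infinite convolution of boxes, the j-th of half-width th s'_j repeated N_j times: summability
    of N_j s'_j keeps the support bounded, and N_j tending to infinity makes the decay beat every
    power of [W]. *)
Lemma mollifier s : summable s -> exists chi, bump 1 8 (5 / 8) chi /\
  forall K, exists C0, forall t,
    Cmod (fourier (emb chi) t) * W (fun j => s j ^ 2) (t ^ 2) ^ K <= C0.
Proof.
intros Hs.
(* [slow_multiplier] wants strictly positive terms; enlarging [s] only enlarges the product to be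
   beaten. *)
set (s' := fun j => s j + (/ 2) ^ j).
assert (Hs' : summable s') by (apply summable_plus; [exact Hs|apply summable_half]).
assert (Hp : forall j, 0 < s' j).
{ intros j; unfold s'; generalize (proj1 Hs j), (pow_lt (/ 2) j); lra. }
destruct (slow_multiplier s' Hs' Hp) as [N [HN HNk]].
destruct (summable_bounded _ HN) as [B [HB0 HB]].
(* Makes the total width of all averages at most 1/8, the room left by [tent]. *)
set (th := Rmin 1 (/ (8 * B))).
assert (Hth : 0 < th) by (apply Rmin_glb_lt; [lra|apply Rinv_0_lt_compat; lra]).
set (a := fun j => th * s' j).
assert (Ha : forall j, 0 < a j) by (intros j; apply Rmult_lt_0_compat; auto).
set (g := fix g n := match n with O => tent | S m => iavg (N m) (a m) (g m) end).
set (b := fun j => INR (N j) * a j).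
assert (Hb : forall n, Rsum b n <= / 8).
{ intros n; rewrite (Rsum_ext b (fun j => th * (INR (N j) * s' j)))
    by (intros; unfold b, a; ring).
  rewrite Rsum_scal; apply Rle_trans with (/ (8 * B) * B); [|right; field; lra].
  apply Rmult_le_compat; [lra| |apply Rmin_r|apply HB].
  apply Rsum_ge0, HN. }
assert (Hb0 : forall j, 0 <= b j)
  by (intros j; apply Rmult_le_pos; [apply pos_INR|left; apply Ha]).
assert (Hg' : forall n, bump (7 / 8 + Rsum b n) 8 (3 / 4 - Rsum b n) (g n)).
{ induction n as [|n IH].
  - simpl; replace (7 / 8 + 0) with (7 / 8) by ring;
    replace (3 / 4 - 0) with (3 / 4) by ring; apply bump_tent.
  - cbn [Rsum g]; pose proof (bump_iavg (N n) _ _ _ _ (a n) (Ha n) IH) as Q.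
    replace (7 / 8 + (Rsum b n + b n)) with (7 / 8 + Rsum b n + INR (N n) * a n)
      by (unfold b; ring).
    replace (3 / 4 - (Rsum b n + b n)) with (3 / 4 - Rsum b n - INR (N n) * a n)
      by (unfold b; ring).
    exact Q. }
assert (Hg : forall n, bump 1 8 (5 / 8) (g n)).
{ intros n; destruct (Hg' n) as [G1 [G2 [G3 G4]]]; specialize (Hb n).
  split; [exact G1|split; [exact G2|split]].
  - intros x Hx; apply G3; lra.
  - intros x Hx; apply G4; lra. }
assert (Hsb : summable (fun j => 8 * b j)).
{ apply summable_scal; [lra|apply summable_bound with (/ 8); assumption]. }
destruct (unif_limit_telescope R (fun n => emb (g n)) _ Hsb) as [G [e [He HG]]].
{ intros n x; unfold emb; rewrite <- RtoC_minus, Cmod_R.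
  cbn [g]; apply (iavg_close (N n) _ 8 _ (g n) (a n) x (Ha n) ltac:(lra) (Hg' n)). }
set (chi := fun x => fst (G x)).
assert (Hchi : forall x n, Rabs (chi x - g n x) <= e n).
{ intros x n; eapply Rle_trans; [|apply (HG x n)].
  apply (Cmod_ge_fst (G x - emb (g n) x)%C). }
assert (Hemb : forall x n, Cmod (emb chi x - emb (g n) x)%C <= e n).
{ intros x n; unfold emb; rewrite <- RtoC_minus, Cmod_R; apply Hchi. }
assert (Hlim : forall y z, (forall n, y <= z + e n) -> y <= z).
{ intros y z H; apply Rminus_le, (le_of_lim_0 _ e He); intros n; specialize (H n); lra. }
assert (Hbchi : bump 1 8 (5 / 8) chi).
{ split; [|split; [|split]].
  - intros x y; apply Rminus_le, (le_of_lim_0 _ (fun n => 2 * e n)).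
    + apply lim_0_scal, He.
    + intros n; destruct (Hg n) as [G1 _]; specialize (G1 x y).
      generalize (Hchi x n), (Hchi y n); intros.
      replace (chi x - chi y) with ((chi x - g n x) + (g n x - g n y) - (chi y - g n y)) by ring.
      pose proof (Rabs_triang (chi x - g n x + (g n x - g n y)) (- (chi y - g n y))) as T1.
      pose proof (Rabs_triang (chi x - g n x) (g n x - g n y)).
      rewrite Rabs_Ropp in T1; unfold Rminus at 1; unfold Rminus in *; lra.
  - intros x; split; apply Hlim; intros n; destruct (Hg n) as [_ [G2 _]];
    generalize (G2 x), (Hchi x n); intros Q1 Q2; apply Rabs_le_between in Q2; lra.
  - intros x Hx; apply Rle_antisym; apply Hlim; intros n;
    destruct (Hg n) as [_ [_ [G3 _]]];
    generalize (Hchi x n); intros Q2; rewrite (G3 x Hx) in Q2;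
    apply Rabs_le_between in Q2; lra.
  - intros x Hx; apply Hlim; intros n; destruct (Hg n) as [_ [_ [_ G4]]];
    generalize (G4 x Hx), (Hchi x n); intros Q1 Q2; apply Rabs_le_between in Q2; lra. }
exists chi; split; [exact Hbchi|].
assert (Fb : forall f t, bump 1 8 (5 / 8) f -> Cmod (fourier (emb f) t) <= 1 / PI * 1).
{ intros f t Hf; apply (fourier_bound (emb f) 1 1 t); [lra|apply (cs_emb _ _ _ _ Hf)|].
  intros x; unfold emb; rewrite Cmod_R; apply Rabs_le.
  generalize (proj1 (proj2 Hf) x); lra. }
set (eta := th ^ 2 / 16).
assert (Heta : 0 < eta) by (unfold eta; generalize (pow_lt th 2 Hth); lra).
assert (Dec : forall n t, t <> 0 -> Cmod (fourier (emb (g n)) t) ^ 2 *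
  Rprod (fun j => (1 + eta * (s' j ^ 2 * t ^ 2)) ^ N j) n <= (1 / PI * 1) ^ 2).
{ intros n t Ht; induction n as [|n IH].
  - simpl Rprod; rewrite Rmult_1_r; apply pow_incr; split; [apply Cmod_ge_0|].
    apply (Fb tent t (Hg O)).
  - eapply Rle_trans; [|exact IH]; cbn [g Rprod].
    pose proof (fourier_iavg_decay (N n) 1 8 (5 / 8) (g n) (a n) t
      ltac:(lra) (Ha n) (Hg n) Ht) as Q.
    replace ((a n * t) ^ 2 / 16) with (eta * (s' n ^ 2 * t ^ 2)) in Q
      by (unfold a, eta; field).
    set (P := Rprod _ n).
    assert (HP : 0 <= P).
    { apply Rprod_ge0; intros j; apply pow_le.
      assert (0 <= eta * (s' j ^ 2 * t ^ 2)); [|lra].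
      apply Rmult_le_pos; [lra|apply Rmult_le_pos; apply pow2_ge_0]. }
    rewrite (Rmult_comm P), <- Rmult_assoc.
    apply Rmult_le_compat_r; assumption. }
assert (Hs2 : summable (fun j => s j ^ 2)) by (apply summable_sqr, Hs).
assert (Hs2' : summable (fun j => s' j ^ 2)) by (apply summable_sqr, Hs').
intros K.
(* Exponent [2 * K] because [Dec] bounds the square of the transform. *)
destruct (product_absorb s' N eta (2 * K) Hp) as [D [n0 [HD HPA]]]; auto.
{ destruct (summable_bounded s' Hs') as [B' [_ HB']]; exists B'; intros j.
  eapply Rle_trans; [|apply (HB' (S j))].
  apply Rsum_ge_term; [apply Hs'|lia]. }
set (C0 := sqrt (D * (1 / PI * 1) ^ 2)).
exists (Rmax (1 / PI * 1) C0); intros t.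
(* The decay lemmas divide by a t; at t = 0 the weight is 1 and the trivial bound of the transform
   suffices. *)
destruct (Req_dec t 0) as [Z|Z].
- subst t.
  replace (0 ^ 2) with 0 by ring; rewrite W_0 by exact Hs2.
  rewrite pow1, Rmult_1_r; eapply Rle_trans; [apply Fb, Hbchi|apply Rmax_l].
- apply Rle_trans with C0; [|apply Rmax_r].
  apply Rle_trans with (Cmod (fourier (emb chi) t) * W (fun j => s' j ^ 2) (t ^ 2) ^ K).
  { apply Rmult_le_compat_l; [apply Cmod_ge_0|].
    apply pow_incr; split; [generalize (W_ge1 _ _ Hs2 (pow2_ge_0 t)); lra|].
    apply W_mono_c; auto; [|apply pow2_ge_0].
    intros j; apply pow_incr; split; [apply Hs|].
    unfold s'; generalize (pow_lt (/ 2) j); lra. }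
  set (Wt := W (fun j => s' j ^ 2) (t ^ 2)).
  assert (L1 : is_lim_seq (fun n => PW (fun j => s' j ^ 2) n (t ^ 2)) (Finite Wt))
    by (apply W_lim; [exact Hs2'|apply pow2_ge_0]).
  assert (L2 : is_lim_seq (fun n => PW (fun j => s' j ^ 2) n (t ^ 2) ^ K) (Finite (Wt ^ K))).
  { clear - L1; induction K as [|K IH]; [apply is_lim_seq_const|].
    simpl; apply is_lim_seq_mult'; assumption. }
  assert (L3 : is_lim_seq (fun n => Cmod (fourier (emb (g n)) t))
    (Finite (Cmod (fourier (emb chi) t)))).
  { apply is_lim_seq_spec; intros eps.
    assert (Le : is_lim_seq (fun n => 1 / PI * e n) (Finite 0)) by (apply lim_0_scal, He).
    destruct (lim_0_eps _ eps Le (cond_pos eps)) as [n1 Hn1].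
    exists n1; intros n Hn; eapply Rle_lt_trans; [|apply (Hn1 n Hn)].
    eapply Rle_trans; [apply Cmod_lip|]; rewrite Cmod_minus_sym.
    apply (fourier_unif (emb chi) (fun n => emb (g n)) 1 e t ltac:(lra) He);
      [intros k; apply (cs_emb _ _ _ _ (Hg k))|exact Hemb]. }
  pose proof (is_lim_seq_mult' _ _ _ _ L3 L2) as L4.
  apply (is_lim_seq_le_loc _ (fun _ => C0) (Finite _) (Finite C0)) with (2 := L4);
    [|apply is_lim_seq_const].
  exists n0; intros n Hn.
  set (f := Cmod (fourier (emb (g n)) t)); set (p := PW (fun j => s' j ^ 2) n (t ^ 2)).
  assert (Hp0 : 1 <= p) by (apply PW_ge1; [apply Hs2'|apply pow2_ge_0]).
  assert (Hf0 : 0 <= f) by apply Cmod_ge_0.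
  unfold C0; rewrite <- (sqrt_pow2 (f * p ^ K))
    by (apply Rmult_le_pos; [exact Hf0|apply pow_le; lra]).
  apply sqrt_le_1_alt.
  rewrite Rpow_mult_distr, <- pow_mult, (Nat.mul_comm K 2).
  pose proof (HPA (t ^ 2) n (pow2_ge_0 t) Hn) as Q1.
  pose proof (Dec n t Z) as Q2; fold f in Q2; fold p in Q1.
  set (Pr := Rprod (fun j => (1 + eta * (s' j ^ 2 * t ^ 2)) ^ N j) n) in *.
  apply Rle_trans with (f ^ 2 * (D * Pr)).
  + apply Rmult_le_compat_l; [apply pow2_ge_0|exact Q1].
  + replace (f ^ 2 * (D * Pr)) with (D * (f ^ 2 * Pr)) by ring.
    apply Rmult_le_compat_l; [lra|exact Q2].
Qed.

(* [phi q r] is a fixed mollifier averaged [q] times over intervals of length [1/q]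
   and modulated by [cis (r x)]: at distance [2 e q] from [r], the averages have
   gained a factor [exp (- q)] in the Fourier transform. *)
Lemma test_functions s : summable s -> exists phi : nat -> R -> R -> C,
  (forall q r, (1 <= q)%nat -> cs 2 (phi q r) /\ 1 <= Cmod (phi q r 0)) /\
  forall K, exists C0, 0 < C0 /\ forall q r t, (1 <= q)%nat ->
    Cmod (fourier (phi q r) t) * W (fun j => s j ^ 2) ((t - r) ^ 2) ^ K <= C0 /\
    (2 * exp 1 * INR q <= Rabs (t - r) ->
     Cmod (fourier (phi q r) t) * W (fun j => s j ^ 2) ((t - r) ^ 2) ^ K
       <= C0 * exp (- INR q)).
Proof.
intros Hs; destruct (mollifier s Hs) as [chi [Hchi Hdec]].
assert (Hs2 : summable (fun j => s j ^ 2)) by (apply summable_sqr, Hs).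
(* Half of the interval length 1/q. The [q] averages spend 1/2 in all, so the support lies in
   [-3/2, 3/2] and a plateau of radius 1/8 remains. *)
set (a := fun q => / (2 * INR q)).
exists (fun q r x => (cis (r * x) * emb (iavg q (a q) chi) x)%C).
assert (Hq : forall q, (1 <= q)%nat -> 0 < INR q) by (intros; apply lt_0_INR; lia).
assert (Ha : forall q, (1 <= q)%nat -> 0 < a q).
{ intros q H; apply Rinv_0_lt_compat; generalize (Hq q H); lra. }
assert (Hqa : forall q, (1 <= q)%nat -> INR q * a q = / 2).
{ intros q H; unfold a; field; generalize (Hq q H); lra. }
assert (Hb : forall q, (1 <= q)%nat -> bump (1 + / 2) 8 (5 / 8 - / 2) (iavg q (a q) chi)).
{ intros q H; rewrite <- (Hqa q H); apply bump_iavg; auto. }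
split.
- intros q r H; pose proof (cs_emb _ _ _ _ (Hb q H)) as Hcs; split.
  + apply cs_mono with (1 + / 2); [lra|].
    assert (Q : cs (1 + / 2) (fun x => emb (iavg q (a q) chi) x * cis (- ((- r) * x)))%C)
      by (apply cs_cis, Hcs).
    replace (fun x => (cis (r * x) * emb (iavg q (a q) chi) x)%C)
      with (fun x => (emb (iavg q (a q) chi) x * cis (- ((- r) * x)))%C); [exact Q|].
    apply functional_extensionality; intros x.
    replace (- (- r * x)) with (r * x) by ring; ring.
  + rewrite Rmult_0_r, cis_0, Cmult_1_l; unfold emb; rewrite Cmod_R.
    eapply Rle_trans; [|apply Rle_abs].
    apply (proj2 (proj2 (proj2 (Hb q H)))); rewrite Rabs_R0; lra.
- intros K; destruct (Hdec K) as [C1 HC1].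
  set (C2 := (1 + / 2) / PI * 1).
  assert (HPI : 0 < C2)
    by (unfold C2; generalize PI_RGT_0; intros; rewrite Rmult_1_r; apply Rdiv_lt_0_compat; lra).
  exists (Rmax C1 C2); split; [generalize (Rmax_r C1 C2); lra|].
  intros q r t H.
  rewrite fourier_mod.
  set (x := t - r).
  assert (HW : 1 <= W (fun j => s j ^ 2) (x ^ 2)) by (apply W_ge1; [exact Hs2|apply pow2_ge_0]).
  assert (HWK : 0 <= W (fun j => s j ^ 2) (x ^ 2) ^ K) by (apply pow_le; lra).
  specialize (HC1 x).
  destruct (Req_dec x 0) as [Z|Z].
  + split.
    * rewrite Z; replace (0 ^ 2) with 0 by ring; rewrite W_0 by exact Hs2.
      rewrite pow1, Rmult_1_r; apply Rle_trans with C2; [|apply Rmax_r].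
      apply fourier_bound; [lra|apply (cs_emb _ _ _ _ (Hb q H))|].
      intros y; unfold emb; rewrite Cmod_R; apply Rabs_le.
      generalize (proj1 (proj2 (Hb q H)) y); lra.
    * intros F; rewrite Z, Rabs_R0 in F; generalize (Hq q H), (exp_pos 1); nra.
  + pose proof (fourier_iavg_far q 1 8 (5 / 8) chi (a q) x ltac:(lra) (Ha q H) Hchi Z) as Q.
    set (h := Cmod (fourier (emb chi) x)) in *.
    assert (Hh : 0 <= h) by apply Cmod_ge_0.
    assert (P : 0 < Rabs (a q * x)).
    { apply Rabs_pos_lt, Rmult_integral_contrapositive; split; [generalize (Ha q H); lra|exact Z]. }
    pose proof (Rinv_0_lt_compat _ P) as PI'.
    set (mm := Rmin 1 (/ Rabs (a q * x))) in *.
    assert (Hm : 0 <= mm <= 1) by (split; [apply Rmin_glb; lra|apply Rmin_l]).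
    assert (HC : h * W (fun j => s j ^ 2) (x ^ 2) ^ K <= Rmax C1 C2)
      by (eapply Rle_trans; [exact HC1|apply Rmax_l]).
    split.
    * eapply Rle_trans; [|exact HC]; apply Rmult_le_compat_r; [exact HWK|].
      eapply Rle_trans; [exact Q|].
      rewrite <- (Rmult_1_l h) at 2; apply Rmult_le_compat_r; [exact Hh|].
      rewrite <- (pow1 q); apply pow_incr; exact Hm.
    * intros F.
      (* At distance 2 e q the argument a(q) |x| is at least e, so each average gains a factor
         1/e. *)
      assert (Hme : mm ^ q <= exp (- INR q)).
      { apply Rle_trans with (/ exp 1 ^ q).
        - rewrite <- pow_inv; apply pow_incr; split; [apply Hm|].
          eapply Rle_trans; [apply Rmin_r|].
          apply Rinv_le_contravar; [apply exp_pos|].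
          rewrite Rabs_mult, (Rabs_right (a q)) by (generalize (Ha q H); lra).
          apply Rle_trans with (a q * (2 * exp 1 * INR q)).
          + right; unfold a; field; generalize (Hq q H); lra.
          + apply Rmult_le_compat_l; [left; apply Ha, H|exact F].
        - rewrite exp_pow, Rmult_1_r, exp_Ropp; lra. }
      apply Rle_trans with (mm ^ q * h * W (fun j => s j ^ 2) (x ^ 2) ^ K);
        [apply Rmult_le_compat_r; assumption|].
      rewrite Rmult_assoc, Rmult_comm.
      apply Rmult_le_compat; [apply Rmult_le_pos; assumption|apply pow_le, Hm|exact HC|exact Hme].
Qed.

(** * Dyadic estimates *)

Lemma half_pow k : (/ 2) ^ k * 2 ^ k = 1.
Proof. rewrite <- Rpow_mult_distr, Rinv_l by lra; apply pow1. Qed.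

Lemma dyadic_below x : 0 < x <= 1 -> exists l, (/ 2) ^ l <= x <= 2 * (/ 2) ^ l.
Proof.
intros [H0 H1].
destruct (pow_lt_1_zero (/ 2) ltac:(rewrite Rabs_right; lra) x H0) as [n Hn].
specialize (Hn n (Nat.le_refl n)).
rewrite Rabs_right in Hn by (apply Rle_ge, pow_le; lra).
apply Rlt_le in Hn; induction n as [|n IH].
- exists O; simpl in *; lra.
- destruct (Rle_dec ((/ 2) ^ n) x) as [L|L]; [apply IH, L|].
  exists (S n); simpl in *; lra.
Qed.

(** Rounding down loses at most a factor 2, hence the 4 in [U]. Values above 1 are lowered to 1 so
    that the exponents stay natural numbers, which costs B^2; a zero stays zero. *)
Lemma dyadic_rounding u : summable u -> exists (v : nat -> R) (l : nat -> nat) (U : nat),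
  (1 <= U)%nat /\
  (forall j, 0 <= v j <= u j) /\ (forall j, u j ^ 2 <= INR U * v j ^ 2) /\
  forall j, v j = 0 \/ v j = (/ 2) ^ l j.
Proof.
intros Hu; destruct (summable_bounded u Hu) as [B [HB0 HB]].
assert (HuB : forall j, u j <= B).
{ intros j; eapply Rle_trans; [|apply (HB (S j))].
  apply Rsum_ge_term; [apply Hu|lia]. }
destruct (nfloor_ex (B ^ 2) (pow2_ge_0 B)) as [U0 HU0].
set (U := (U0 + 4)%nat).
assert (HU4 : 4 <= INR U) by (unfold U; rewrite plus_INR; simpl; generalize (pos_INR U0); lra).
assert (HUB : B ^ 2 <= INR U) by (unfold U; rewrite plus_INR; simpl; simpl in HU0; lra).
assert (Q : forall j, exists p : R * nat, 0 <= fst p <= u j /\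
  u j ^ 2 <= INR U * fst p ^ 2 /\ (fst p = 0 \/ fst p = (/ 2) ^ snd p)).
{ intros j; pose proof (proj1 Hu j) as Hj.
  destruct (Rle_lt_or_eq_dec _ _ Hj) as [L|E].
  - destruct (Rle_dec (u j) 1) as [L1|L1].
    + destruct (dyadic_below (u j) (conj L L1)) as [l [H1 H2]].
      exists ((/ 2) ^ l, l); simpl fst; simpl snd.
      split; [lra|split; [|right; reflexivity]].
      apply Rle_trans with ((2 * (/ 2) ^ l) ^ 2); [apply pow_incr; lra|].
      rewrite Rpow_mult_distr; apply Rmult_le_compat_r; [apply pow2_ge_0|lra].
    + exists (1, O); simpl fst; simpl snd; split; [lra|split; [|right; reflexivity]].
      rewrite pow1, Rmult_1_r; apply Rle_trans with (B ^ 2); [|exact HUB].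
      apply pow_incr; split; [lra|apply HuB].
  - exists (0, O); simpl fst; split; [lra|split; [|left; reflexivity]].
    rewrite <- E; lra. }
apply functional_choice in Q; destruct Q as [p Hp].
exists (fun j => fst (p j)), (fun j => snd (p j)), U; repeat split; try apply Hp.
unfold U; lia.
Qed.

(* [dtail i] is the sum of [dgam j] over [j >= i]; in particular the total is 12. *)
Definition dgam (i : nat) : R := (INR i + 1) ^ 2 * (/ 2) ^ i.
Definition dtail (i : nat) : R := (2 * INR i ^ 2 + 8 * INR i + 12) * (/ 2) ^ i.
(** The distance |k - l|: one of the truncated differences is 0. *)
Definition ndist (k l : nat) : nat := ((k - l) + (l - k))%nat.

Lemma dtail_step i : dtail i = dgam i + dtail (S i).
Proof. unfold dtail, dgam; rewrite S_INR; simpl; field. Qed.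

Lemma dtail_ge0 i : 0 <= dtail i.
Proof.
apply Rmult_le_pos; [|apply pow_le; lra].
generalize (pos_INR i), (pow2_ge_0 (INR i)); lra.
Qed.

(** The sums on either side of l telescope through [dtail], each to at most 12. *)
Lemma sum_dgam l K : Rsum (fun k => dgam (ndist k l)) K <= 24.
Proof.
assert (A : forall K, (K <= l)%nat ->
  Rsum (fun k => dgam (ndist k l)) K <= dtail (S l - K) - dtail (S l)).
{ induction K0 as [|m IH]; intros H; [simpl; lra|].
  cbn [Rsum]; specialize (IH ltac:(lia)).
  replace (S l - m)%nat with (S (l - m)) in IH by lia.
  replace (S l - S m)%nat with (l - m)%nat by lia.
  rewrite (dtail_step (l - m)).
  replace (ndist m l) with (l - m)%nat by (unfold ndist; lia); lra. }
assert (D0 : dtail 0 = 12) by (unfold dtail; simpl; ring).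
destruct (Nat.le_gt_cases K l) as [H|H].
- specialize (A K H); generalize (dtail_ge0 (S l)); intros.
  assert (M : forall i, dtail i <= 12).
  { induction i as [|i IH]; [lra|].
    rewrite dtail_step in IH.
    assert (0 <= dgam i) by (apply Rmult_le_pos; [apply pow2_ge_0|apply pow_le; lra]); lra. }
  generalize (M (S l - K)%nat); lra.
- assert (Q : forall m, Rsum (fun k => dgam (ndist k l)) (l + m) <= 24 - dtail m).
  { induction m as [|m IH].
    - rewrite Nat.add_0_r; specialize (A l (Nat.le_refl l)).
      replace (S l - l)%nat with 1%nat in A by lia.
      generalize (dtail_ge0 (S l)), (dtail_step 0); intros.
      assert (0 <= dgam 0) by (unfold dgam; simpl; lra); lra.
    - rewrite Nat.add_succ_r; cbn [Rsum]; rewrite (dtail_step m) in IH.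
      replace (ndist (l + m) l) with m by (unfold ndist; lia); lra. }
  specialize (Q (K - l)%nat); replace (l + (K - l))%nat with K in Q by lia.
  generalize (dtail_ge0 (K - l)); lra.
Qed.

(** Models the positive part of ln (2^k / (A ln |rho(2^k)|^2)); slow variation lets its value at k
    be compared with the value at the level of a given factor. *)
Definition slow (om : nat -> R) : Prop :=
  (forall k, 0 <= om k) /\ forall k, Rabs (om (S k) - om k) <= 1.

Lemma slow_dist om k l : slow om -> om k <= om l + INR (ndist k l).
Proof.
intros [_ H].
assert (A : forall m d, Rabs (om (m + d)%nat - om m) <= INR d).
{ intros m d; induction d as [|d IH].
  - rewrite Nat.add_0_r, Rminus_diag, Rabs_R0; simpl; lra.
  - rewrite Nat.add_succ_r, S_INR.
    replace (om (S (m + d)) - om m)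
      with ((om (S (m + d)) - om (m + d)%nat) + (om (m + d)%nat - om m)) by ring.
    eapply Rle_trans; [apply Rabs_triang|]; generalize (H (m + d)%nat); lra. }
destruct (Nat.le_gt_cases l k) as [L|L].
- pose proof (A l (k - l)%nat) as Q; replace (l + (k - l))%nat with k in Q by lia.
  replace (ndist k l) with (k - l)%nat by (unfold ndist; lia).
  apply Rabs_le_between in Q; lra.
- pose proof (A k (l - k)%nat) as Q; replace (k + (l - k))%nat with l in Q by lia.
  replace (ndist k l) with (l - k)%nat by (unfold ndist; lia).
  apply Rabs_le_between in Q; lra.
Qed.

Lemma ln_le_minus1 z : 0 < z -> ln z <= z - 1.
Proof.
intros H; generalize (exp_ineq1_le (ln z)); rewrite exp_ln by exact H; lra.
Qed.

Lemma ln_le_mono x y : 0 < x -> x <= y -> ln x <= ln y.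
Proof.
intros H [L|E]; [left; apply ln_increasing; assumption|rewrite E; lra].
Qed.

Lemma ln_pow_nat x n : 0 < x -> ln (x ^ n) = INR n * ln x.
Proof.
intros H; induction n as [|n IH]; [simpl; rewrite ln_1; ring|].
rewrite S_INR; simpl; rewrite ln_mult, IH; [ring|exact H|apply pow_lt, H].
Qed.

Lemma ln2_le1 : ln 2 <= 1.
Proof. generalize (ln_le_minus1 2); lra. Qed.

(** Put i = |k - l|. For l <= k the logarithm is ln (1 + 4^i) <= 2 (i + 1) and 2^(-k) = 2^(-l)
    2^(-i). For l > k it is at most 4^(-i), which outweighs 2^(-k) = 2^(-l) 2^i. *)
Lemma ln_term k l :
  (/ 2) ^ k * ln (1 + 4 ^ k * ((/ 2) ^ l) ^ 2)
  <= (/ 2) ^ l * (2 * (INR (ndist k l) + 1) * (/ 2) ^ ndist k l).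
Proof.
assert (P : forall n, 0 < (/ 2) ^ n) by (intros; apply pow_lt; lra).
assert (Q : forall n, 0 < 4 ^ n) by (intros; apply pow_lt; lra).
assert (Sq : forall n, ((/ 2) ^ n) ^ 2 * 4 ^ n = 1).
{ intros n; replace (4 ^ n) with ((2 ^ n) ^ 2).
  - rewrite <- Rpow_mult_distr, half_pow; ring.
  - replace 4 with (2 * 2) by ring; rewrite Rpow_mult_distr; ring. }
destruct (Nat.le_gt_cases l k) as [L|L].
- replace (ndist k l) with (k - l)%nat by (unfold ndist; lia).
  set (i := (k - l)%nat); replace k with (l + i)%nat by (unfold i; lia).
  rewrite !pow_add, (Rmult_assoc ((/ 2) ^ l)).
  replace (4 ^ l * 4 ^ i * ((/ 2) ^ l) ^ 2) with (4 ^ i)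
    by (rewrite <- (Rmult_1_r (4 ^ i)) at 1; rewrite <- (Sq l); ring).
  rewrite (Rmult_comm ((/ 2) ^ i)).
  apply Rmult_le_compat_l; [left; apply P|].
  apply Rmult_le_compat_r; [left; apply P|].
  apply Rle_trans with (ln (4 ^ S i)).
  + apply ln_le_mono; [generalize (Q i); lra|].
    simpl; assert (1 <= 4 ^ i) by (apply pow_R1_Rle; lra); lra.
  + rewrite ln_pow_nat, S_INR by lra.
    replace 4 with (2 * 2) by ring; rewrite ln_mult by lra.
    generalize ln2_le1, (pos_INR i); intros; nra.
- replace (ndist k l) with (l - k)%nat by (unfold ndist; lia).
  set (i := (l - k)%nat); replace l with (k + i)%nat by (unfold i; lia).
  rewrite !pow_add, Rpow_mult_distr.
  replace (4 ^ k * (((/ 2) ^ k) ^ 2 * ((/ 2) ^ i) ^ 2)) with (((/ 2) ^ i) ^ 2)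
    by (rewrite <- Rmult_assoc, (Rmult_comm (4 ^ k)), Sq; ring).
  rewrite (Rmult_assoc ((/ 2) ^ k)); apply Rmult_le_compat_l; [left; apply P|].
  eapply Rle_trans; [apply ln_le_minus1; generalize (pow2_ge_0 ((/ 2) ^ i)); lra|].
  set (h := (/ 2) ^ i) in *; pose proof (P i) as Hh; fold h in Hh.
  generalize (pos_INR i); intros.
  simpl; nra.
Qed.

(** With i = |k - l|, one factor i + 1 of [dgam] comes from [ln_term], the other from om k <= om l +
    i <= (om l + 1)(i + 1); 48 is 2 times the 24 of [sum_dgam]. *)
Lemma weighted_log_term om v l K : slow om -> v = 0 \/ v = (/ 2) ^ l ->
  Rsum (fun k => (/ 2) ^ k * om k * ln (1 + 4 ^ k * v ^ 2)) K <= 48 * (v * (om l + 1)).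
Proof.
intros Hom [->| ->].
- right; rewrite (Rsum_ext _ (fun _ => 0)), Rsum_0; [ring|].
  intros k _; replace (1 + 4 ^ k * 0 ^ 2) with 1 by ring; rewrite ln_1; ring.
- assert (Hl : 0 <= om l) by apply Hom.
  assert (P : forall n, 0 < (/ 2) ^ n) by (intros; apply pow_lt; lra).
  apply Rle_trans with (Rsum (fun k => ((/ 2) ^ l * (om l + 1) * 2) * dgam (ndist k l)) K).
  + apply Rsum_le; intros k _.
    pose proof (slow_dist om k l Hom) as Q1.
    pose proof (ln_term k l) as Q2.
    pose proof (pos_INR (ndist k l)) as Q3.
    assert (Q4 : 0 <= ln (1 + 4 ^ k * ((/ 2) ^ l) ^ 2)).
    { rewrite <- ln_1; apply ln_le_mono; [lra|].
      generalize (pow_lt 4 k ltac:(lra)), (pow2_ge_0 ((/ 2) ^ l)); intros; nra. }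
    assert (Q5 : 0 <= om k) by apply Hom.
    unfold dgam; set (i := INR (ndist k l)) in *.
    replace ((/ 2) ^ k * om k * ln (1 + 4 ^ k * ((/ 2) ^ l) ^ 2))
      with (((/ 2) ^ k * ln (1 + 4 ^ k * ((/ 2) ^ l) ^ 2)) * om k) by ring.
    replace ((/ 2) ^ l * (om l + 1) * 2 * ((i + 1) ^ 2 * (/ 2) ^ ndist k l))
      with (((/ 2) ^ l * (2 * (i + 1) * (/ 2) ^ ndist k l)) * ((om l + 1) * (i + 1))) by ring.
    apply Rmult_le_compat; [|exact Q5|exact Q2|nra].
    apply Rmult_le_pos; [left; apply P|exact Q4].
  + rewrite Rsum_scal.
    replace (48 * ((/ 2) ^ l * (om l + 1))) with ((/ 2) ^ l * (om l + 1) * 2 * 24) by ring.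
    apply Rmult_le_compat_l; [|apply sum_dgam].
    repeat apply Rmult_le_pos; try lra; left; apply P.
Qed.

Lemma ln_scale_le (U : nat) x y : (1 <= U)%nat -> 0 <= x -> 0 <= y -> y <= INR U * x ->
  ln (1 + y) <= INR U * ln (1 + x).
Proof.
intros HU Hx Hy H; rewrite <- ln_pow_nat by lra.
apply ln_le_mono; [lra|].
destruct (Rle_lt_or_eq_dec _ _ Hx) as [L|E].
- apply Rle_trans with (1 + INR U * x); [lra|apply poly, L].
- subst x; rewrite Rplus_0_r, pow1; lra.
Qed.

(** The left side is a dyadic discretisation of the integral. Exchanging levels and factors leaves
    for each j only the weight at its own level l_j; the rounding loss U comes out of the logarithm
    by Bernoulli. *)
Lemma weighted_log_sum u v l U om n K :
  (1 <= U)%nat -> (forall j, u j ^ 2 <= INR U * v j ^ 2) ->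
  (forall j, v j = 0 \/ v j = (/ 2) ^ l j) -> slow om ->
  Rsum (fun k => (/ 2) ^ k * om k * ln (PW (fun j => u j ^ 2) n (4 ^ k))) K
  <= INR U * (48 * Rsum (fun j => v j * (om (l j) + 1)) n).
Proof.
intros HU Huv Hv Hom.
assert (P : forall n, 0 < (/ 2) ^ n) by (intros; apply pow_lt; lra).
assert (Q : forall n, 0 < 4 ^ n) by (intros; apply pow_lt; lra).
apply Rle_trans with (Rsum (fun k => Rsum (fun j =>
  INR U * ((/ 2) ^ k * om k * ln (1 + 4 ^ k * v j ^ 2))) n) K).
- apply Rsum_le; intros k _.
  unfold PW; rewrite Rprod_ln.
  + rewrite <- Rsum_scal; apply Rsum_le; intros j _.
    replace (INR U * ((/ 2) ^ k * om k * ln (1 + 4 ^ k * v j ^ 2)))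
      with ((/ 2) ^ k * om k * (INR U * ln (1 + 4 ^ k * v j ^ 2))) by ring.
    apply Rmult_le_compat_l.
    * apply Rmult_le_pos; [left; apply P|apply Hom].
    * apply ln_scale_le; [exact HU| | |].
      -- apply Rmult_le_pos; [left; apply Q|apply pow2_ge_0].
      -- apply Rmult_le_pos; [apply pow2_ge_0|left; apply Q].
      -- replace (INR U * (4 ^ k * v j ^ 2)) with (INR U * v j ^ 2 * 4 ^ k) by ring.
         apply Rmult_le_compat_r; [left; apply Q|apply Huv].
  + intros j; generalize (Rmult_le_pos _ _ (pow2_ge_0 (u j)) (Rlt_le _ _ (Q k))); lra.
- rewrite Rsum_exchange, <- !Rsum_scal; apply Rsum_le; intros j _.
  rewrite Rsum_scal; apply Rmult_le_compat_l; [apply pos_INR|].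
  apply weighted_log_term; auto.
Qed.

Lemma is_lim_seq_ln (a : nat -> R) l : 0 < l -> is_lim_seq a (Finite l) ->
  is_lim_seq (fun n => ln (a n)) (Finite (ln l)).
Proof.
intros Hl H; apply is_lim_seq_continuous; [|exact H].
apply derivable_continuous_pt; exists (/ l); apply derivable_pt_lim_ln, Hl.
Qed.

Lemma weighted_log_sum_W u a K B : summable u ->
  (forall n, Rsum (fun k => a k * ln (PW (fun j => u j ^ 2) n (4 ^ k))) K <= B) ->
  Rsum (fun k => a k * ln (W (fun j => u j ^ 2) (4 ^ k))) K <= B.
Proof.
intros Hu H; pose proof (summable_sqr u Hu) as Hs.
assert (L : is_lim_seq
  (fun n => Rsum (fun k => a k * ln (PW (fun j => u j ^ 2) n (4 ^ k))) K)
  (Finite (Rsum (fun k => a k * ln (W (fun j => u j ^ 2) (4 ^ k))) K))).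
{ clear H; induction K as [|K IH]; [apply is_lim_seq_const|].
  cbn [Rsum]; apply is_lim_seq_plus'; [exact IH|].
  apply is_lim_seq_mult'; [apply is_lim_seq_const|].
  assert (P : 0 <= 4 ^ K) by (apply pow_le; lra).
  apply is_lim_seq_ln; [generalize (W_ge1 _ _ Hs P); lra|apply W_lim; assumption]. }
exact (is_lim_seq_le _ _ (Finite _) (Finite _) H L (is_lim_seq_const B)).
Qed.

(** * The necessary condition for invertibility *)

Definition at_level (v : nat -> R) (k j : nat) : R :=
  if Req_EM_T (v j) ((/ 2) ^ k) then 1 else 0.

(** The multiplicity of the zero i 2^k in the product of the first n factors 1 + v_j^2 z^2, as a
    real number. *)
Definition cnt (v : nat -> R) (k n : nat) : R := Rsum (at_level v k) n.

Lemma at_level_ge0 v k j : 0 <= at_level v k j.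
Proof. unfold at_level; destruct (Req_EM_T _ _); lra. Qed.

Lemma cnt_ge0 v k n : 0 <= cnt v k n.
Proof. apply Rsum_ge0, at_level_ge0. Qed.

Lemma Cmod_factor c t : Cmod (1 + RtoC c * ((Ci * RtoC t) * (Ci * RtoC t)))%C
  = Rabs (1 - c * t ^ 2).
Proof.
rewrite <- Cmod_R; f_equal; apply injective_projections; simpl; ring.
Qed.

(** Each factor of level k among the first n is at most [th]; all others are at most 1 + v_j^2 t^2.
    The power th^cnt is written as an exponential because [cnt] is real, and n stays fixed while m
    goes to infinity. *)
Lemma pz_near v k t th n m : (forall j, 0 <= v j) -> 0 < th <= 1 ->
  Rabs (1 - t ^ 2 * ((/ 2) ^ k) ^ 2) <= th -> (n <= m)%nat ->
  Cmod (pz (fun j => (v j ^ 2)%R) m (Ci * RtoC t)%C)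
  <= exp (ln th * cnt v k n) * PW (fun j => v j ^ 2) m (t ^ 2).
Proof.
intros Hv Hth Hnear Hnm.
assert (F1 : forall j, Rabs (1 - v j ^ 2 * t ^ 2) <= 1 + v j ^ 2 * t ^ 2).
{ intros j; generalize (Rmult_le_pos _ _ (pow2_ge_0 (v j)) (pow2_ge_0 t)); intros.
  apply Rabs_le; lra. }
assert (S : forall i, Cmod (pz (fun j => (v j ^ 2)%R) (S i) (Ci * RtoC t)%C)
  = Cmod (pz (fun j => (v j ^ 2)%R) i (Ci * RtoC t)%C) * Rabs (1 - v i ^ 2 * t ^ 2)).
{ intros i; unfold pz; cbn [Cprod]; rewrite Cmod_mult, Cmod_factor; reflexivity. }
induction Hnm as [|m Hnm IH].
- induction n as [|n IH].
  + unfold pz, PW, cnt; simpl; rewrite Rmult_0_r, exp_0, Cmod_1; lra.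
  + rewrite S, PW_S; unfold cnt; cbn [Rsum]; fold (cnt v k n).
    rewrite Rmult_plus_distr_l, exp_plus.
    replace (exp (ln th * cnt v k n) * exp (ln th * at_level v k n) *
      (PW (fun j => v j ^ 2) n (t ^ 2) * (1 + v n ^ 2 * t ^ 2)))
      with ((exp (ln th * cnt v k n) * PW (fun j => v j ^ 2) n (t ^ 2))
        * (exp (ln th * at_level v k n) * (1 + v n ^ 2 * t ^ 2))) by ring.
    apply Rmult_le_compat; [apply Cmod_ge_0|apply Rabs_pos|exact IH|].
    unfold at_level; destruct (Req_EM_T (v n) ((/ 2) ^ k)) as [E|E].
    * rewrite Rmult_1_r, exp_ln by lra.
      apply Rle_trans with th; [rewrite E, Rmult_comm; exact Hnear|].
      generalize (Rmult_le_pos _ _ (pow2_ge_0 (v n)) (pow2_ge_0 t)); intros; nra.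
    * rewrite Rmult_0_r, exp_0, Rmult_1_l; apply F1.
- rewrite S, PW_S, <- Rmult_assoc.
  apply Rmult_le_compat; [apply Cmod_ge_0|apply Rabs_pos|exact IH|apply F1].
Qed.

(* At [r = 2^k] the symbol has a zero of order [cnt v k m]. If the left side were
   larger, [F] would be so small within [2 e q ~ ln rho(r)] of [i r] that the test
   function [phi q r] violates the hypothesis. *)
Lemma key_estimate (s v : nat -> R) (F : C -> C) (Kc : R) (n : nat) (eps : R) :
  let w := fun t => W (fun j => s j ^ 2) (t ^ 2) in
  summable s -> 0 < s O -> summable v ->
  (forall t, W (fun j => v j ^ 2) (t ^ 2) <= Kc * w t) ->
  (forall z, exists e, is_lim_seq e (Finite 0) /\
     forall n, Cmod (F z - pz (fun j => (v j ^ 2)%R) n z)%C <= e n) ->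
  0 < eps ->
  (forall phi, rap w phi -> cs 2 phi -> 1 <= Cmod (phi 0) ->
     ~ forall t, Cmod (F (Ci * RtoC t) * fourier phi t)%C * w t ^ n <= eps) ->
  exists A C0, 0 < A /\ 0 < C0 /\ forall k m,
    cnt v k m * ln (2 ^ k / (A * ln (W (fun j => s j ^ 2) (4 ^ k))))
    <= C0 * ln (W (fun j => s j ^ 2) (4 ^ k)).
Proof.
intros w Hs Hs0 Hv Hwc HF Heps Hbad.
pose proof (summable_sqr s Hs) as Hs2.
pose proof (summable_sqr v Hv) as Hv2.
assert (Hw : weight w) by (apply weight_W; assumption).
pose proof (proj1 Hw) as Hw1.
assert (HKc : 1 <= Kc * w 0).
{ eapply Rle_trans; [|apply Hwc]; apply W_ge1; [exact Hv2|apply pow2_ge_0]. }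
assert (HKc0 : 0 < Kc) by (specialize (Hw1 0); nra).
destruct (test_functions s Hs) as [phi [Hphi Hdec]].
(* [n] powers of the weight from the hypothesis and one from |F(it)| <= Kc w(t). *)
set (p := (n + 1)%nat).
(* The power p of w(t) <= w(r)^2 w(t - r)^2 asks for decay against w(t - r)^(2p). *)
destruct (Hdec (2 * p)%nat) as [C1 [HC1 HD]].
(* All constants become a summand in the exponent, nonnegative thanks to the absolute value. *)
set (E := Rabs (ln (Kc * C1 / eps))).
assert (HKC : 0 < Kc * C1) by (apply Rmult_lt_0_compat; assumption).
assert (HKCe : 0 < Kc * C1 / eps) by (apply Rdiv_lt_0_compat; assumption).
assert (HE : Kc * C1 <= eps * exp E).
{ replace (Kc * C1) with (eps * exp (ln (Kc * C1 / eps))) by (rewrite exp_ln by exact HKCe; field; lra).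
  apply Rmult_le_compat_l; [lra|apply exp_le_mono, Rle_abs]. }
assert (HE0 : 0 <= E) by apply Rabs_pos.
(* A positive lower bound for every [L] below, so that constants can be absorbed into multiples of
   [L]. *)
set (L0 := ln (W (fun j => s j ^ 2) 1)).
assert (HL0 : 0 < L0).
{ rewrite <- ln_1; apply ln_increasing; [lra|].
  pose proof (W_poly (fun j => s j ^ 2) 1 O Hs2 ltac:(lra)) as Q; cbv beta in Q.
  generalize (pow_lt (s O) 2 Hs0); lra. }
set (A1 := 2 * INR p + (E + 2) / L0).
assert (HEL : 0 <= (E + 2) / L0) by (apply Rmult_le_pos; [lra|left; apply Rinv_0_lt_compat, HL0]).
pose proof (pos_INR p) as Hp0.
assert (HA1 : 0 < A1).
{ unfold A1; assert (0 < (E + 2) / L0) by (apply Rdiv_lt_0_compat; lra); lra. }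
pose proof (exp_pos 1) as He1.
(* For |t - r| <= D = 2 e A1 L and t <= 2 r one has |1 - t^2 / r^2| <= 3 D / r, which is [th]. The 4
   p comes from w(t) <= w(r)^4 on that interval. *)
exists (3 * (2 * exp 1 * A1)), (4 * INR p + E / L0 + 1).
assert (HEL' : 0 <= E / L0) by (apply Rmult_le_pos; [lra|left; apply Rinv_0_lt_compat, HL0]).
split; [repeat apply Rmult_lt_0_compat; lra|split; [lra|]].
intros k m.
set (r := 2 ^ k).
assert (Hr : 0 < r) by (apply pow_lt; lra).
assert (Hr4 : 4 ^ k = r ^ 2).
{ unfold r; rewrite <- pow_mult, Nat.mul_comm, pow_mult; f_equal; ring. }
assert (H4k : 1 <= 4 ^ k) by (apply pow_R1_Rle; lra).
set (L := ln (W (fun j => s j ^ 2) (4 ^ k))).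
assert (HL : L0 <= L).
{ apply ln_le_mono; [generalize (W_ge1 _ 1 Hs2 ltac:(lra)); lra|].
  apply W_mono; [exact Hs2|lra]. }
assert (HwL : w r = exp L).
{ unfold L; rewrite exp_ln; [unfold w; rewrite Hr4; reflexivity|].
  generalize (W_ge1 _ (4 ^ k) Hs2 ltac:(lra)); lra. }
assert (HLE : E <= E / L0 * L).
{ apply Rle_trans with (E / L0 * L0); [right; field; lra|].
  apply Rmult_le_compat_l; assumption. }
set (th := 3 * (2 * exp 1 * A1) * L / r).
assert (Hth0 : 0 < th).
{ apply Rdiv_lt_0_compat; [|exact Hr]; repeat apply Rmult_lt_0_compat; lra. }
replace (r / (3 * (2 * exp 1 * A1) * L)) with (/ th) by (unfold th; field; lra).
rewrite ln_Rinv by exact Hth0.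
pose proof (cnt_ge0 v k m) as Hcnt.
(* For th >= 1 the left side is nonpositive. Otherwise the negated claim makes th^cnt smaller than
   every loss incurred near r. *)
destruct (Rle_dec 1 th) as [T1|T1].
{ assert (0 <= ln th) by (rewrite <- ln_1; apply ln_le_mono; lra); nra. }
apply Rnot_lt_le; intros Hcontra.
(* Then q > 2 p L + E: far from r the gain exp (- q) beats w(r)^(2p) = exp (2 p L) and the
   constants. *)
destruct (nfloor_ex (2 * INR p * L + E + 1)) as [q Hq].
{ assert (0 <= 2 * INR p * L) by (repeat apply Rmult_le_pos; lra); lra. }
assert (Hq1 : (1 <= q)%nat).
{ assert (0 <= 2 * INR p * L) by (repeat apply Rmult_le_pos; lra).
  assert (0 < INR q) by lra; destruct q; [simpl in *; lra|lia]. }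
assert (HqA : INR q <= A1 * L).
{ unfold A1; rewrite Rmult_plus_distr_r.
  assert (E + 2 <= (E + 2) / L0 * L).
  { apply Rle_trans with ((E + 2) / L0 * L0); [right; field; lra|].
    apply Rmult_le_compat_l; assumption. }
  lra. }
set (psi := phi q r).
destruct (Hphi q r Hq1) as [Cpsi Zpsi]; fold psi in Cpsi, Zpsi.
assert (Hadd : forall t, w t <= w r ^ 2 * w (t - r) ^ 2).
{ intros t; unfold w; replace (t ^ 2) with ((r + (t - r)) ^ 2) by (f_equal; ring).
  apply W_add, Hs2. }
assert (Rpsi : rap w psi).
{ split; [exists 2; exact Cpsi|]; intros i.
  destruct (Hdec (2 * i)%nat) as [C2 [HC2 HD2]].
  exists (w r ^ (2 * i) * C2); intros t.
  apply Rle_trans with (Cmod (fourier psi t) * (w r ^ 2 * w (t - r) ^ 2) ^ i).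
  - apply Rmult_le_compat_l; [apply Cmod_ge_0|].
    apply pow_incr; split; [generalize (Hw1 t); lra|apply Hadd].
  - rewrite Rpow_mult_distr, <- !pow_mult.
    replace (Cmod (fourier psi t) * (w r ^ (2 * i) * w (t - r) ^ (2 * i)))
      with (w r ^ (2 * i) * (Cmod (fourier psi t) * w (t - r) ^ (2 * i))) by ring.
    apply Rmult_le_compat_l; [apply pow_le; generalize (Hw1 r); lra|].
    apply (HD2 q r t Hq1). }
apply (Hbad psi Rpsi Cpsi Zpsi); intros t.
rewrite Cmod_mult.
destruct (HD q r t Hq1) as [D1 D2]; fold psi in D1, D2.
change (Cmod (fourier psi t) * w (t - r) ^ (2 * p) <= C1) in D1.
set (f := Cmod (fourier psi t)) in *.
assert (Hf : 0 <= f) by apply Cmod_ge_0.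
assert (Hwt : 1 <= w t) by apply Hw1.
destruct (Rle_dec (2 * exp 1 * INR q) (Rabs (t - r))) as [Far|Near].
- specialize (D2 Far).
  change (f * w (t - r) ^ (2 * p) <= C1 * exp (- INR q)) in D2.
  apply Rle_trans with (Kc * (w r ^ (2 * p) * (f * w (t - r) ^ (2 * p)))).
  + replace (Kc * (w r ^ (2 * p) * (f * w (t - r) ^ (2 * p))))
      with (Kc * f * (w r ^ 2 * w (t - r) ^ 2) ^ p)
      by (rewrite Rpow_mult_distr, <- !pow_mult; ring).
    apply Rle_trans with (Kc * f * w t ^ p).
    * unfold p; rewrite pow_add, pow_1.
      replace (Kc * f * (w t ^ n * w t)) with (Kc * w t * f * w t ^ n) by ring.
      apply Rmult_le_compat_r; [apply pow_le; lra|].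
      apply Rmult_le_compat_r; [exact Hf|].
      apply (symbol_le w (fun j => v j ^ 2) F Kc); assumption.
    * apply Rmult_le_compat_l; [apply Rmult_le_pos; lra|].
      apply pow_incr; split; [lra|apply Hadd].
  + apply Rle_trans with (Kc * (w r ^ (2 * p) * (C1 * exp (- INR q)))).
    * apply Rmult_le_compat_l; [lra|].
      apply Rmult_le_compat_l; [apply pow_le; generalize (Hw1 r); lra|exact D2].
    * rewrite HwL, exp_pow, mult_INR.
      replace (Kc * (exp (INR 2 * INR p * L) * (C1 * exp (- INR q))))
        with (Kc * C1 * (exp (INR 2 * INR p * L) * exp (- INR q))) by ring.
      rewrite <- exp_plus.
      apply Rle_trans with (Kc * C1 * exp (- E)).
      -- apply Rmult_le_compat_l; [lra|apply exp_le_mono]; simpl; lra.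
      -- apply Rle_trans with (eps * exp E * exp (- E)).
         ++ apply Rmult_le_compat_r; [left; apply exp_pos|exact HE].
         ++ rewrite Rmult_assoc, <- exp_plus, Rplus_opp_r, exp_0; lra.
- apply Rnot_le_lt in Near.
  assert (HA : Rabs (t - r) <= 2 * exp 1 * A1 * L).
  { apply Rle_trans with (2 * exp 1 * INR q); [lra|].
    rewrite (Rmult_assoc (2 * exp 1)); apply Rmult_le_compat_l; [lra|exact HqA]. }
  set (D := 2 * exp 1 * A1 * L) in *.
  assert (HthD : th * r = 3 * D) by (unfold th, D; field; lra).
  assert (HDr : 3 * D < r) by (rewrite <- HthD; nra).
  apply Rabs_le_between in HA.
  assert (Hnear : Rabs (1 - t ^ 2 * ((/ 2) ^ k) ^ 2) <= th).
  { replace (((/ 2) ^ k) ^ 2) with (/ r ^ 2)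
      by (unfold r; rewrite pow_inv, <- pow_inv; reflexivity).
    replace (1 - t ^ 2 * / r ^ 2) with ((r - t) * (r + t) / r ^ 2) by (field; lra).
    assert (Hr2 : 0 < r ^ 2) by (apply pow_lt, Hr).
    unfold Rdiv; rewrite Rabs_mult, (Rabs_right (/ _))
      by (left; apply Rinv_0_lt_compat, Hr2).
    apply Rmult_le_reg_r with (r ^ 2); [exact Hr2|].
    rewrite Rmult_assoc, Rinv_l, Rmult_1_r by lra.
    replace (th * r ^ 2) with (3 * D * r) by (rewrite <- HthD; ring).
    rewrite Rabs_mult; replace (3 * D * r) with (D * (3 * r)) by ring.
    apply Rmult_le_compat; try apply Rabs_pos; apply Rabs_le; lra. }
  (* As 3 D < r, t lies in (0, 2r), and the doubling bound [W_4] applies. *)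
  assert (Hwt4 : w t <= exp (4 * L)).
  { apply Rle_trans with (W (fun j => s j ^ 2) (4 * r ^ 2)).
    - apply W_mono; [exact Hs2|split; [apply pow2_ge_0|]].
      replace (4 * r ^ 2) with ((2 * r) ^ 2) by ring; apply pow_incr; lra.
    - eapply Rle_trans; [apply W_4; [exact Hs2|apply pow2_ge_0]|].
      fold (w r); rewrite HwL, exp_pow; simpl; right; f_equal; ring. }
  set (X := exp (ln th * cnt v k m)).
  assert (HX : 0 < X) by apply exp_pos.
  assert (HFX : Cmod (F (Ci * RtoC t)%C) <= X * (Kc * w t)).
  { destruct (HF (Ci * RtoC t)%C) as [e [He H]].
    apply Rminus_le, (lim_0_ge_N _ e m He); intros i Hi.
    pose proof (Cmod_le_sub (F (Ci * RtoC t)%C)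
      (pz (fun j => (v j ^ 2)%R) i (Ci * RtoC t)%C)) as T.
    pose proof (pz_near v k t th m i (proj1 Hv) ltac:(lra) Hnear Hi) as Q.
    fold X in Q.
    assert (X * PW (fun j => v j ^ 2) i (t ^ 2) <= X * (Kc * w t)).
    { apply Rmult_le_compat_l; [lra|].
      eapply Rle_trans; [apply PW_le_W; [exact Hv2|apply pow2_ge_0]|apply Hwc]. }
    specialize (H i); lra. }
  assert (HfC : f <= C1).
  { eapply Rle_trans; [|exact D1]; rewrite <- (Rmult_1_r f) at 1.
    apply Rmult_le_compat_l; [exact Hf|apply pow_R1_Rle, Hw1]. }
  apply Rle_trans with (X * (Kc * w t) * C1 * w t ^ n).
  + apply Rmult_le_compat_r; [apply pow_le; lra|].
    apply Rmult_le_compat; [apply Cmod_ge_0|exact Hf|exact HFX|exact HfC].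
  + replace (X * (Kc * w t) * C1 * w t ^ n) with (X * (Kc * C1) * w t ^ p)
      by (unfold p; rewrite pow_add, pow_1; ring).
    apply Rle_trans with (X * (eps * exp E) * exp (INR p * (4 * L))).
    * apply Rmult_le_compat.
      -- apply Rmult_le_pos; lra.
      -- apply pow_le; lra.
      -- apply Rmult_le_compat_l; lra.
      -- apply Rle_trans with (exp (4 * L) ^ p); [apply pow_incr; lra|].
         rewrite exp_pow; lra.
    * replace (X * (eps * exp E) * exp (INR p * (4 * L)))
        with (eps * (X * (exp E * exp (INR p * (4 * L))))) by ring.
      unfold X; rewrite <- !exp_plus.
      rewrite <- (Rmult_1_r eps) at 2; apply Rmult_le_compat_l; [lra|].
      rewrite <- exp_0; apply exp_le_mono.
      lra.
Qed.

(** * The integral condition *)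

Lemma pz_real c n t : pz c n (RtoC t) = RtoC (PW c n (t ^ 2)).
Proof.
induction n as [|n IH]; [reflexivity|].
rewrite PW_S, RtoC_mult, <- IH; unfold pz; cbn [Cprod]; f_equal.
apply injective_projections; simpl; ring.
Qed.

(** [PW c n (t ^ 2)] is [pz c n] at a real point, so the Lipschitz bound [pz_lip], uniform in n,
    passes to the limit. *)
Lemma W_continuous c t : summable c -> continuous (fun t => W c (t ^ 2)) t.
Proof.
intros Hc; apply continuity_pt_filterlim; intros eps He.
destruct (summable_bounded c Hc) as [B [HB0 HB]].
set (Rad := Rabs t + 1).
assert (HRad : 1 <= Rad) by (unfold Rad; generalize (Rabs_pos t); lra).
set (K := W c (Rad ^ 2) * (2 * Rad * B)).
assert (HW : 1 <= W c (Rad ^ 2)) by (apply W_ge1; [exact Hc|apply pow2_ge_0]).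
assert (HK : 0 < K) by (unfold K; repeat apply Rmult_lt_0_compat; lra).
assert (Lip : forall y, Rabs y <= Rad -> Rabs (W c (y ^ 2) - W c (t ^ 2)) <= K * Rabs (y - t)).
{ intros y Hy.
  pose proof (W_lim c _ Hc (pow2_ge_0 y)) as L1.
  pose proof (W_lim c _ Hc (pow2_ge_0 t)) as L2.
  pose proof (is_lim_seq_abs _ _ (is_lim_seq_minus' _ _ _ _ L1 L2)) as L3.
  refine (is_lim_seq_le _ (fun _ => K * Rabs (y - t)) (Finite _) (Finite _) _ L3
    (is_lim_seq_const _)).
  intros n.
  pose proof (pz_lip c Rad (RtoC t) (RtoC y) Hc) as Q.
  specialize (Q ltac:(rewrite Cmod_R; unfold Rad; lra) ltac:(rewrite Cmod_R; exact Hy) n).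
  rewrite !pz_real, <- !RtoC_minus, !Cmod_R in Q.
  eapply Rle_trans; [exact Q|].
  apply Rmult_le_compat_r; [apply Rabs_pos|].
  apply Rmult_le_compat.
  - generalize (PW_ge1 c n (Rad ^ 2) (proj1 Hc) (pow2_ge_0 Rad)); lra.
  - apply Rmult_le_pos; [lra|apply Rsum_ge0, Hc].
  - apply PW_le_W; [exact Hc|apply pow2_ge_0].
  - apply Rmult_le_compat_l; [lra|apply HB]. }
exists (Rmin 1 (eps / K)); split.
- apply Rmin_glb_lt; [lra|apply Rdiv_lt_0_compat; lra].
- intros y0 [_ Hy]; pose (y := y0 : R); change (Rabs (y - t) < Rmin 1 (eps / K)) in Hy.
  change (Rabs (W c (y ^ 2) - W c (t ^ 2)) < eps). clearbody y.
  assert (Rabs (y - t) < 1) by (eapply Rlt_le_trans; [exact Hy|apply Rmin_l]).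
  assert (Rabs (y - t) < eps / K) by (eapply Rlt_le_trans; [exact Hy|apply Rmin_r]).
  eapply Rle_lt_trans; [apply Lip|].
  + unfold Rad; generalize (Rabs_triang (y - t) t); replace (y - t + t) with y by ring; lra.
  + replace eps with (K * (eps / K)) by (field; lra).
    apply Rmult_lt_compat_l; assumption.
Qed.

Lemma continuous_ln x : 0 < x -> continuous ln x.
Proof.
intros Hx; apply continuity_pt_filterlim, derivable_continuous_pt.
exists (/ x); apply derivable_pt_lim_ln, Hx.
Qed.

Lemma Rmax0_lip a b : Rabs (Rmax 0 a - Rmax 0 b) <= Rabs (a - b).
Proof.
unfold Rmax; repeat destruct (Rle_dec _ _); unfold Rabs; repeat destruct (Rcase_abs _); lra.
Qed.

Lemma entropy_le x y : 0 < x -> 0 < y -> x * ln (/ x) <= x * ln (/ y) + y.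
Proof.
intros Hx Hy.
assert (E : ln (/ x) = ln (/ y) + ln (y / x)).
{ unfold Rdiv; rewrite ln_mult, !ln_Rinv by (try apply Rinv_0_lt_compat; assumption); ring. }
rewrite E.
assert (Q : ln (y / x) <= y / x - 1) by (apply ln_le_minus1, Rdiv_lt_0_compat; assumption).
assert (x * ln (y / x) <= x * (y / x - 1)) by (apply Rmult_le_compat_l; lra).
replace (x * (y / x - 1)) with (y - x) in H by (field; lra); lra.
Qed.

Section Integral.

Variables (omega : C -> C) (u s v : nat -> R) (l : nat -> nat) (U : nat) (A C0 : R).
Hypothesis Hu : summable u.
Hypothesis Hu0 : 0 < u O.
Hypothesis Homega : forall t : R,
  Cmod (omega (RtoC t)) ^ 2 = W (fun j => u j ^ 2) (t ^ 2).
Hypothesis Hs : summable s.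
Hypothesis Hs0 : 0 < s O.
Hypothesis HU : (1 <= U)%nat.
Hypothesis Hvu : forall j, 0 <= v j <= u j.
Hypothesis Huv : forall j, u j ^ 2 <= INR U * v j ^ 2.
Hypothesis Hvl : forall j, v j = 0 \/ v j = (/ 2) ^ l j.
Hypothesis HA : 0 < A.
Hypothesis HC0 : 0 < C0.

(** With [s] the sequence of rho this is 2 ln |rho(2^k)|. *)
Let Lw k := ln (W (fun j => s j ^ 2) (4 ^ k)).

Hypothesis Hkey : forall k m, cnt v k m * ln (2 ^ k / (A * Lw k)) <= C0 * Lw k.

(** Where the logarithm is negative, the bound [Hkey] remains true with 0 in its place. *)
Let om k := Rmax 0 (ln (2 ^ k / (A * Lw k))).

Local Lemma pow4_pos k : 0 < 4 ^ k.
Proof. apply pow_lt; lra. Qed.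

Local Lemma pow2_pos k : 0 < 2 ^ k.
Proof. apply pow_lt; lra. Qed.

Local Lemma powh_pos k : 0 < (/ 2) ^ k.
Proof. apply pow_lt; lra. Qed.

Local Lemma lnW_pos r x : summable r -> 0 < r O -> 0 < x ->
  0 < ln (W (fun j => r j ^ 2) x).
Proof.
intros Hr Hr0 Hx; rewrite <- ln_1; apply ln_increasing; [lra|].
pose proof (W_poly (fun j => r j ^ 2) x O (summable_sqr r Hr) ltac:(lra)) as Q.
cbv beta in Q; generalize (Rmult_lt_0_compat _ _ (pow_lt (r O) 2 Hr0) Hx); lra.
Qed.

Local Lemma Lw_pos k : 0 < Lw k.
Proof. apply lnW_pos; auto; apply pow4_pos. Qed.

Local Lemma lnW_4 r x : summable r -> 0 < r O -> 0 < x ->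
  ln (W (fun j => r j ^ 2) (4 * x)) <= 4 * ln (W (fun j => r j ^ 2) x).
Proof.
intros Hr Hr0 Hx; pose proof (summable_sqr r Hr) as Hr2.
pose proof (W_ge1 _ x Hr2 ltac:(lra)).
pose proof (W_ge1 _ (4 * x) Hr2 ltac:(lra)).
replace 4 with (INR 4) at 2 by (simpl; ring).
rewrite <- ln_pow_nat by lra.
apply ln_le_mono; [lra|apply W_4; [exact Hr2|lra]].
Qed.

(** By monotonicity and doubling, Lw (k + 1) lies between Lw k and 4 Lw k; the logarithm thus
    changes by a number in [- ln 2, ln 2], and ln 2 <= 1. *)
Local Lemma om_slow : slow om.
Proof.
split; [intros k; apply Rmax_l|].
intros k; unfold om; eapply Rle_trans; [apply Rmax0_lip|].
pose proof (Lw_pos k) as L1; pose proof (Lw_pos (S k)) as L2.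
assert (M1 : Lw k <= Lw (S k)).
{ unfold Lw; pose proof (pow4_pos k); apply ln_le_mono.
  - generalize (W_ge1 _ (4 ^ k) (summable_sqr s Hs) ltac:(lra)); lra.
  - apply W_mono; [apply summable_sqr, Hs|simpl; lra]. }
assert (M2 : Lw (S k) <= 4 * Lw k) by (apply (lnW_4 s (4 ^ k)); auto; apply pow4_pos).
assert (E : forall i, ln (2 ^ i / (A * Lw i)) = INR i * ln 2 - ln A - ln (Lw i)).
{ intros i; pose proof (Lw_pos i); pose proof (pow2_pos i).
  unfold Rdiv; rewrite ln_mult, ln_Rinv, ln_mult, ln_pow_nat; try lra.
  - apply Rmult_lt_0_compat; assumption.
  - apply Rinv_0_lt_compat, Rmult_lt_0_compat; assumption. }
rewrite !E, S_INR.
pose proof (ln_le_mono _ _ L1 M1) as N1; pose proof (ln_le_mono _ _ L2 M2) as N2.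
rewrite ln_mult in N2 by lra.
replace (ln 4) with (2 * ln 2) in N2
  by (replace 4 with (2 * 2) by ring; rewrite ln_mult by lra; ring).
generalize ln2_le1, ln_lt_2; intros; apply Rabs_le; lra.
Qed.

Local Lemma cnt_om k m : cnt v k m * om k <= C0 * Lw k.
Proof.
unfold om, Rmax; destruct (Rle_dec _ _); [apply Hkey|].
rewrite Rmult_0_r; apply Rmult_le_pos; [lra|left; apply Lw_pos].
Qed.

(** Non-quasianalyticity of rho in dyadic form: [weighted_log_sum] for [s] itself with constant
    weight 1, where the right side is controlled by the sum of the s_j. *)
Lemma sum_Lw : exists B1, forall K, Rsum (fun k => (/ 2) ^ k * Lw k) K <= B1.
Proof.
destruct (dyadic_rounding s Hs) as [v' [l' [U' [HU' [Hv' [Hsv' Hvl']]]]]].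
destruct (summable_bounded s Hs) as [B [HB0 HB]].
assert (S1 : slow (fun _ => 1)).
{ split; intros; [lra|rewrite Rminus_diag, Rabs_R0; lra]. }
exists (INR U' * (48 * (2 * B))); intros K.
rewrite (Rsum_ext _ (fun k => ((/ 2) ^ k * 1) * Lw k)) by (intros; ring).
apply (weighted_log_sum_W s (fun k => (/ 2) ^ k * 1) K); [exact Hs|].
intros n; eapply Rle_trans;
  [apply (weighted_log_sum s v' l' U' (fun _ => 1) n K HU' Hsv' Hvl' S1)|].
apply Rmult_le_compat_l; [apply pos_INR|].
apply Rmult_le_compat_l; [lra|].
rewrite (Rsum_ext _ (fun j => 2 * v' j)) by (intros; ring).
rewrite Rsum_scal; apply Rmult_le_compat_l; [lra|].
eapply Rle_trans; [|apply (HB n)]; apply Rsum_le; intros j _; apply Hv'.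
Qed.

(** Group the factors by level: level k holds cnt v k n of them, each with v_j = 2^(-k), and cnt
    times om is at most C0 Lw by the key estimate. *)
Lemma sum_levels B1 n : (forall K, Rsum (fun k => (/ 2) ^ k * Lw k) K <= B1) ->
  Rsum (fun j => v j * om (l j)) n <= C0 * B1.
Proof.
intros HB1.
assert (HK : exists K, forall j, (j < n)%nat -> (l j < K)%nat).
{ clear; induction n as [|n [K HK]]; [exists O; lia|].
  exists (Nat.max K (S (l n))); intros j Hj.
  destruct (Nat.eq_dec j n); [subst; lia|specialize (HK j ltac:(lia)); lia]. }
destruct HK as [K HK].
assert (Hom : forall k, 0 <= om k) by apply om_slow.
apply Rle_trans with (Rsum (fun j =>
  Rsum (fun k => (/ 2) ^ k * om k * at_level v k j) K) n).
- apply Rsum_le; intros j Hj.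
  assert (Hpos : forall k, 0 <= (/ 2) ^ k * om k * at_level v k j).
  { intros k; repeat apply Rmult_le_pos; auto; [left; apply powh_pos|apply at_level_ge0]. }
  destruct (Hvl j) as [E|E].
  + rewrite E, Rmult_0_l; apply Rsum_ge0, Hpos.
  + eapply Rle_trans; [|apply (Rsum_ge_term _ K (l j) Hpos (HK j Hj))].
    unfold at_level; destruct (Req_EM_T (v j) ((/ 2) ^ l j)); [|contradiction].
    rewrite Rmult_1_r, E; lra.
- rewrite Rsum_exchange.
  apply Rle_trans with (Rsum (fun k => C0 * ((/ 2) ^ k * Lw k)) K).
  + apply Rsum_le; intros k _; rewrite Rsum_scal; fold (cnt v k n).
    replace ((/ 2) ^ k * om k * cnt v k n) with ((/ 2) ^ k * (cnt v k n * om k)) by ring.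
    replace (C0 * ((/ 2) ^ k * Lw k)) with ((/ 2) ^ k * (C0 * Lw k)) by ring.
    apply Rmult_le_compat_l; [left; apply powh_pos|apply cnt_om].
  + rewrite Rsum_scal; apply Rmult_le_compat_l; [lra|apply HB1].
Qed.

Let Wu t := W (fun j => u j ^ 2) t.

Lemma mild_integrand_W t :
  mild_integrand omega t = / 2 * ln (Wu (t ^ 2)) / t ^ 2 * ln (t / (/ 2 * ln (Wu (t ^ 2)))).
Proof.
assert (E : ln (Cmod (omega (RtoC t))) = / 2 * ln (Wu (t ^ 2))).
{ unfold Wu; rewrite <- Homega, ln_pow_nat; [simpl; field|].
  pose proof (W_ge1 _ (t ^ 2) (summable_sqr u Hu) (pow2_ge_0 t)) as Q.
  rewrite <- Homega in Q; generalize (Cmod_ge_0 (omega (RtoC t))); nra. }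
unfold mild_integrand; rewrite E; reflexivity.
Qed.

Lemma mild_continuous t : 1 <= t -> continuous (mild_integrand omega) t.
Proof.
intros Ht.
assert (Ht2 : 0 < t ^ 2) by (apply pow_lt; lra).
pose proof (lnW_pos u (t ^ 2) Hu Hu0 Ht2) as P; fold (Wu (t ^ 2)) in P.
assert (Wpos : 1 <= Wu (t ^ 2))
  by (apply W_ge1; [apply summable_sqr, Hu|lra]).
assert (cL : continuous (fun t => / 2 * ln (Wu (t ^ 2))) t).
{ apply (continuous_mult (K := R_AbsRing)); [apply continuous_const|].
  apply (continuous_comp (fun t => Wu (t ^ 2)) ln).
  - apply W_continuous, summable_sqr, Hu.
  - apply continuous_ln; lra. }
assert (ci : continuous (fun t => / t ^ 2) t).
{ apply continuity_pt_filterlim, continuity_pt_inv; [|lra].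
  apply derivable_continuous_pt; reg. }
assert (cq : continuous (fun t => t / (/ 2 * ln (Wu (t ^ 2)))) t).
{ apply (continuous_mult (K := R_AbsRing)); [apply continuous_id|].
  apply continuity_pt_filterlim, continuity_pt_inv; [|lra].
  apply continuity_pt_filterlim, cL. }
apply (continuous_ext (fun t => / 2 * ln (Wu (t ^ 2)) / t ^ 2
  * ln (t / (/ 2 * ln (Wu (t ^ 2)))))).
- intros x; symmetry; apply mild_integrand_W.
- apply (continuous_mult (K := R_AbsRing)).
  + apply (continuous_mult (K := R_AbsRing)); assumption.
  + apply (continuous_comp (fun t => t / (/ 2 * ln (Wu (t ^ 2)))) ln); [exact cq|].
    apply continuous_ln, Rdiv_lt_0_compat; lra.
Qed.

(** A bound for the integral over [2^k, 2^(k+1)]: the factor 2^(-k) in [mild_le] cancels the length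
    of the block. *)
Let H k := 2 * ((/ 2) ^ k * om k * ln (Wu (4 ^ k))) + A * ((/ 2) ^ k * Lw k).

Lemma mild_le k t : 2 ^ k <= t <= 2 ^ S k -> mild_integrand omega t <= (/ 2) ^ k * H k.
Proof.
intros Ht; pose proof (pow2_pos k) as P2; pose proof (powh_pos k) as PH; pose proof (pow4_pos k) as P4.
assert (Ht0 : 0 < t) by lra.
assert (Ht2 : 0 < t ^ 2) by (apply pow_lt; lra).
assert (E4 : 4 ^ k = (2 ^ k) ^ 2).
{ rewrite <- pow_mult, Nat.mul_comm, pow_mult; f_equal; ring. }
assert (Ei : (/ 2) ^ k = / 2 ^ k) by apply pow_inv.
pose proof (lnW_pos u (t ^ 2) Hu Hu0 Ht2) as P; fold (Wu (t ^ 2)) in P.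
pose proof (Lw_pos k) as PL.
rewrite mild_integrand_W.
(* x = ln |omega(t)| / t, so the integrand is (1 / t) x ln (1 / x). *)
set (x := / 2 * ln (Wu (t ^ 2)) / t).
(* The comparison value for [entropy_le]: ln (1 / y) is at most om k, and y itself is summable by
   [sum_Lw]. *)
set (y := A * Lw k / 2 ^ k).
assert (Hx : 0 < x) by (apply Rdiv_lt_0_compat; lra).
assert (Hy : 0 < y) by (apply Rdiv_lt_0_compat; [apply Rmult_lt_0_compat; assumption|exact P2]).
replace (t / (/ 2 * ln (Wu (t ^ 2)))) with (/ x) by (unfold x; field; lra).
replace (/ 2 * ln (Wu (t ^ 2)) / t ^ 2 * ln (/ x)) with (/ t * (x * ln (/ x)))
  by (unfold x; field; lra).
(* t <= 2^(k+1) and doubling give ln Wu (t^2) <= 4 ln Wu (4^k); the 2 is half of this 4. *)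
assert (Hxk : x <= 2 * ((/ 2) ^ k * ln (Wu (4 ^ k)))).
{ apply Rle_trans with (/ 2 * (4 * ln (Wu (4 ^ k))) * (/ 2) ^ k); [|right; field].
  unfold x, Rdiv; apply Rmult_le_compat; [lra|left; apply Rinv_0_lt_compat, Ht0| |].
  - apply Rmult_le_compat_l; [lra|].
    eapply Rle_trans; [|apply (lnW_4 u (4 ^ k)); assumption].
    apply ln_le_mono.
    + generalize (W_ge1 _ (t ^ 2) (summable_sqr u Hu) ltac:(lra)); unfold Wu; lra.
    + apply W_mono; [apply summable_sqr, Hu|split; [lra|]].
      replace (4 * 4 ^ k) with ((2 ^ S k) ^ 2) by (rewrite E4; simpl; ring).
      apply pow_incr; lra.
  - rewrite Ei; apply Rinv_le_contravar; lra. }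
assert (Hom : 0 <= om k) by apply om_slow.
assert (Hz : x * ln (/ x) <= x * om k + y).
{ eapply Rle_trans; [apply (entropy_le x y Hx Hy)|].
  apply Rplus_le_compat_r, Rmult_le_compat_l; [lra|].
  replace (/ y) with (2 ^ k / (A * Lw k)) by (unfold y; field; lra).
  apply Rmax_r. }
apply Rle_trans with (/ t * (x * om k + y)).
{ apply Rmult_le_compat_l; [left; apply Rinv_0_lt_compat, Ht0|exact Hz]. }
apply Rmult_le_compat.
- left; apply Rinv_0_lt_compat, Ht0.
- apply Rplus_le_le_0_compat; [apply Rmult_le_pos; lra|lra].
- rewrite Ei; apply Rinv_le_contravar; lra.
- unfold H; apply Rplus_le_compat.
  + replace (2 * ((/ 2) ^ k * om k * ln (Wu (4 ^ k))))
      with (2 * ((/ 2) ^ k * ln (Wu (4 ^ k))) * om k) by ring.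
    apply Rmult_le_compat_r; assumption.
  + right; unfold y; rewrite Ei; field; lra.
Qed.

Lemma mild_integral_bounded :
  exists B, forall K, RInt (mild_integrand omega) 1 (2 ^ K) <= B.
Proof.
destruct sum_Lw as [B1 HB1].
destruct (summable_bounded u Hu) as [Bu [HBu0 HBu]].
(* In the bound of [weighted_log_sum] the terms v_j om(l_j) sum to at most C0 B1 by [sum_levels],
   and the terms v_j to at most Bu. *)
set (B2 := INR U * (48 * (C0 * B1 + Bu))).
assert (HB2 : forall K, Rsum (fun k => (/ 2) ^ k * om k * ln (Wu (4 ^ k))) K <= B2).
{ intros K; apply (weighted_log_sum_W u (fun k => (/ 2) ^ k * om k) K); [exact Hu|].
  intros n; eapply Rle_trans;
    [apply (weighted_log_sum u v l U om n K HU Huv Hvl om_slow)|].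
  apply Rmult_le_compat_l; [apply pos_INR|].
  apply Rmult_le_compat_l; [lra|].
  rewrite (Rsum_ext _ (fun j => v j * om (l j) + v j)) by (intros; ring).
  rewrite Rsum_plus; apply Rplus_le_compat; [apply sum_levels, HB1|].
  eapply Rle_trans; [|apply (HBu n)]; apply Rsum_le; intros j _; apply Hvu. }
assert (EX : forall a b, 1 <= a <= b -> ex_RInt (mild_integrand omega) a b).
{ intros a b Hab; apply (ex_RInt_continuous (V := R_CompleteNormedModule)).
  intros z Hz; rewrite Rmin_left in Hz by lra; apply mild_continuous; lra. }
assert (Q : forall K, RInt (mild_integrand omega) 1 (2 ^ K) <= Rsum H K).
{ induction K as [|K IH].
  - simpl; rewrite RInt_point; apply Rle_refl.
  - assert (P1 : 1 <= 2 ^ K) by (apply pow_R1_Rle; lra).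
    assert (P2 : 2 ^ K <= 2 ^ S K) by (simpl; lra).
    rewrite <- (RInt_Chasles (V := R_CompleteNormedModule) _ 1 (2 ^ K) (2 ^ S K))
      by (apply EX; lra).
    apply Rplus_le_compat; [exact IH|].
    apply Rle_trans with (RInt (fun _ => (/ 2) ^ K * H K) (2 ^ K) (2 ^ S K)).
    + apply RInt_le; [exact P2|apply EX; lra|apply ex_RInt_const|].
      intros t Ht; apply mild_le; lra.
    + rewrite RInt_const; right; unfold scal; simpl; unfold mult; simpl.
      replace ((2 * 2 ^ K - 2 ^ K) * ((/ 2) ^ K * H K))
        with (((/ 2) ^ K * 2 ^ K) * H K) by ring.
      rewrite half_pow; ring. }
exists (2 * B2 + A * B1); intros K; eapply Rle_trans; [apply Q|].
unfold H; rewrite Rsum_plus, !Rsum_scal.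
apply Rplus_le_compat; apply Rmult_le_compat_l; try lra; [apply HB2|apply HB1].
Qed.

End Integral.

(** * The symbol built from omega, and its non-invertibility for every larger rho *)

Lemma entire_product_le c F z : summable c ->
  (exists e, is_lim_seq e (Finite 0) /\ forall n, Cmod (F z - pz c n z)%C <= e n) ->
  Cmod (F z) <= W c (Cmod z ^ 2).
Proof.
intros Hc [e [He H]]; apply Rminus_le, (le_of_lim_0 _ e He); intros n.
pose proof (Cmod_le_sub (F z) (pz c n z)) as T.
pose proof (pz_le_W c n z (Cmod z) Hc (Rle_refl _)).
specialize (H n); lra.
Qed.

Theorem theorem3p11 :
  forall omega : C -> C, in_Omega omega ->
  is_lim (fun x => RInt (mild_integrand omega) 1 x) p_infty p_infty ->
  exists (T : Dspace omega -> Dspace omega) (f : C -> C),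
    ultradiff_op omega T /\
    constant_coeff omega T /\
    symbol omega f /\
    (forall phi : Dspace omega, fD f phi (T phi)) /\
    convergence_type omega f /\
    (exists z : C, f z <> RtoC 0) /\
    forall rho : C -> C, in_Omega rho ->
      (exists c0 : R, 0 < c0 /\
        forall t : R, Cmod (omega (RtoC t)) <= c0 * Cmod (rho (RtoC t))) ->
      ~ invertible_in_dual rho f.
Proof.
intros omega Homega Hdiv.
destruct (in_Omega_W omega Homega) as [u [Hu [Hu0 Eu]]].
destruct (dyadic_rounding u Hu) as [v [l [U [HU [Hvu [Huv Hvl]]]]]].
assert (Hv : summable v) by (apply summable_le with u; assumption).
pose proof (summable_sqr u Hu) as Hu2; pose proof (summable_sqr v Hv) as Hv2.
assert (Hvu2 : forall x, 0 <= x -> W (fun j => v j ^ 2) x <= W (fun j => u j ^ 2) x).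
{ intros x Hx; apply W_mono_c; auto; intros j; apply pow_incr, Hvu. }
destruct (entire_product _ Hv2) as [F [HF DF]].
assert (FW : forall z, Cmod (F z) <= W (fun j => u j ^ 2) (Cmod z ^ 2)).
{ intros z; eapply Rle_trans; [apply (entire_product_le _ F z Hv2 (HF z))|].
  apply Hvu2, pow2_ge_0. }
set (w := fun t => W (fun j => u j ^ 2) (t ^ 2)).
assert (Hw : weight w) by (apply weight_W; assumption).
assert (Ew : forall t, w t = Cmod (omega (RtoC t)) ^ 2) by (intros t; symmetry; apply Eu).
assert (Hwc : forall t, W (fun j => v j ^ 2) (t ^ 2) <= 1 * w t).
{ intros t; rewrite Rmult_1_l; apply Hvu2, pow2_ge_0. }
destruct (operator_exists omega w _ F 1 Hw Ew Hv2 Hwc HF) as [T [HT [HTc FT]]].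
exists T, F; split; [exact HT|split; [exact HTc|split; [|split; [exact FT|split; [|split]]]]].
- split; [exact DF|split].
  + intros eps He; destruct (W_exp_type u Hu eps He) as [A HA].
    exists A; intros z; eapply Rle_trans; [apply FW|apply HA, Cmod_ge_0].
  + exists 2%nat, 1; split; [lia|split; [lra|]]; intros t.
    rewrite Rmult_1_l, Cmod_Cpow, Eu.
    rewrite <- (Cmod_Ci_mult t); apply FW.
- exists 2%nat, 1; split; [lia|split; [lra|]]; intros z.
  rewrite Rmult_1_l, Cmod_Cpow, Eu; apply FW.
(* F(0) = 1. This clause excludes the zero symbol, for which surjectivity fails trivially. *)
- exists (RtoC 0); intros E.
  destruct (HF (RtoC 0)) as [e [He H]].
  assert (Q : forall n, pz (fun j => (v j ^ 2)%R) n (RtoC 0) = RtoC 1).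
  { intros n; rewrite pz_real; f_equal; unfold PW.
    induction n as [|n IH]; [reflexivity|].
    cbn [Rprod]; rewrite IH; ring. }
  assert (Z : RtoC 0 = RtoC 1).
  { apply (C_eq_of_lim _ _ e He); intros n; rewrite <- E at 1; rewrite <- (Q n); apply H. }
  apply (f_equal fst) in Z; simpl in Z; lra.
(* The symbol was fixed by omega alone; rho enters through its own product and the constant c0^2. *)
- intros rho Hrho [c0 [Hc0 Hle]] Hinv.
  destruct (in_Omega_W rho Hrho) as [s [Hs [Hs0 Es]]].
  set (wr := fun t => W (fun j => s j ^ 2) (t ^ 2)).
  assert (Hwr : weight wr) by (apply weight_W; assumption).
  assert (Ewr : forall t, wr t = Cmod (rho (RtoC t)) ^ 2) by (intros t; symmetry; apply Es).
  assert (Hwcr : forall t, W (fun j => v j ^ 2) (t ^ 2) <= c0 ^ 2 * wr t).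
  { intros t; eapply Rle_trans; [apply Hvu2, pow2_ge_0|].
    rewrite <- Eu, Ewr, <- Rpow_mult_distr; apply pow_incr; split;
      [apply Cmod_ge_0|apply Hle]. }
  assert (Hneg : ~ forall n eps, 0 < eps -> exists phi, rap wr phi /\ cs 2 phi /\
    1 <= Cmod (phi 0) /\
    forall t, Cmod (F (Ci * RtoC t) * fourier phi t)%C * wr t ^ n <= eps).
  { intros Htest.
    exact (not_invertible_criterion rho wr _ F (c0 ^ 2) Hwr Ewr Hv2 Hwcr HF Htest Hinv). }
  (* Invertibility forbids test functions for all n and eps; the classical negation provides one
     pair at which they fail, as [key_estimate] requires. *)
  apply not_all_ex_not in Hneg; destruct Hneg as [n Hneg].
  apply not_all_ex_not in Hneg; destruct Hneg as [eps Hneg].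
  apply imply_to_and in Hneg; destruct Hneg as [Heps Hneg].
  destruct (key_estimate s v F (c0 ^ 2) n eps Hs Hs0 Hv Hwcr HF Heps)
    as [A [C0 [HA [HC0 Hkey]]]].
  { intros phi H1 H2 H3 H4; apply Hneg; exists phi; auto. }
  destruct (mild_integral_bounded omega u s v l U A C0) as [B HB]; auto.
  apply is_lim_spec in Hdiv.
  destruct (Hdiv B) as [N HN].
  (* The integral is at most [B] at every 2^K, and one of these lies beyond the point from which it
     exceeds [B]. *)
  destruct (Pow_x_infinity 2 ltac:(rewrite Rabs_right; lra) (N + 1)) as [K HK].
  specialize (HK K (Nat.le_refl K)).
  rewrite Rabs_right in HK by (apply Rle_ge, pow_le; lra).
  specialize (HN (2 ^ K) ltac:(lra)); specialize (HB K); lra.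
Qed.
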